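(* Let $\mathfrak A$ be an extendible ideal of $n$-linear operators, and let $E_1,\dots,E_n,F$ be Banach spaces. (1) If $\mathfrak A$ is $F$-Arens stable and has the $F$-Radon-Nikodým property, and $E_1',\dots,E_n',F$ have Schauder bases $(e_{j_1}')_{j_1},\dots,(e_{j_n}')_{j_n},(f_l)_l$ respectively, then the monomials $\big(e_{j_1}'(\cdot)\cdots e_{j_n}'(\cdot)\cdot f_l\big)_{j_1,\dots,j_n,l}$ with the square ordering form a Schauder basis of $\mathfrak A(E_1,\dots,E_n;F)$. (2) If $\mathfrak A$ is $F''$-Arens stable and has the $F''$-Radon-Nikodým property, $F''$ has the bounded approximation property, $E_1,\dots,E_n$ have shrinking Schauder bases $(e_{j_1})_{j_1},\dots,(e_{j_n})_{j_n}$ respectively, and $F$ has a Schauder basis $(f_l)_l$, then the monomials $\big(e_{j_1}'(\cdot)\cdots e_{j_n}'(\cdot)\cdot f_l\big)_{j_1,\dots,j_n,l}$, where $(e_{j_k}')_{j_k}$ are the coordinate functionals of $(e_{j_k})_{j_k}$, with the square ordering form a Schauder basis of $\mathfrak A(E_1,\dots,E_n;F)$.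
   Context: Banach spaces are over $\mathbb K=\mathbb R$ or $\mathbb C$; $E'$ is the dual of $E$. $\mathcal L(E_1,\dots,E_n;F)$ is the space of continuous $n$-linear operators with the sup norm on unit balls. A linear operator $S:E\to F$ is a metric surjection if it is surjective and $\|S(x)\|=\inf\{\|y\|:S(y)=S(x)\}$ for all $x$. Ideal of $n$-linear operators: a pair $(\mathfrak A,\|\cdot\|_{\mathfrak A})$ such that (i) each $\mathfrak A(E_1,\dots,E_n;F)=\mathfrak A\cap\mathcal L(E_1,\dots,E_n;F)$ is a linear subspace of $\mathcal L(E_1,\dots,E_n;F)$ and a Banach space under $\|\cdot\|_{\mathfrak A}$; (ii) if $R_j\in\mathcal L(X_j;E_j)$, $T\in\mathfrak A(E_1,\dots,E_n;F)$, $S\in\mathcal L(F;Y)$, then $S\circ T\circ(R_1,\dots,R_n)\in\mathfrak A(X_1,\dots,X_n;Y)$ with $\mathfrak A$-norm at most $\|S\|\,\|T\|_{\mathfrak A}\|R_1\|\cdots\|R_n\|$; (iii) $(\lambda_1,\dots,\lambda_n)\mapsto\lambda_1\cdots\lambda_n$ belongs to $\mathfrak A$ with norm $1$. Associated tensor norm ($\mathfrak A\sim\alpha$): $\alpha$ is the unique finitely generated tensor norm of order $n+1$ with $\mathfrak A(M_1,\dots,M_n;N)=(M_1'\otimes\cdots\otimes M_n'\otimes N;\alpha)$ isometrically for all finite dimensional $M_j,N$. (A tensor norm of order $m$ assigns to normed spaces $E_1,\dots,E_m$ a norm on $\otimes_j E_j$ with $\varepsilon\le\alpha\le\pi$ (injective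 and projective norms) and $\|T_1\otimes\cdots\otimes T_m\|\le\|T_1\|\cdots\|T_m\|$; it is finitely generated if $\alpha(z;\otimes E_j)=\inf\alpha(z;\otimes M_j)$ over finite dimensional $M_j\subset E_j$ with $z\in\otimes M_j$.) $\widetilde\otimes$ denotes completion. For a Banach space $G$, $\mathfrak A$ has the $G$-Radon-Nikodým property if for all index sets $J_1,\dots,J_n$ the canonical mapping $(\ell_1(J_1)\widetilde\otimes\cdots\widetilde\otimes\ell_1(J_n)\widetilde\otimes G,\alpha)\to\mathfrak A(c_0(J_1),\dots,c_0(J_n);G)$, $x_1'\otimes\cdots\otimes x_n'\otimes g\mapsto x_1'(\cdot)\cdots x_n'(\cdot)g$, is a metric surjection. Extendible: for all Banach spaces $E_j,F$, superspaces $G_j\supset E_j$ and $T\in\mathfrak A(E_1,\dots,E_n;F)$ there is an extension $\widetilde T\in\mathfrak A(G_1,\dots,G_n;F)$ of $T$ with the same $\mathfrak A$-norm. $G$-Arens stable: for $T\in\mathcal L(E_1,\dots,E_n;G)$ the $k$-Arens extension $Ext_k(T)\in\mathcal L(E_1,\dots,E_k'',\dots,E_n;G'')$ is $Ext_k(T)(x_1,\dots,x_k'',\dots,x_n)(y')=x_k''\big(z\mapsto y'(T(x_1,\dots,x_{k-1},z,x_{k+1},\dots,x_n))\big)$. $\mathfrak A$ is $G$-Arens stable if for all $1\le k\le n$ and all $E_1,\dots,E_n$, $Ext_k$ is well defined (in particular $G$-valued) and isometric as a map $\mathfrak A(E_1,\dots,E_n;G)\to\mathfrak A(E_1,\dots,E_{k-1},E_k'',E_{k+1},\dots,E_n;G)$.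 Square ordering (of Gelbaum–Gil de Lamadrid): on $\mathbb N^2$, enumerate by blocks $k=1,2,\dots$, the $k$-th block (pairs with maximum $k$) being $(1,k),(2,k),\dots,(k,k),(k,k-1),\dots,(k,1)$. On $\mathbb N^{m}$ it is defined recursively: enumerate $\mathbb N^{m-1}$ by its square ordering, thereby identify $\mathbb N^{m}=\mathbb N^{m-1}\times\mathbb N$ with $\mathbb N\times\mathbb N$, and use the ordering of $\mathbb N^2$. *)

(* Defs.v *)
From HB Require Import structures.
From mathcomp Require Import all_boot all_order all_algebra finmap.
From mathcomp Require Import complex.
From mathcomp Require Import all_classical all_reals all_analysis.
From mathcomp Require Import ring lra.
From mathcomp Require summability.

Set Implicit Arguments.
Unset Strict Implicit.
Unset Printing Implicit Defensive.

Import Order.TTheory GRing.Theory Num.Theory.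
Import numFieldNormedType.Exports.

Local Open Scope classical_set_scope.
Local Open Scope ring_scope.

Inductive is_real_or_complex : numFieldType -> Prop :=
| IsReal (R : realType) : is_real_or_complex R
| IsComplex (R : realType) : is_real_or_complex R[i]%C.

Record scalarField := ScalarField {
  scalar_sort :> numFieldType;
  scalarP : is_real_or_complex scalar_sort }.


Lemma complex_complete (R : realType) (K := R[i]%C : numFieldType)
  (F : set_system K) : ProperFilter F -> cauchy F -> cvg F.
Proof.
move=> FF /cauchy_ballP Fc.
have proj_cvg (p : R[i]%C -> R) :
    (forall x y : K, `|p x - p y|%:C%C <= `|x - y|) -> cvg (p @ F).
  move=> pc; apply: R_complete; apply/cauchy_ballP => e e0.
  have e0' : 0 < e%:C%C :> K by rewrite ltcR.
  have := Fc _ e0'; rewrite !near_simpl => FF2.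
  rewrite !near_map2.
  apply: filterS FF2 => -[x y] /=; rewrite -!ball_normE /= => xy.
  by rewrite -ltcR; apply: le_lt_trans xy; exact: pc.
have Recvg : cvg ((fun x : K => complex.Re x) @ F).
  apply: proj_cvg => -[a b] [c d] /=.
  rewrite normc_def lecR /= -[leLHS]sqrtr_sqr.
  by rewrite ler_sqrt ?lerDl ?sqr_ge0// addr_ge0// sqr_ge0.
have Imcvg : cvg ((fun x : K => complex.Im x) @ F).
  apply: proj_cvg => -[a b] [c d] /=.
  rewrite normc_def lecR /= -[leLHS]sqrtr_sqr.
  by rewrite ler_sqrt ?lerDr ?sqr_ge0// addr_ge0// sqr_ge0.
move/cvg_ex : Recvg => [a /cvgrPdist_lt Fa].
move/cvg_ex : Imcvg => [b /cvgrPdist_lt Fb].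
apply/cvg_ex; exists ((a +i* b)%C : K); apply/cvgrPdist_lt => e e0.
have e2 : 0 < complex.Re e / 2.
  by move: e0; case: e => x y; rewrite ltcE /= => /andP[_ ?]; rewrite divr_gt0.
apply: filterS2 (Fa _ e2) (Fb _ e2) => -[c d] /= ac bd.
have -> : e = (complex.Re e)%:C%C.
  by move: e0; case: (e) => x y; rewrite ltcE /= => /andP[/eqP -> _].
rewrite normc_def ltcR /= (_ : complex.Re e = complex.Re e / 2 + complex.Re e / 2); last first.
  by rewrite -splitr.
have h : Num.sqrt ((a - c) ^+ 2 + (b - d) ^+ 2) <= `|a - c| + `|b - d|.
  rewrite -[leRHS](ger0_norm (addr_ge0 (normr_ge0 _) (normr_ge0 _))).
  rewrite -[leRHS]sqrtr_sqr.
  rewrite ler_sqrt ?sqr_ge0//.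
  rewrite [leRHS]sqrrD -!normrX !(ger0_norm (sqr_ge0 _)) addrAC lerDl.
  by rewrite mulrn_wge0// mulr_ge0.
by apply: le_lt_trans h _; rewrite ltrD.
Qed.

Section Scalars.
Variable K : scalarField.

Lemma scalar_complete (F : set_system K) : ProperFilter F -> cauchy F -> cvg F.
Proof.
case: K F => _ [R|R] F; [exact: R_complete | exact: complex_complete].
Qed.

Lemma scalar_sup (A : set K) (M : K) : A !=set0 ->
  (forall x, A x -> 0 <= x <= M) -> supremums A !=set0.
Proof.
case: K A M => _ [R|R] A M /= A0 AM.
  have hA : has_sup A by split => //; exists M => x /AM/andP[].
  exists (sup A); split; first exact: sup_upper_bound.
  by move=> y; exact: ge_sup.
pose B := [set r : R | A r%:C%C].
have AE x : A x -> x = (complex.Re x)%:C%C.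
  by move=> /AM/andP[]; case: x => a b; rewrite lecE /= => /andP[/eqP ->].
have hB : has_sup B.
  case: A0 => x Ax; split; first by exists (complex.Re x); rewrite /B /= -AE.
  exists (complex.Re M) => r /AM/andP[_]; rewrite lecE /=.
  by case/andP.
exists ((sup B)%:C%C); split.
  move=> x Ax; rewrite (AE _ Ax) lecR; apply: sup_upper_bound => //.
  by rewrite /B /= -AE.
move=> [c d] ub; rewrite lecE /=.
case: (A0) => x Ax; have := ub _ Ax; rewrite (AE _ Ax) lecE /= => /andP[/eqP <- _].
rewrite eqxx /=; apply: ge_sup; first by case: hB.
by move=> r /ub; rewrite lecE /= => /andP[].
Qed.

Lemma ksup_ge (A : set K) (M x : K) : (forall x, A x -> 0 <= x <= M) -> A x ->
  x <= supremum 0 A.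
Proof.
move=> AM Ax; have A0 : A !=set0 by exists x.
rewrite /supremum ifF; last exact/negbTE/set0P.
have [s As] := scalar_sup A0 AM.
by case: xgetP => [y -> [yu _]|/(_ s)//]; exact: yu.
Qed.

Lemma ksup_le (A : set K) (M : K) : (forall x, A x -> 0 <= x <= M) -> 0 <= M ->
  supremum 0 A <= M.
Proof.
move=> AM M0; rewrite /supremum; case: ifPn => // /set0P A0.
by case: xgetP => [y -> [_ yl]|//]; apply: yl => x /AM/andP[].
Qed.

Lemma ksup_ge0 (A : set K) (M : K) : (forall x, A x -> 0 <= x <= M) ->
  0 <= supremum 0 A.
Proof.
move=> AM; have [->|/set0P [x Ax]] := eqVneq A set0; first by rewrite supremum0.
by apply: le_trans (ksup_ge AM Ax); case/andP: (AM _ Ax).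
Qed.

End Scalars.

Section NormedSubspace.
Variables (K : numFieldType) (V : lmodType K).

Definition subspace_closed (S : set V) :=
  S 0 /\ forall (a : K) u v, S u -> S v -> S (a *: u + v).

Definition norm_on (S : set V) (N : V -> K) :=
  [/\ forall u v, S u -> S v -> N (u + v) <= N u + N v,
      forall (a : K) u, S u -> N (a *: u) = `|a| * N u
    & forall u, S u -> N u = 0 -> u = 0].

(* A linear subspace of V with its own norm, not related to any norm of V. *)
Record normed_sub := NormedSub {
  ns_set :> set V;
  ns_norm : V -> K;
  ns_closed : subspace_closed ns_set;
  ns_normP : norm_on ns_set ns_norm }.

Record ns_type (S : normed_sub) := NsType {
  ns_val : V;
  ns_valP : ns_val \in (ns_set S) }.

Variable S : normed_sub.

HB.instance Definition _ := [isSub for @ns_val S].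
HB.instance Definition _ := [Choice of ns_type S by <:].

Lemma ns_submod_closed : GRing.submod_closed (mem (ns_set S)).
Proof.
have [S0 SD] := ns_closed S; split; first exact/mem_set.
by move=> a u v /set_mem Su /set_mem Sv; exact/mem_set/SD.
Qed.

HB.instance Definition _ := GRing.SubChoice_isSubLmodule.Build K V
  (mem (ns_set S)) (ns_type S) ns_submod_closed.

Let N (u : ns_type S) : K := ns_norm S (\val u).

Let ND u v : N (u + v) <= N u + N v.
Proof.
have [+ _ _] := ns_normP S; rewrite /N linearD; apply; exact/set_mem/valP.
Qed.

Let NZ a u : N (a *: u) = `|a| * N u.
Proof.
have [_ + _] := ns_normP S; rewrite /N linearZ; apply; exact/set_mem/valP.
Qed.

Let N0 u : N u = 0 -> u = 0.
Proof.
have [_ _ +] := ns_normP S => H /H Nu; apply: val_inj; rewrite linear0.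
by apply: Nu; exact/set_mem/valP.
Qed.

HB.instance Definition _ := Lmodule_isNormed.Build K (ns_type S) ND NZ N0.

Lemma ns_normE (u : ns_type S) : `|u| = ns_norm S (\val u).
Proof. by []. Qed.

End NormedSubspace.

Record banach_sub (K : numFieldType) (V : lmodType K) := BanachSub {
  bs_sub :> normed_sub V;
  bs_complete : forall F : set_system (ns_type bs_sub),
    ProperFilter F -> cauchy F -> cvg F }.

Definition bs_type (K : numFieldType) (V : lmodType K) (B : banach_sub V) : Type :=
  ns_type B.

Section BanachSubspace.
Variables (K : numFieldType) (V : lmodType K) (B : banach_sub V).
HB.instance Definition _ := NormedModule.on (bs_type B).
HB.instance Definition _ := SubChoice.on (bs_type B).
HB.instance Definition _ := Uniform_isComplete.Build (bs_type B) (@bs_complete _ _ B).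
End BanachSubspace.


Section SupNorm.
Variables (K : scalarField) (V : lmodType K) (T : Type) (D : set T).
Variables (q : T -> V -> K) (S : set V).
Hypothesis Sc : subspace_closed S.
Hypothesis q_ge0 : forall t u, 0 <= q t u.
Hypothesis qD : forall t u v, q t (u + v) <= q t u + q t v.
Hypothesis qZ : forall t a u, q t (a *: u) = `|a| * q t u.
Hypothesis q_bnd : forall u, S u -> exists M, forall t, D t -> q t u <= M.
Hypothesis q_sep : forall u, S u -> (forall t, D t -> q t u = 0) -> u = 0.

Let N u := supremum 0 [set q t u | t in D].

Lemma sup_norm_ge u t : S u -> D t -> q t u <= N u.
Proof.
move=> /q_bnd[M uM] Dt; apply: (@ksup_ge _ _ M); last by exists t.
by move=> _ [s Ds <-]; rewrite q_ge0 uM.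
Qed.

Lemma sup_norm_le u M : 0 <= M -> (forall t, D t -> q t u <= M) -> N u <= M.
Proof.
move=> M0 uM; apply: ksup_le => // _ [t Dt <-].
by rewrite q_ge0 uM.
Qed.

Lemma sup_norm_ge0 u : S u -> 0 <= N u.
Proof.
move=> /q_bnd[M uM]; apply: (@ksup_ge0 _ _ M) => _ [t Dt <-].
by rewrite q_ge0 uM.
Qed.

Lemma sup_norm_on : norm_on S N.
Proof.
have [S0 SD] := Sc.
have SZ a u : S u -> S (a *: u).
  by move=> Su; rewrite -[_ *: _]addr0; exact: SD.
have NZ a u : S u -> N (a *: u) <= `|a| * N u.
  move=> Su; apply: sup_norm_le => [|t Dt].
    by rewrite mulr_ge0 ?sup_norm_ge0.
  by rewrite qZ ler_wpM2l ?sup_norm_ge.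
split=> [u v Su Sv|a u Su|u Su Nu0].
- apply: sup_norm_le => [|t Dt]; first by rewrite addr_ge0 ?sup_norm_ge0.
  by apply: le_trans (qD _ _ _) _; rewrite lerD ?sup_norm_ge.
- apply/eqP; rewrite eq_le NZ //=.
  have [->|a0] := eqVneq a 0.
    by rewrite normr0 mul0r; apply: sup_norm_ge0; exact: SZ.
  rewrite -ler_pdivlMl ?normr_gt0// -normfV.
  by have := NZ a^-1 (a *: u) (SZ _ _ Su); rewrite scalerA mulVf// scale1r.
- apply: q_sep => // t Dt; apply/eqP; rewrite eq_le q_ge0 andbT -Nu0.
  exact: sup_norm_ge.
Qed.

End SupNorm.

Section SupNormComplete.
Variables (K : scalarField) (T : Type) (D : set T) (S : normed_sub (T -> K^o)).
Hypothesis S_norm :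
  ns_norm S = fun f => supremum 0 [set `|f t| | t in D].
Hypothesis S_bnd : forall f : T -> K^o, ns_set S f ->
  exists M, forall t, D t -> `|f t| <= M.
Hypothesis S_eval : forall t, exists2 C, 0 <= C &
  forall f : T -> K^o, ns_set S f -> `|f t| <= C * ns_norm S f.
(* S is stable under limits that are pointwise on T and uniform on D *)
Hypothesis S_lim : forall g : T -> K^o,
  (forall (r s t : T) (e : K), 0 < e -> exists f : T -> K^o, [/\ ns_set S f,
     [/\ `|f r - g r| < e, `|f s - g s| < e & `|f t - g t| < e] &
     forall x, D x -> `|f x - g x| <= e]) -> ns_set S g.

Lemma sup_norm_complete (F : set_system (ns_type S)) :
  ProperFilter F -> cauchy F -> cvg F.
Proof.
move=> FF /cauchy_ballP Fc.
have Fc' t : cvg ((fun u : ns_type S => (\val u t : K)) @ F).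
  apply: scalar_complete; apply/cauchy_ballP => e e0.
  have [C C0 SC] := S_eval t.
  have d0 : 0 < e / (C + 1) by rewrite divr_gt0// ltr_wpDl.
  have := Fc _ d0; rewrite !near_simpl => FF2.
  rewrite !near_map2.
  apply: filterS FF2 => -[x y] /=; rewrite -!ball_normE /= => xy.
  have := SC _ (set_mem (valP (x - y))).
  rewrite -ns_normE linearB => /le_lt_trans; apply.
  rewrite ltr_pdivlMr ?ltr_wpDl// in xy.
  by apply: le_lt_trans xy; rewrite mulrC ler_wpM2l// lerDl.
pose g : T -> K^o := fun t => lim ((fun u : ns_type S => (\val u t : K)) @ F).
have gF t : (fun u : ns_type S => (\val u t : K)) @ F --> g t by exact: Fc'.
have Fg e : 0 < e -> \forall u \near F, forall t, D t -> `|\val u t - g t| <= e.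
  move=> e0; have := Fc _ e0; rewrite !near_simpl => FF2.
  have [[A B] /= [FA FB] AB] := FF2.
  apply: filterS FA => u Au t Dt.
  have H : \forall v \near F, `|\val u t - \val v t| <= e.
    apply: filterS FB => v Bv.
    have /= := AB (u, v) (conj Au Bv); rewrite -ball_normE /= => /ltW uv.
    apply: le_trans uv; rewrite [leRHS]ns_normE S_norm linearB.
    have [M uM] := S_bnd (set_mem (valP (u - v))).
    apply: (@ksup_ge _ _ M) => [_ [s Ds <-]|]; last by exists t.
    by rewrite normr_ge0 /=; have := uM s Ds; rewrite linearB.
  apply/ler_addgt0Pr => d d0.
  have Hd : \forall v \near F, `|\val v t - g t| < d.
    by have /cvgrPdistC_lt := gF t; apply.
  have [v [h1 h2]] := filter_ex (filterI H Hd).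
  by rewrite -(subrKA (\val v t)) (le_trans (ler_normD _ _))// lerD// ltW.
have Sg : ns_set S g.
  apply: S_lim => r s t e e0.
  have Fe x : \forall u \near F, `|\val u x - g x| < e.
    by have /cvgrPdistC_lt := gF x; apply.
  have [u [h1 [h2 [h3 h4]]]] :=
    filter_ex (filterI (Fe r) (filterI (Fe s) (filterI (Fe t) (Fg _ e0)))).
  by exists (\val u); split => //; exact/set_mem/valP.
apply/cvg_ex; exists (NsType (mem_set Sg)).
apply/cvgrPdistC_le => e e0.
apply: filterS (Fg _ e0) => u ug.
rewrite [leLHS]ns_normE S_norm linearB.
apply: ksup_le (ltW e0) => _ [t Dt <-].
by rewrite normr_ge0 /=; exact: ug.
Qed.

End SupNormComplete.

(* Norms take values in K and, when K is complex, suprema are taken for the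
   partial order of K; they exist by scalar_sup. *)
Definition opnorm (K : numFieldType) (X Y : normedModType K) (f : X -> Y) : K :=
  supremum 0 [set `|f x| | x in [set x | `|x| <= 1]].

Section Dual.
Variables (K : scalarField) (X : normedModType K).

Definition dual_set : set (X -> K^o) := [set f | linear f /\ continuous f].

Let ball1 : set X := [set x | `|x| <= 1].

Lemma dual_set_closed : subspace_closed dual_set.
Proof.
split; first by split=> [a u v|]; [rewrite scaler0 addr0|exact: cst_continuous].
move=> a f g [fl fc] [gl gc]; split=> [b u v|x].
  rewrite !fctE fl gl !scalerDr addrACA; congr (_ + _ + _).
  by rewrite /GRing.scale /= mulrCA.
by apply: cvgD; [apply: cvgZr; exact: fc|exact: gc].
Qed.

Lemma dual_set_bounded (f : X -> K^o) : dual_set f ->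
  exists2 C, 0 <= C & forall x, `|f x| <= C * `|x|.
Proof.
move=> [fl fc].
pose L := GRing.isLinear.Build _ _ _ _ f fl.
pose f' : {linear X -> K^o} := HB.pack f L.
have /linear_boundedP : bounded_near f' (nbhs 0).
  by apply/linear_bounded_continuous.
by move=> /pinfty_ex_gt0[C C0 fC]; exists C => //; exact: ltW.
Qed.

Lemma dual_set_bounded1 (f : X -> K^o) : dual_set f ->
  exists M, forall x, ball1 x -> `|f x| <= M.
Proof.
move=> /dual_set_bounded[C C0 fC]; exists C => x x1.
by apply: le_trans (fC x) _; rewrite ler_piMr.
Qed.

Lemma dual_set0 (f : X -> K^o) : dual_set f -> f 0 = 0.
Proof. by move=> [fl _]; have := fl (-1) 0 0; rewrite scaler0 addr0 scaleN1r addNr. Qed.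

Lemma dual_setZ (f : X -> K^o) a x : dual_set f -> f (a *: x) = a *: f x.
Proof.
by move=> df; have [fl _] := df; have := fl a x 0; rewrite !addr0 dual_set0// addr0.
Qed.

Lemma dual_set_eval (f : X -> K^o) x : dual_set f ->
  `|f x| <= `|x| * supremum 0 [set `|f y| | y in ball1].
Proof.
move=> df; have [->|x0] := eqVneq x 0; first by rewrite dual_set0// !normr0 mul0r.
rewrite -ler_pdivrMl ?normr_gt0//.
have [M fM] := dual_set_bounded1 df.
apply: (@ksup_ge _ _ M) => [_ [y y1 <-]|]; first by rewrite normr_ge0 fM.
exists (`|x|^-1 *: x).
  by rewrite /ball1 /= normrZ normfV normr_id mulVf// normr_eq0.
by rewrite dual_setZ// [LHS]normrZ normfV normr_id.
Qed.

Lemma dual_norm_on : norm_on dual_set (@opnorm K X K^o).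
Proof.
apply: (@sup_norm_on _ _ _ ball1 (fun x f => `|f x|)).
- exact: dual_set_closed.
- by [].
- by move=> x u v; exact: ler_normD.
- by move=> x a u; rewrite -normrM.
- exact: dual_set_bounded1.
- move=> f df f0; apply/funext => x; apply/eqP; rewrite -normr_le0.
  have := dual_set_eval x df; congr (_ <= _).
  rewrite (_ : [set _ | _ in _] = [set 0]) ?supremum1 ?mulr0//.
  apply/seteqP; split=> [_ [y y1 <-]|_ ->]; first exact: f0.
  by exists 0; rewrite /ball1 /= ?normr0 ?ler01// dual_set0// normr0.
Qed.

Definition dual_normed := NormedSub dual_set_closed dual_norm_on.

Lemma dual_complete (F : set_system (ns_type dual_normed)) :
  ProperFilter F -> cauchy F -> cvg F.
Proof.
apply: (@sup_norm_complete _ _ ball1) => //.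
- exact: dual_set_bounded1.
- by move=> x; exists `|x| => // f; exact: dual_set_eval.
- move=> g gP.
  have gl : linear g.
    move=> a u v; apply/eqP; rewrite -subr_eq0 -normr_le0.
    apply/ler_addgt0Pr => e e0; rewrite add0r.
    have d0 : 0 < e / (`|a| + 2) by rewrite divr_gt0// ltr_wpDl.
    have [f [[fl _] [h1 h2 h3] _]] := gP (a *: u + v) u v _ d0.
    rewrite (_ : g _ - _ = a * (f u - g u) + (f v - g v) - (f (a *: u + v) - g (a *: u + v))); last first.
      by rewrite fl /GRing.scale /=; ring.
    rewrite (le_trans (ler_normB _ _))// (le_trans (lerD (ler_normD _ _) (lexx _)))//.
    rewrite normrM.
    rewrite (_ : e = `|a| * (e / (`|a| + 2)) + e / (`|a| + 2) + e / (`|a| + 2)); last first.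
      by field; rewrite gt_eqF// ltr_wpDl.
    by rewrite !lerD ?ler_wpM2l// ltW.
  split=> //.
  have [f [df _ fg]] := gP 0 0 0 1 ltr01.
  have [M fM] := dual_set_bounded1 df.
  pose L := GRing.isLinear.Build _ _ _ _ g gl.
  pose g' : {linear X -> K^o} := HB.pack g L.
  suff : bounded_near g' (nbhs 0) by move/linear_bounded_continuous.
  apply/ex_bound; exists (M + 1); apply/nbhs_normP; exists 1 => //= x /=.
  rewrite sub0r normrN => /ltW x1.
  rewrite -[g x](subKr (f x)) (le_trans (ler_normB _ _))//.
  by rewrite lerD ?fM ?fg.
Qed.

Definition dual : completeNormedModType K := bs_type (BanachSub dual_complete).

End Dual.

Notation bidual X := (dual (dual X)).

(* K itself as a Banach space: the library has this instance on R^o only *)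
Definition scalar_space_type (K : scalarField) : Type := K^o.
HB.instance Definition _ (K : scalarField) :=
  NormedModule.copy (scalar_space_type K) K^o.
HB.instance Definition _ (K : scalarField) :=
  Uniform_isComplete.Build (scalar_space_type K) (@scalar_complete K).
Definition scalar_space (K : scalarField) : completeNormedModType K :=
  scalar_space_type K.

Section SequenceSpaces.
Variables (K : scalarField) (J : choiceType).

Definition l1_set : set (J -> K^o) :=
  [set x | exists M, forall A : {fset J}, \sum_(j <- A) `|x j| <= M].

Definition l1_norm (x : J -> K^o) : K :=
  supremum 0 [set \sum_(j <- A) `|x j| | A in [set: {fset J}]].

Lemma l1_set_closed : subspace_closed l1_set.
Proof.
split; first by exists 0 => A; rewrite big1// => j _; rewrite normr0.
move=> a x y [M xM] [N yN]; exists (`|a| * M + N) => A.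
apply: (@le_trans _ _ (\sum_(j <- A) (`|a| * `|x j| + `|y j|))).
  by apply: ler_sum => j _; rewrite (le_trans (ler_normD _ _))// normrM.
by rewrite big_split /= -mulr_sumr lerD// ler_wpM2l.
Qed.

Lemma l1_norm_on : norm_on l1_set l1_norm.
Proof.
apply: (@sup_norm_on _ _ _ setT (fun (A : {fset J}) (x : J -> K^o) => \sum_(j <- A) `|x j|)).
- exact: l1_set_closed.
- by move=> A x; exact: sumr_ge0.
- by move=> A x y; rewrite -big_split /=; apply: ler_sum => j _; exact: ler_normD.
- by move=> A a x; rewrite mulr_sumr; apply: eq_bigr => j _; rewrite -normrM.
- by move=> x [M xM]; exists M.
- move=> x _ x0; apply/funext => j; apply/eqP; rewrite -normr_eq0.
  by have := x0 [fset j]%fset I; rewrite big_seq_fset1 => ->.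
Qed.

Definition l1 : normedModType K := ns_type (NormedSub l1_set_closed l1_norm_on).

Definition c0_set : set (J -> K^o) :=
  [set x | forall e : K, 0 < e -> finite_set [set j | e <= `|x j|]].

Definition c0_norm (x : J -> K^o) : K := supremum 0 [set `|x j| | j in setT].

Lemma c0_set_closed : subspace_closed c0_set.
Proof.
split=> [e e0|a x y xc yc e e0].
  rewrite (_ : [set _ | _] = set0)//; apply/seteqP; split=> // j /=.
  by rewrite normr0 => /(lt_le_trans e0); rewrite ltxx.
have d0 : 0 < e / (`|a| + 1) / 2 by rewrite !divr_gt0// ltr_wpDl.
have f0 : 0 < e / 2 by rewrite divr_gt0.
have : finite_set ([set j | e / (`|a| + 1) / 2 <= `|x j|] `|` [set j | e / 2 <= `|y j|]).
  by rewrite finite_setU; split; [exact: xc|exact: yc].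
apply: sub_finite_set => j /= ej; apply: contrapT => /not_orP[/negP h1 /negP h2].
rewrite -real_ltNge ?normr_real ?(gtr0_real d0) ?(gtr0_real f0)// in h1.
rewrite -real_ltNge ?normr_real ?(gtr0_real d0) ?(gtr0_real f0)// in h2.
suff : `|a *: x j + y j| < e by move=> /(le_lt_trans ej); rewrite ltxx.
apply: le_lt_trans (ler_normD _ _) _; rewrite [e]splitr.
apply: ler_ltD => //; rewrite [leLHS]normrM.
rewrite (le_trans (ler_wpM2l _ (ltW h1)))//.
rewrite mulrA ler_pM2r ?invr_gt0// mulrA ler_pdivrMr ?ltr_wpDl//.
by rewrite mulrC ler_wpM2l ?ltW// ltrDl.
Qed.

Lemma c0_bounded (x : J -> K^o) : c0_set x ->
  exists M, forall j, setT j -> `|x j| <= M.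
Proof.
move=> xc; have [s sP] := (finite_seqP _).1 (xc 1 ltr01).
exists (1 + \sum_(j <- s) `|x j|) => j _.
have s0 : 0 <= \sum_(j <- s) `|x j| by exact: sumr_ge0.
have [js|js] := boolP (j \in s).
  rewrite (big_rem j)//= addrCA lerDl addr_ge0//; exact: sumr_ge0.
have : ~ (1 <= `|x j|).
  by move=> h; move/negP: js; apply; have : [set` s] j by rewrite -sP.
move=> /negP; rewrite -real_ltNge// => /ltW h.
by apply: le_trans h _; rewrite lerDl.
Qed.

Lemma c0_norm_on : norm_on c0_set c0_norm.
Proof.
apply: (@sup_norm_on _ _ _ setT (fun j (x : J -> K^o) => `|x j|)).
- exact: c0_set_closed.
- by [].
- by move=> j x y; exact: ler_normD.
- by move=> j a x; rewrite -normrM.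
- exact: c0_bounded.
- by move=> x _ x0; apply/funext => j; apply/eqP; rewrite -normr_eq0 x0.
Qed.

Definition c0_normed := NormedSub c0_set_closed c0_norm_on.

Lemma c0_complete (F : set_system (ns_type c0_normed)) :
  ProperFilter F -> cauchy F -> cvg F.
Proof.
apply: (@sup_norm_complete _ _ setT) => //.
- exact: c0_bounded.
- move=> j; exists 1 => // x xc; rewrite mul1r.
  have [M xM] := c0_bounded xc.
  apply: (@ksup_ge _ _ M) => [_ [i _ <-]|]; last by exists j.
  by rewrite normr_ge0 xM.
- move=> g gP e e0; have e2 : 0 < e / 2 by rewrite divr_gt0.
  have [[j0 _]|J0] := pselect (exists j : J, True); last first.
    rewrite (_ : [set _ | _] = set0)//; apply/seteqP; split=> // j /= _.
    by apply: J0; exists j.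
  have [f [fc _ fg]] := gP j0 j0 j0 _ e2.
  apply: sub_finite_set (fc _ e2) => j /= ej.
  have gf := fg j I.
  have : e <= `|f j| + e / 2.
    apply: le_trans ej _; rewrite -[g j](subKr (f j)).
    by rewrite (le_trans (ler_normB _ _))// lerD.
  by rewrite -lerBlDr {1}[e]splitr addrK.
Qed.

Definition c0 : completeNormedModType K := bs_type (BanachSub c0_complete).

(* the pairing of l1(J) = c0(J)' with c0(J) *)
Definition l1_pairing (y : l1) (x : c0) : K :=
  summability.sum (fun j => \val y j * \val x j : K^o).

End SequenceSpaces.

Definition isometric (K : numFieldType) (X Y : normedModType K) (f : X -> Y) :=
  forall x, `|f x| = `|x|.

Section Multilinear.
Variables (K : numFieldType) (I : finType).

Definition multilinear (E : I -> normedModType K) (F : lmodType K)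
    (T : (forall i, E i) -> F) :=
  forall i (x : forall j, E j) (a : K) (u v : E i),
    T (dfwith x i (a *: u + v)) = a *: T (dfwith x i u) + T (dfwith x i v).

Definition elementary_op (E : I -> normedModType K) (F : lmodType K)
    (phi : forall i, E i -> K) (y : F) : (forall i, E i) -> F :=
  fun x => (\prod_i phi i (x i)) *: y.

Lemma elementary_op_multilinear (E : I -> normedModType K) (F : lmodType K)
    (phi : forall i, E i -> K^o) (y : F) :
  (forall i, linear (phi i)) -> multilinear (elementary_op phi y).
Proof.
move=> phil i x a u v; rewrite /elementary_op.
have eqD w : \prod_j phi j (dfwith x i w j) =
    phi i w * \prod_(j | j != i) phi j (x j).
  rewrite (bigD1 i)//= dfwithin; congr (_ * _).
  by apply: eq_bigr => j ji; rewrite dfwithout// eq_sym.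
by rewrite !eqD phil scalerA -scalerDl mulrDl mulrA.
Qed.

Record mform (E : I -> normedModType K) := MForm {
  mform_fun :> (forall i, E i) -> K^o;
  mformP : multilinear mform_fun }.

(* The algebraic tensor product of the E i, realized inside the algebraic dual
   of the space of all (not necessarily continuous) multilinear forms. *)
Definition pure_tensor (E : I -> normedModType K) (x : forall i, E i) :
  mform E -> K^o := fun b => b x.

Definition tensors (E : I -> normedModType K) : set (mform E -> K^o) :=
  [set z | exists s : seq (K * (forall i, E i)),
     z = \sum_(p <- s) p.1 *: pure_tensor p.2].

Arguments tensors : clear implicits.

Lemma tensors_closed (E : I -> normedModType K) : subspace_closed (tensors E).
Proof.
split; first by exists [::]; rewrite big_nil.
move=> a _ _ [s ->] [t ->]; exists ([seq (a * p.1, p.2) | p <- s] ++ t).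
rewrite big_cat big_map /=; congr (_ + _).
by rewrite scaler_sumr; apply: eq_bigr => p _; rewrite scalerA.
Qed.

Lemma mform_comp_subproof (E F : I -> normedModType K)
    (T : forall i, {linear E i -> F i}) (b : mform F) :
  multilinear (fun x => b (fun i => T i (x i)) : K^o).
Proof.
move=> i x a u v.
have eqT w : (fun j => T j (dfwith x i w j)) = dfwith (fun j => T j (x j)) i (T i w).
  apply: functional_extensionality_dep => j.
  have [<-|ij] := eqVneq i j; first by rewrite !dfwithin.
  by rewrite !dfwithout.
by rewrite !eqT linearP; exact: mformP.
Qed.

Definition mform_comp (E F : I -> normedModType K)
    (T : forall i, {linear E i -> F i}) (b : mform F) : mform E :=
  MForm (mform_comp_subproof T b).

Definition tensor_map (E F : I -> normedModType K)
    (T : forall i, {linear E i -> F i}) (z : mform E -> K^o) : mform F -> K^o :=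
  fun b => z (mform_comp T b).

Lemma tensor_map_pure (E F : I -> normedModType K)
    (T : forall i, {linear E i -> F i}) (x : forall i, E i) :
  tensor_map T (pure_tensor x) = pure_tensor (fun i => T i (x i)).
Proof. by []. Qed.

Definition projective_norm (E : I -> normedModType K) (z : mform E -> K^o) : K :=
  infimum 0 [set \sum_(p <- s) `|p.1| * \prod_i `|p.2 i| |
    s in [set s : seq (K * (forall i, E i)) |
            z = \sum_(p <- s) p.1 *: pure_tensor p.2]].

End Multilinear.

Arguments tensors {K I} E.

Section TensorNorms.
Variables (K : scalarField) (I : finType).

Lemma dual_linear (X : normedModType K) (phi : dual X) :
  linear (\val phi : X -> K^o).
Proof. by have /set_mem[] := valP phi. Qed.

Definition mform_prod (E : I -> normedModType K) (phi : forall i, dual (E i)) :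
    mform E :=
  MForm (elementary_op_multilinear (1 : K^o) (fun i => dual_linear (phi i))).

Definition injective_norm (E : I -> normedModType K) (z : mform E -> K^o) : K :=
  supremum 0 [set `|z (mform_prod phi)| |
    phi in [set phi : forall i, dual (E i) | forall i, `|phi i| <= 1]].

(* tensor norms of order #|I| *)
Record tensor_norm := TensorNorm {
  tn :> forall E : I -> normedModType K, (mform E -> K^o) -> K;
  tn_normP : forall E, norm_on (tensors E) (@tn E);
  tn_inj_proj : forall E z, tensors E z ->
    injective_norm z <= @tn E z <= projective_norm z;
  tn_map : forall (E F : I -> normedModType K) (T : forall i, {linear E i -> F i}),
    (forall i, continuous (T i)) -> forall z, tensors E z ->
    @tn F (tensor_map T z) <= (\prod_i opnorm (T i)) * @tn E z }.

Arguments tn : clear implicits.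

Definition tensor_space (alpha : tensor_norm) (E : I -> normedModType K) :
  normedModType K := ns_type (NormedSub (tensors_closed E) (tn_normP alpha E)).

Definition finite_dim (X : normedModType K) :=
  exists s : seq X, forall x, exists c : nat -> K,
    x = \sum_(i < size s) c i *: s`_i.

(* subspaces and superspaces are represented by linear isometric embeddings *)
Definition finitely_generated (alpha : tensor_norm) :=
  forall (E : I -> normedModType K) z, tensors E z ->
  alpha E z = infimum 0 [set r | exists (M : I -> normedModType K)
    (j : forall i, {linear M i -> E i}) (w : mform M -> K^o),
    [/\ forall i, finite_dim (M i), forall i, isometric (j i), tensors M w,
        tensor_map j w = z & r = alpha M w]].

End TensorNorms.

Arguments tn {K I} alpha E z : rename.

Definition metric_surjection (K : numFieldType) (X Y : normedModType K)
    (f : X -> Y) :=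
  (forall y, exists x, f x = y) /\
  forall x, `|f x| = infimum 0 [set `|u| | u in [set u | f u = f x]].

Definition is_completion (K : numFieldType) (Y : normedModType K)
    (X : completeNormedModType K) (i : Y -> X) :=
  isometric i /\ dense (range i).

Section Ideals.
Variables (K : scalarField) (n : nat).
Implicit Types (E G X : 'I_n -> completeNormedModType K).
Implicit Types (F Y : completeNormedModType K).

Definition mult_op E F := (forall i, E i) -> F.

Record ideal := Ideal {
  ideal_sub : forall E F, banach_sub (mult_op E F);
  ideal_mult : forall E F (T : mult_op E F), ns_set (ideal_sub E F) T ->
    multilinear T /\ continuous (T : prod_topology E -> F);
  ideal_comp : forall E X F Y (R : forall i, {linear X i -> E i})
      (T : mult_op E F) (S : {linear F -> Y}),
    (forall i, continuous (R i)) -> continuous S ->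
    ns_set (ideal_sub E F) T ->
    let U : mult_op X Y := fun x => S (T (fun i => R i (x i))) in
    ns_set (ideal_sub X Y) U /\
    ns_norm (ideal_sub X Y) U <=
      opnorm S * ns_norm (ideal_sub E F) T * \prod_i opnorm (R i);
  ideal_prod :
    let E i := scalar_space K in
    let P : mult_op E (scalar_space K) := fun x => \prod_i (x i : K) in
    ns_set (ideal_sub E (scalar_space K)) P /\
    ns_norm (ideal_sub E (scalar_space K)) P = 1 }.

Definition ideal_space (A : ideal) E F : completeNormedModType K :=
  bs_type (ideal_sub A E F).
Coercion ideal_space : ideal >-> Funclass.

(* the family (E_1, ..., E_n, F), with None as the index of F *)
Definition fam_rcons (E : 'I_n -> normedModType K) (F : normedModType K)
    (o : option 'I_n) : normedModType K :=
  if o is Some i then E i else F.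

Definition pt_rcons (E : 'I_n -> normedModType K) (F : normedModType K)
    (x : forall i, E i) (y : F) (o : option 'I_n) : fam_rcons E F o :=
  match o with Some i => x i | None => y end.

(* A(M_1, ..., M_n; N) = (M_1' * ... * M_n' * N, alpha): the linear map sending
   phi_1 * ... * phi_n * y to the operator phi_1(.)...phi_n(.) y is an isometry
   onto A(M_1, ..., M_n; N). *)
Definition associated (A : ideal) (alpha : tensor_norm K (option 'I_n)) :=
  finitely_generated alpha /\
  forall (M : 'I_n -> completeNormedModType K) (N : completeNormedModType K),
  (forall i, finite_dim (M i)) -> finite_dim N ->
  let op (s : seq (K * ((forall i, dual (M i)) * N))) : mult_op M N :=
    \sum_(p <- s) p.1 *: elementary_op (fun i => \val (p.2.1 i)) p.2.2 in
  let tens (s : seq (K * ((forall i, dual (M i)) * N))) :=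
    \sum_(p <- s) p.1 *:
      pure_tensor (@pt_rcons (fun i => dual (M i)) N p.2.1 p.2.2) in
  (forall s, ns_set (ideal_sub A M N) (op s) /\
     ns_norm (ideal_sub A M N) (op s) = alpha _ (tens s)) /\
  (forall T : A M N, exists s, \val T = op s).

(* The associated tensor norm is unique, and so is the completion X up to
   isometry; Phi is determined by its values on elementary tensors. *)
Definition radon_nikodym (A : ideal) F :=
  exists2 alpha : tensor_norm K (option 'I_n), associated A alpha &
  forall J : 'I_n -> choiceType,
  let L := tensor_space alpha (fam_rcons (fun i => l1 K (J i)) F) in
  exists (X : completeNormedModType K) (iota : {linear L -> X})
    (Phi : {linear X -> A (fun i => c0 K (J i)) F}),
  [/\ is_completion iota, continuous Phi,
      forall (y : forall i, l1 K (J i)) (g : F) (z : L),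
        \val z = pure_tensor (@pt_rcons (fun i => l1 K (J i)) F y g) ->
        \val (Phi (iota z)) = elementary_op (fun i => l1_pairing (y i)) g
    & metric_surjection Phi].

Definition extendible (A : ideal) :=
  forall E F G (j : forall i, {linear E i -> G i}), (forall i, isometric (j i)) ->
  forall T : A E F, exists2 U : A G F,
    forall x, \val U (fun i => j i (x i)) = \val T x & `|U| = `|T|.

Definition fam_with E (k : 'I_n) (D : completeNormedModType K) (i : 'I_n) :
    completeNormedModType K :=
  if i == k then D else E i.

Definition pt_with E k (D : completeNormedModType K) (x : forall i, E i) (d : D)
    (i : 'I_n) : fam_with E k D i :=
  match i == k as b return (if b then D else E i : completeNormedModType K) with
  | true => d | false => x i end.

(* Ext_k(T)(x_1, ..., x'', ..., x_n), as a function on F'; the k-th component of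
   x is not used. For T continuous multilinear the argument of insubd is in the
   dual of E_k, so insubd only turns it into an element of that type. *)
Definition arens_ext E F (T : mult_op E F) (k : 'I_n) (x : forall i, E i)
    (x'' : bidual (E k)) : dual F -> K :=
  fun y' => \val x'' (insubd 0 (fun z : E k => \val y' (T (dfwith x k z)) : K^o)).

Definition arens_stable (A : ideal) F :=
  forall (k : 'I_n) E (T : A E F),
  exists2 U : A (fam_with E k (bidual (E k))) F,
    forall (x : forall i, E i) (x'' : bidual (E k)) (y' : dual F),
      \val y' (\val U (pt_with k x x'')) = arens_ext (\val T) x x'' y'
    & `|U| = `|T|.

End Ideals.

Section Bases.
Variable K : scalarField.

Definition schauder_basis (X : completeNormedModType K) (e : nat -> X) :=
  forall x : X, exists! a : nat -> K,
    \sum_(j < N) a j *: e j @[N --> \oo] --> x.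

Definition coordinate_functionals (X : completeNormedModType K) (e : nat -> X)
    (e' : nat -> dual X) :=
  forall x : X, \sum_(j < N) \val (e' j) x *: e j @[N --> \oo] --> x.

Definition shrinking (X : completeNormedModType K) (e : nat -> X) :=
  forall e' : nat -> dual X, coordinate_functionals e e' ->
  closure [set phi : dual X | exists N (a : nat -> K),
             phi = \sum_(j < N) a j *: e' j] = setT.

Definition bounded_approximation (X : completeNormedModType K) :=
  exists M : K, forall C : set X, compact C -> forall e : K, 0 < e ->
  exists T : {linear X -> X},
    [/\ continuous T, opnorm T <= M,
        exists s : seq X, forall x, exists c : nat -> K,
          T x = \sum_(i < size s) c i *: s`_i
      & forall x, C x -> `|T x - x| <= e].

(* Square ordering, with indices starting from 0 instead of 1. *)
Definition square_block (k : nat) : seq (nat * nat) :=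
  [seq (i, k) | i <- iota 0 k.+1] ++ [seq (k, i) | i <- rev (iota 0 k)].

(* blocks 0, ..., t already contain more than t pairs *)
Definition square2 (t : nat) : nat * nat :=
  nth (0, 0)%N (flatten [seq square_block k | k <- iota 0 t.+1]) t.

(* square_order m enumerates N^(m+1), as sequences of size m+1 *)
Fixpoint square_order (m : nat) (t : nat) : seq nat :=
  if m is m'.+1 then
    rcons (square_order m' (square2 t).1) (square2 t).2
  else [:: t].

Definition monomial (n : nat) (E : 'I_n -> completeNormedModType K)
    (F : completeNormedModType K) (e' : forall i, nat -> dual (E i))
    (f : nat -> F) (s : seq nat) : mult_op E F :=
  elementary_op (fun i : 'I_n => \val (e' i (nth 0%N s i))) (f (nth 0%N s n)).

Definition monomials_basis (n : nat) (A : ideal K n)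
    (E : 'I_n -> completeNormedModType K) (F : completeNormedModType K)
    (e' : forall i, nat -> dual (E i)) (f : nat -> F) :=
  exists2 b : nat -> A E F,
    forall t, \val (b t) = monomial e' f (square_order n t) & schauder_basis b.

End Bases.

(* Main.v *)
From HB Require Import structures.
Require Import Defs.
From mathcomp Require Import all_boot all_order all_algebra.
From mathcomp Require Import complex.
From mathcomp Require Import all_classical all_reals all_analysis.
From mathcomp Require Import ring lra zify.

Set Implicit Arguments.
Unset Strict Implicit.
Unset Printing Implicit Defensive.

Import Order.TTheory GRing.Theory Num.Theory.
Import numFieldNormedType.Exports.

Local Open Scope classical_set_scope.
Local Open Scope ring_scope.

(** Two things have to be shown: monomials span a dense subspace of the ideal, and the
    square ordering turns them into a basis of their closed span.

    For the second point, a linearly dense sequence is a basis as soon as the projections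
    onto its initial segments are uniformly bounded (basis_of_projections). Each factor
    has such projections (basis_coordinates), and they act on the ideal by composition
    or, for a basis of a dual that need not consist of coordinate functionals, through
    the Arens extension (dual_projections_act). An initial segment of the square ordering
    of pairs is a combination of three rectangles, so that its projection is a bounded
    combination of products of two projections (square_projections); sequences are
    treated by recursion (square_order_projections).

    Density is a vector-valued form of Lewis' theorem (approximable_separable): under the
    Arens stability and Radon-Nikodym hypotheses, finite type operators are dense as soon
    as the duals of the domain spaces are separable. For domain spaces c0 this is the
    Radon-Nikodym property itself (approximable_c0). In general, the domain spaces are
    replaced by c0 one at a time (approximable_step). Embed X = E k into the space G of
    weak-star continuous functions on the dual ball and extend the operator T to G. As X'
    is separable, the ball is covered by countably many small norm balls with centers
    k_m. A partition of unity (w_m) subordinate to them, made of elements of G'' that are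
    limits of continuous functions, shows that the inclusion of X into G'' is nearly the
    sum of k_m (x) w_m (factorization_data); the point is that functionals on G are
    countably additive on this partition (rest_vanishes). As (w_m) is weakly
    unconditionally summable, it defines an operator c0 -> G'', and X is mapped into the
    bidual of c0 by x |-> (k_m x)_m. Hence T is, up to a small error, obtained by Arens
    extension from an operator on c0, which is approximable.

    If the hypotheses concern the bidual of F only, the operators T composed with the
    basis projections of the domain spaces have values in F, and they converge to T in the
    ideal with values in F''. As the basis projections of F extend to operators from F''
    to F, the norms of the ideal for F and for F'' are equivalent on finite type operators
    with values in F, so that the convergence also holds for F (approximable_bidual). *)

(** * Scalars *)

Section ScalarFacts.
Variable K : scalarField.

Lemma scalar_archi (C e : K) : 0 <= C -> 0 < e -> exists N, C <= N%:R * e.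
Proof.
case: K C e => _ [R|R] /= C e C0 e0.
  exists (Num.bound (C / e)); rewrite -ler_pdivrMr//.
  by apply/ltW/archi_boundP; rewrite divr_ge0// ltW.
have CE : C = (complex.Re C)%:C%C.
  by move: C0; case: (C) => x y; rewrite lecE /= => /andP[/eqP -> _].
have eE : e = (complex.Re e)%:C%C.
  by move: e0; case: (e) => x y; rewrite ltcE /= => /andP[/eqP -> _].
move: C0 e0; rewrite CE eE lecR ltcR => a0 c0.
exists (Num.bound (complex.Re C / complex.Re e)).
rewrite -(rmorph_nat (real_complex R)) -rmorphM lecR -ler_pdivrMr//.
by apply/ltW/archi_boundP; rewrite divr_ge0// ltW.
Qed.

Lemma scalar_geom (C e : K) : 0 <= C -> 0 < e -> exists N, C * 2^-1 ^+ N <= e.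
Proof.
move=> C0 e0; have [N CN] := scalar_archi C0 e0; exists N.
rewrite exprVn ler_pdivrMr ?exprn_gt0//; apply: le_trans CN _.
rewrite mulrC ler_wpM2l// ?(ltW e0)// -natrX ler_nat ltnW//; exact: ltn_expl.
Qed.

Lemma ultra_fmap (T V : Type) (U : set_system T) (f : T -> V) :
  UltraFilter U -> UltraFilter (f @ U).
Proof.
move=> UU; split; first exact: fmap_proper_filter.
move=> G GF sG; rewrite predeqE => A; split; last exact: sG.
move=> GA; have [//|UnA] := in_ultra_setVsetC (f @^-1` A) UU.
have GnA : G (~` A) by apply: sG.
by have /filter_ex [? []] : G (A `&` (~` A)) by exact: filterI.
Qed.

Lemma real_ultra_cvg (R : realType) (m : R) (V : set_system R) :
  UltraFilter V -> V [set r | `|r| <= m] -> cvg V.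
Proof.
move=> VU Vm.
have Vm' : V [set` `[-m, m]].
  by apply: filterS Vm => r /=; rewrite in_itv /= ler_norml.
have := @segment_compact R (-m) m; rewrite compact_ultra => /(_ V VU Vm')[p [_ Vp]].
by apply/cvg_ex; exists p.
Qed.

Lemma complex_ultra_cvg (R : realType) (C := R[i]%C : numFieldType) (M : C)
    (V : set_system C) :
  UltraFilter V -> V [set z | `|z| <= M] -> cvg V.
Proof.
move=> VU VM.
have proj_cvg (p : R[i]%C -> R) :
    (forall z : R[i]%C, `|p z|%:C%C <= `|z|) -> cvg (p @ V).
  move=> pz; apply: (@real_ultra_cvg _ (complex.Re M)); first exact: ultra_fmap.
  suff : V [set z | `|p z| <= complex.Re M] by [].
  apply: filterS VM => z /= zM.
  by have := le_trans (pz z) zM; rewrite lecE /= => /andP[].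
have Recvg : cvg ((fun z : C => complex.Re z) @ V).
  apply: proj_cvg => -[a b] /=; rewrite normc_def lecR /= -[leLHS]sqrtr_sqr.
  by rewrite ler_sqrt ?lerDl ?sqr_ge0// addr_ge0// sqr_ge0.
have Imcvg : cvg ((fun z : C => complex.Im z) @ V).
  apply: proj_cvg => -[a b] /=; rewrite normc_def lecR /= -[leLHS]sqrtr_sqr.
  by rewrite ler_sqrt ?lerDr ?sqr_ge0// addr_ge0// sqr_ge0.
move/cvg_ex : Recvg => [a /cvgrPdist_lt Fa].
move/cvg_ex : Imcvg => [b /cvgrPdist_lt Fb].
apply/cvg_ex; exists ((a +i* b)%C : C); apply/cvgrPdist_lt => e e0.
have e2 : 0 < complex.Re e / 2.
  by move: e0; case: e => x y; rewrite ltcE /= => /andP[_ ?]; rewrite divr_gt0.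
apply: filterS2 (Fa _ e2) (Fb _ e2) => -[c d] /= ac bd.
have -> : e = (complex.Re e)%:C%C.
  by move: e0; case: (e) => x y; rewrite ltcE /= => /andP[/eqP -> _].
rewrite normc_def ltcR /= [X in _ < X]splitr.
apply: le_lt_trans (ltrD ac bd).
rewrite -[leRHS](ger0_norm (addr_ge0 (normr_ge0 _) (normr_ge0 _))).
rewrite -[leRHS]sqrtr_sqr ler_sqrt ?sqr_ge0//.
rewrite [leRHS]sqrrD -!normrX !(ger0_norm (sqr_ge0 _)) addrAC lerDl.
by rewrite mulrn_wge0// mulr_ge0.
Qed.

Lemma scalar_ultra_cvg (M : K) (V : set_system K) :
  UltraFilter V -> V [set z | `|z| <= M] -> cvg V.
Proof.
case: K M V => _ [R|R] M V; [exact: real_ultra_cvg | exact: complex_ultra_cvg].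
Qed.

End ScalarFacts.

(** * Vectors of a Banach subspace *)

Section BanachSubspaceValues.
Variables (K : numFieldType) (V : lmodType K) (B : banach_sub V).

Lemma bs_valD (u v : bs_type B) : \val (u + v) = \val u + \val v :> V.
Proof. exact: (linearD (\val : ns_type B -> V)). Qed.

Lemma bs_valB (u v : bs_type B) : \val (u - v) = \val u - \val v :> V.
Proof. exact: (linearB (\val : ns_type B -> V)). Qed.

Lemma bs_valZ a (u : bs_type B) : \val (a *: u) = a *: \val u :> V.
Proof. exact: (linearZ_LR (\val : ns_type B -> V)). Qed.

Lemma bs_val_sum (I : Type) (s : seq I) (P : pred I) (f : I -> bs_type B) :
  \val (\sum_(i <- s | P i) f i) = \sum_(i <- s | P i) \val (f i) :> V.
Proof. exact: (linear_sum (\val : ns_type B -> V)). Qed.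

Lemma bs_ext (u v : bs_type B) : \val u = \val v -> u = v.
Proof. exact: val_inj. Qed.

Lemma bs_normE (u : bs_type B) : `|u| = ns_norm B (\val u).
Proof. by []. Qed.

Definition to_bs (v : V) : bs_type B := insubd (0 : bs_type B) v.

Lemma to_bsE v : ns_set B v -> \val (to_bs v) = v.
Proof. by move=> Bv; rewrite /to_bs insubdK//; exact: mem_set. Qed.

Lemma bs_valP (u : bs_type B) : ns_set B (\val u).
Proof. exact/set_mem/valP. Qed.

End BanachSubspaceValues.

(** * Bounded operators and functionals *)

Section Bounded.
Variable K : scalarField.

Lemma abs_series_cvg (X : completeNormedModType K) (v : nat -> X) (C : K) :
  (forall N, \sum_(i < N) `|v i| <= C) -> cvg (\sum_(i < N) v i @[N --> \oo]).
Proof.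
move=> vC; pose S N : K := \sum_(i < N) `|v i|.
have [s [ub lub]] : supremums (range S) !=set0.
  apply: (@scalar_sup _ _ C); first by exists (S 0%N), 0%N.
  by move=> _ [N _ <-]; rewrite vC andbT sumr_ge0.
have Sle N : S N <= s by apply: ub; exists N.
have S0 N : 0 <= S N by exact: sumr_ge0.
have s0 : 0 <= s by exact: le_trans (S0 0%N) (Sle 0%N).
apply: cauchy_cvg; apply: cauchy_exP => e e0.
have [N0 N0e] : exists N0, s - e < S N0.
  apply: contrapT => /forallNP h.
  have /lub : ubound (range S) (s - e).
    move=> _ [N _ <-]; rewrite real_leNgt; first exact/negP/h.
    - exact: ger0_real.
    - by rewrite realB// ?ger0_real// ltW.
  by rewrite lerBrDr gerDl => /(lt_le_trans e0); rewrite ltxx.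
exists (\sum_(i < N0) v i), N0 => // N /= N0N.
rewrite -ball_normE /= distrC -(subnKC N0N); move: (N - N0)%N => d.
rewrite big_split_ord /= addrAC subrr add0r.
apply: le_lt_trans (ler_norm_sum _ _ _) _.
have := Sle (N0 + d)%N; rewrite /S big_split_ord /= -lerBrDl => /le_lt_trans; apply.
by rewrite ltrBlDr addrC -ltrBlDr.
Qed.

Lemma bounded_cont (X Y : normedModType K) (f : {linear X -> Y}) (C : K) :
  (forall x, `|f x| <= C * `|x|) -> continuous f.
Proof.
move=> fC; suff : bounded_near f (nbhs 0) by move/linear_bounded_continuous.
apply/ex_bound; exists `|C|; apply/nbhs_normP; exists 1 => //= x /=.
rewrite sub0r normrN => /ltW x1; apply: le_trans (fC x) _.
have [->|x0] := eqVneq x 0; first by rewrite normr0 mulr0.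
have C0 : 0 <= C.
  have := le_trans (normr_ge0 _) (fC x).
  by rewrite pmulr_lge0// normr_gt0.
by rewrite (ger0_norm C0) ler_piMr.
Qed.

Lemma cont_bounded (X Y : normedModType K) (f : {linear X -> Y}) :
  continuous f -> exists2 C, 0 <= C & forall x, `|f x| <= C * `|x|.
Proof.
move=> fc; have /linear_boundedP : bounded_near f (nbhs 0).
  exact/linear_bounded_continuous.
by move=> /pinfty_ex_gt0[C C0 fC]; exists C => //; exact: ltW.
Qed.

Lemma opnorm_le (X Y : normedModType K) (f : X -> Y) (C : K) : 0 <= C ->
  (forall x, `|f x| <= C * `|x|) -> opnorm f <= C.
Proof.
move=> C0 fC; apply: ksup_le => // _ [x x1 <-].
by rewrite normr_ge0 /= (le_trans (fC x))// ler_piMr.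
Qed.

Lemma opnorm_ge0 (X Y : normedModType K) (f : {linear X -> Y}) :
  continuous f -> 0 <= opnorm f.
Proof.
move=> /cont_bounded[C C0 fC]; apply: (@ksup_ge0 _ _ C) => _ [x x1 <-].
by rewrite normr_ge0 /= (le_trans (fC x))// ler_piMr.
Qed.

Lemma dual_intro (X : normedModType K) (f : X -> K^o) (C : K) :
  linear f -> (forall x, `|f x| <= C * `|x|) -> dual_set f.
Proof.
move=> fl fC; split=> //.
pose f' : {linear X -> K^o} := HB.pack f (GRing.isLinear.Build _ _ _ _ f fl).
exact: (@bounded_cont _ _ f' C).
Qed.

Definition to_dual (X : normedModType K) (f : X -> K^o) : dual X :=
  insubd (0 : dual X) f.

Lemma to_dualE (X : normedModType K) (f : X -> K^o) : dual_set f -> \val (to_dual f) = f.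
Proof. by move=> df; rewrite /to_dual insubdK//; exact: mem_set. Qed.

Lemma dualP (X : normedModType K) (f : dual X) : dual_set (\val f).
Proof. exact/set_mem/valP. Qed.

Lemma dualD (X : normedModType K) (f : dual X) x y : \val f (x + y) = \val f x + \val f y.
Proof. by have := dual_linear f 1 x y; rewrite !scale1r. Qed.

Lemma dualZ (X : normedModType K) (f : dual X) a x : \val f (a *: x) = a * \val f x.
Proof. exact: (dual_setZ a x (dualP f)). Qed.

Lemma dual0 (X : normedModType K) (f : dual X) : \val f 0 = 0.
Proof. exact: (dual_set0 (dualP f)). Qed.

Lemma dualB (X : normedModType K) (f : dual X) x y : \val f (x - y) = \val f x - \val f y.
Proof. by rewrite dualD -(scaleN1r y) dualZ mulN1r. Qed.

Lemma dual_sum (X : normedModType K) (f : dual X) (I : Type) (s : seq I) (P : pred I)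
    (v : I -> X) : \val f (\sum_(i <- s | P i) v i) = \sum_(i <- s | P i) \val f (v i).
Proof.
by elim/big_rec2 : _ => [|i _ y _ <-]; rewrite ?dual0// dualD.
Qed.

Lemma ler_dual (X : normedModType K) (f : dual X) x : `|\val f x| <= `|f| * `|x|.
Proof. by rewrite mulrC; exact: (dual_set_eval x (dualP f)). Qed.

Lemma dual_le (X : normedModType K) (f : dual X) C : 0 <= C ->
  (forall x, `|\val f x| <= C * `|x|) -> `|f| <= C.
Proof. by move=> C0 fC; rewrite ns_normE; exact: opnorm_le. Qed.

Lemma dual_valD (X : normedModType K) (f g : dual X) x :
  \val (f + g) x = \val f x + \val g x.
Proof. by rewrite bs_valD. Qed.

Lemma dual_valZ (X : normedModType K) (f : dual X) a x : \val (a *: f) x = a * \val f x.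
Proof. by rewrite bs_valZ. Qed.

Lemma dual_valB (X : normedModType K) (f g : dual X) x :
  \val (f - g) x = \val f x - \val g x.
Proof. by rewrite bs_valB. Qed.

Lemma op_dualP (X Y : normedModType K) (R : {linear X -> dual Y}) a x y mu :
  \val (R (a *: x + y)) mu = a * \val (R x) mu + \val (R y) mu.
Proof. by rewrite linearP (dual_valD (a *: R x) (R y)) (dual_valZ (R x)). Qed.

Lemma dual_val_sum (X : normedModType K) (I : Type) (s : seq I) (P : pred I)
    (f : I -> dual X) x : \val (\sum_(i <- s | P i) f i) x = \sum_(i <- s | P i) \val (f i) x.
Proof. by rewrite bs_val_sum fct_sumE. Qed.

Lemma dual_ext (X : normedModType K) (f g : dual X) :
  (forall x, \val f x = \val g x) -> f = g.
Proof. by move=> fg; apply: val_inj; apply/funext. Qed.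

Lemma dual_cont (X : normedModType K) (f : dual X) : continuous (\val f : X -> K^o).
Proof. by have [] := dualP f. Qed.

(** Coefficients of modulus one make the values of mu add up without cancellation. This
    is how weak unconditional summability of v is derived from bounds on combinations. *)
Lemma sum_norm_dual (Y : normedModType K) (mu : dual Y) (v : nat -> Y) N C :
  (forall w : nat -> K, (forall i, `|w i| <= 1) -> `|\sum_(i < N) w i *: v i| <= C) ->
  \sum_(i < N) `|\val mu (v i)| <= C * `|mu|.
Proof.
move=> vC; pose c i := \val mu (v i).
pose w i : K := if c i == 0 then 0 else `|c i| / c i.
have w1 i : `|w i| <= 1.
  rewrite /w; case: eqP => [|/eqP c0]; first by rewrite normr0.
  by rewrite normrM normfV normr_id mulfV// normr_eq0.
have wc i : w i * c i = `|c i|.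
  rewrite /w; case: eqP => [->|/eqP c0]; first by rewrite mul0r normr0.
  by rewrite divfK.
have -> : \sum_(i < N) `|\val mu (v i)| = \val mu (\sum_(i < N) w i *: v i).
  by rewrite dual_sum; apply: eq_bigr => i _; rewrite dualZ wc.
apply: le_trans (real_ler_norm _) _.
  rewrite dual_sum (eq_bigr (fun i : 'I_N => `|c i|)); last first.
    by move=> i _; rewrite dualZ wc.
  by apply: ger0_real; exact: sumr_ge0.
apply: le_trans (ler_dual _ _) _; rewrite mulrC ler_wpM2r//.
exact: vC.
Qed.

End Bounded.

(** * Norming functionals *)

Section Sublinear.
Variables (R : realType) (K : numFieldType) (iota : {rmorphism R -> K}) (V : lmodType K).

Definition sublinear (q : V -> R) :=
  (forall x y, q (x + y) <= q x + q y) /\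
  (forall r x, 0 <= r -> q (iota r *: x) <= r * q x).

Lemma sublinear_ge (q : V -> R) x : sublinear q -> - q (- x) <= q x.
Proof.
move=> [qD qZ]; have := qZ 0 0 (lexx _); rewrite rmorph0 scale0r mul0r => q00.
have h : 0 <= q 0 by have := qD 0 0; rewrite addr0 lerDl.
by have := qD x (- x); rewrite subrr => /(le_trans h); rewrite -lerBlDr sub0r.
Qed.

(** The largest sublinear functional below q whose value at - y is at most - q y. *)
Definition tilt (q : V -> R) (y x : V) : R :=
  inf [set q (x + iota t *: y) - t * q y | t in [set t | 0 <= t]].

Section Tilt.
Variables (q : V -> R) (y : V).
Hypothesis qs : sublinear q.

Let tilt_lb x :
  lbound [set q (x + iota t *: y) - t * q y | t in [set t | 0 <= t]] (- q (- x)).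
Proof.
have [qD qZ] := qs; move=> _ [t t0 <-]; rewrite lerBrDr addrC lerBlDr.
have [->|tn0] := eqVneq t 0.
  rewrite mul0r rmorph0 scale0r addr0 -lerBlDr sub0r; exact: sublinear_ge.
have h : t * q y <= q (iota t *: y).
  have := qZ t^-1 (iota t *: y); rewrite invr_ge0 => /(_ t0).
  rewrite scalerA -rmorphM mulVf// rmorph1 scale1r => qy.
  by rewrite -ler_pdivlMl// lt_neqAle eq_sym tn0.
apply: le_trans h _; have := qD (x + iota t *: y) (- x).
by rewrite addrAC subrr add0r.
Qed.

Lemma tilt_le_at x t : 0 <= t -> tilt q y x <= q (x + iota t *: y) - t * q y.
Proof.
by move=> t0; apply: ge_inf; [exists (- q (- x)); exact: tilt_lb|exists t].
Qed.

Lemma le_tilt x c : (forall t, 0 <= t -> c <= q (x + iota t *: y) - t * q y) ->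
  c <= tilt q y x.
Proof.
move=> h; apply: lb_le_inf; first by exists (q (x + iota 0 *: y) - 0 * q y), 0 => /=.
by move=> _ [t t0 <-]; exact: h.
Qed.

Lemma tilt_le x : tilt q y x <= q x.
Proof.
by have := @tilt_le_at x 0 (lexx _); rewrite rmorph0 scale0r addr0 mul0r subr0.
Qed.

Lemma tilt_opp : tilt q y (- y) <= - q y.
Proof.
have := @tilt_le_at (- y) 1 ler01; rewrite rmorph1 scale1r addNr mul1r.
move=> /le_trans; apply; rewrite gerDr.
by have [_ /(_ 0 0 (lexx _))] := qs; rewrite scaler0 mul0r.
Qed.

Lemma tilt_sublinear : sublinear (tilt q y).
Proof.
have [qD qZ] := qs; split=> [x z|r x r0].
  rewrite -lerBlDr; apply: le_tilt => t t0; rewrite lerBlDl -lerBlDr.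
  apply: le_tilt => s s0; rewrite lerBlDr.
  apply: le_trans (tilt_le_at _ (addr_ge0 t0 s0)) _.
  rewrite rmorphD scalerDl addrACA mulrDl opprD.
  apply: (le_trans (lerD (qD _ _) (lexx _))).
  by rewrite [leRHS]addrC addrACA.
have h t : 0 <= t -> tilt q y (iota r *: x) <= r * (q (x + iota t *: y) - t * q y).
  move=> t0; apply: le_trans (tilt_le_at _ (mulr_ge0 r0 t0)) _.
  by rewrite rmorphM -scalerA -scalerDr mulrBr mulrA lerD2r qZ.
have [r00|rn0] := eqVneq r 0.
  by have := h 0 (lexx _); rewrite r00 !mul0r.
have rp : 0 < r by rewrite lt_neqAle eq_sym rn0.
rewrite -ler_pdivrMl//; apply: le_tilt => t t0.
by rewrite ler_pdivrMl//; exact: h.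
Qed.

End Tilt.

(** A minimal sublinear functional is linear, as its tilts are not smaller. *)
Lemma minimal_sublinear (p : V -> R) : sublinear p ->
  exists u : V -> R, [/\ forall x y, u (x + y) = u x + u y,
    forall r x, u (iota r *: x) = r * u x & forall x, u x <= p x].
Proof.
move=> ps; pose T := {q : V -> R | sublinear q /\ forall x, q x <= p x}.
pose rel (a b : T) := `[< forall x, sval b x <= sval a x >].
have chain_bound (A : set T) : total_on A rel -> exists b : T, forall a, A a -> rel a b.
  move=> totA; have [[a0 Aa0]|A0] := pselect (A !=set0); last first.
    have pp : sublinear p /\ forall x, p x <= p x by [].
    by exists (exist _ p pp) => a Aa; case: A0; exists a.
  pose m x := inf [set sval a x | a in A].
  have lbm x : lbound [set sval a x | a in A] (- p (- x)).
    move=> _ [a Aa <-]; have [as_ ap] := svalP a.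
    by apply: le_trans (sublinear_ge x as_); rewrite lerN2.
  have mle a x : A a -> m x <= sval a x.
    by move=> Aa; apply: ge_inf; [exists (- p (- x)); exact: lbm|exists a].
  have lem x c : (forall a, A a -> c <= sval a x) -> c <= m x.
    move=> h; apply: lb_le_inf; first by exists (sval a0 x), a0.
    by move=> _ [a Aa <-]; exact: h.
  have ms : sublinear m.
    split=> [x y|r x r0].
      rewrite -lerBlDr; apply: (lem) => a Aa; rewrite lerBlDl -lerBlDr.
      apply: (lem) => b Ab; rewrite lerBlDr.
      have [/asboolP ab|/asboolP ba] := totA a b Aa Ab.
        apply: le_trans (mle b _ Ab) _; have [[bD _] _] := svalP b.
        by apply: le_trans (bD _ _) _; rewrite [leRHS]addrC lerD2r.
      apply: le_trans (mle a _ Aa) _; have [[aD _] _] := svalP a.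
      by apply: le_trans (aD _ _) _; rewrite [leRHS]addrC lerD2l.
    have h a : A a -> m (iota r *: x) <= r * sval a x.
      move=> Aa; have [[_ aZ] _] := svalP a.
      exact: le_trans (mle a _ Aa) (aZ _ _ r0).
    have [r00|rn0] := eqVneq r 0.
      by have := h _ Aa0; rewrite r00 !mul0r.
    have rp : 0 < r by rewrite lt_neqAle eq_sym rn0.
    rewrite -ler_pdivrMl//; apply: (lem) => a Aa.
    by rewrite ler_pdivrMl//; exact: h.
  have mp : sublinear m /\ forall x, m x <= p x.
    split=> // x; apply: le_trans (mle _ _ Aa0) _.
    by have [_] := svalP a0; exact.
  by exists (exist _ m mp) => a Aa; apply/asboolP => x /=; exact: mle.
have [] := @Zorn T rel _ _ _ chain_bound.
- by move=> a; apply/asboolP => x.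
- move=> a b c /asboolP ab /asboolP bc; apply/asboolP => x.
  exact: le_trans (bc x) (ab x).
- move=> [a ap] [b bp] /asboolP/= ab /asboolP/= ba; apply: eq_exist.
  by apply/funext => x; apply/eqP; rewrite eq_le ab ba.
move=> -[u [us up]] umin; exists u; have [uD uZ] := us.
have uN y : u (- y) = - u y.
  have tp : sublinear (tilt u y) /\ forall x, tilt u y x <= p x.
    by split=> [|x]; [exact: tilt_sublinear|exact: le_trans (tilt_le y us x) (up x)].
  have /(congr1 sval)/= tE : exist _ (tilt u y) tp = exist _ u (conj us up) :> T.
    by apply: umin; apply/asboolP => x; exact: tilt_le.
  apply/eqP; rewrite eq_le -{1}tE tilt_opp//=.
  by rewrite lerNl; exact: sublinear_ge.
have uZ' r x : 0 <= r -> u (iota r *: x) = r * u x.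
  move=> r0; apply/eqP; rewrite eq_le uZ//= -lerN2 -uN -mulrN -uN -scalerN.
  exact: uZ.
split=> // [x y|r x].
  apply/eqP; rewrite eq_le uD/= -lerBrDr -uN.
  by have := uD (x + y) (- y); rewrite addrK.
have [r0|r0] := leP 0 r; first exact: uZ'.
rewrite -[r]opprK rmorphN scaleNr uN uZ' ?mulNr// oppr_ge0; exact: ltW.
Qed.

Lemma sublinear_support (p : V -> R) (x0 : V) : sublinear p ->
  exists u : V -> R, [/\ forall x y, u (x + y) = u x + u y,
    forall r x, u (iota r *: x) = r * u x, forall x, u x <= p x & p x0 <= u x0].
Proof.
move=> ps; have [u [uD uZ up]] := minimal_sublinear (tilt_sublinear x0 ps).
exists u; split=> // [x|]; first exact: le_trans (up x) (tilt_le x0 ps x).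
have := le_trans (up (- x0)) (tilt_opp x0 ps).
by rewrite -scaleN1r -(rmorph1 iota) -rmorphN uZ mulN1r lerN2.
Qed.

End Sublinear.

Lemma norming_functional_real (R : realType) (X : normedModType R) (x0 : X) :
  exists phi : X -> R^o,
    [/\ linear phi, forall x, `|phi x| <= `|x| & `|x0| <= `|phi x0|].
Proof.
have ps : sublinear (idfun : {rmorphism R -> R}) (fun x : X => `|x|).
  split=> [x y|r x r0]; first exact: ler_normD.
  by rewrite normrZ ger0_norm.
have [u [uD uZ up ux0]] := sublinear_support x0 ps.
exists u; split=> [a x y|x|]; first by rewrite uD uZ.
  rewrite ler_norml up andbT lerNl -mulN1r -uZ.
  by apply: le_trans (up _) _; rewrite /= scaleN1r normrN.
by apply: le_trans ux0 _; exact: ler_norm.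
Qed.

(** A real functional u is completed to the complex functional x |-> u x - i u (i x);
    its modulus at x is the value of u at a multiple of x by a scalar of modulus one. *)
Lemma norming_functional_complex (R : realType) (C := R[i]%C : numFieldType)
    (X : normedModType C) (x0 : X) :
  exists phi : X -> C^o,
    [/\ linear phi, forall x, `|phi x| <= `|x| & `|x0| <= `|phi x0|].
Proof.
pose p (x : X) : R := complex.Re `|x|.
have pE x : `|x| = (p x)%:C%C.
  rewrite /p; have : 0 <= `|x| by [].
  by case: (`|x|) => a b; rewrite lecE /= => /andP[/eqP -> _].
have ps : sublinear (real_complex R : {rmorphism R -> C}) p.
  split=> [x y|r x r0].
    by have := ler_normD x y; rewrite !pE -rmorphD lecR.
  by rewrite /p normrZ ger0_norm ?lecR// pE -rmorphM.
have [u [uD uZ up ux0]] := sublinear_support x0 ps.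
pose phi (x : X) : C := (u x -i* u ('i%C *: x))%C.
have phiD x y : phi (x + y) = phi x + phi y.
  by rewrite /phi scalerDr !uD; apply/eqP; rewrite eq_complex /= opprD !eqxx.
have phir (r : R) x : phi (r%:C%C *: x) = r%:C%C * phi x.
  rewrite /phi scalerA mulrC -scalerA !uZ.
  by apply/eqP; rewrite eq_complex /= !mul0r subr0 addr0 mulrN !eqxx.
have phii x : phi ('i%C *: x) = 'i%C * phi x.
  rewrite /phi scalerA -expr2 sqr_i scaleN1r -[- x]scaleN1r.
  have -> : -1 = (-1)%:C%C :> C by rewrite rmorphN rmorph1.
  rewrite uZ; apply/eqP; rewrite eq_complex /=.
  by rewrite ?mul0r ?mul1r ?mulN1r ?opprK ?sub0r ?opprK ?add0r !eqxx.
have phil : linear phi.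
  move=> a x y; rewrite phiD; congr (_ + _); rewrite [a]complexE.
  rewrite scalerDl phiD phir -scalerA phii phir.
  by rewrite /GRing.scale /= mulrA -mulrDl.
have phile x : `|phi x| <= `|x|.
  have [->|n0] := eqVneq (phi x) 0; first by rewrite normr0.
  pose w := `|phi x| / phi x.
  have : phi (w *: x) = `|phi x|.
    have := phil w x 0; rewrite !addr0.
    have -> : phi 0 = 0 by have := phil (-1) 0 0; rewrite scaler0 addr0 scaleN1r addNr.
    by rewrite addr0 => ->; rewrite /GRing.scale /= divfK.
  move=> pw; have e : u (w *: x) = complex.Re `|phi x| by rewrite -pw.
  have -> : `|phi x| = (u (w *: x))%:C%C :> C.
    by rewrite e; case: (`|phi x|) (normr_ge0 (phi x)) => a b; rewrite lecE /= => /andP[/eqP ->].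
  have : (u (w *: x))%:C%C <= `|w *: x| by rewrite pE lecR.
  by rewrite normrZ normrM normfV normr_id mulfV ?normr_eq0// mul1r.
exists phi; split=> //.
rewrite pE normc_def lecR; apply: le_trans ux0 _.
apply: le_trans (ler_norm _) _; rewrite -[leLHS]sqrtr_sqr ler_sqrt ?addr_ge0 ?sqr_ge0//=.
by rewrite lerDl sqr_ge0.
Qed.

(** Hahn-Banach. *)
Lemma norming_functional (K : scalarField) (X : normedModType K) (x0 : X) :
  exists2 phi : dual X, `|phi| <= 1 & `|x0| <= `|\val phi x0|.
Proof.
suff [phi [phil phi1 phix0]] : exists phi : X -> K^o,
    [/\ linear phi, forall x, `|phi x| <= `|x| & `|x0| <= `|phi x0|].
  have phid : dual_set phi.
    by apply: (@dual_intro _ _ _ 1) => // x; rewrite mul1r.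
  exists (to_dual phi); rewrite ?to_dualE//.
  by apply: dual_le => // x; rewrite to_dualE// mul1r.
case: K X x0 => _ [R|R] X x0.
  exact: norming_functional_real.
exact: norming_functional_complex.
Qed.

Lemma dual_separates (K : scalarField) (X : normedModType K) (x y : X) :
  (forall phi : dual X, \val phi x = \val phi y) -> x = y.
Proof.
move=> h; have [phi _] := norming_functional (x - y).
by rewrite dualB h subrr normr0 normr_le0 subr_eq0 => /eqP.
Qed.
(** * Series of functionals *)

Section Limits.
Variable K : scalarField.

Lemma cvg_norm_le (X : normedModType K) (T : Type) (F : set_system T) (u : T -> X) l M :
  ProperFilter F -> u @ F --> l -> (\forall t \near F, `|u t| <= M) -> `|l| <= M.
Proof.
move=> FF /cvgrPdist_lt ul uM; apply/ler_addgt0Pr => e e0.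
have [t [tM te]] := filter_ex (filterI uM (ul e e0)).
by rewrite -(subrK (u t) l) (le_trans (ler_normD _ _))// addrC lerD// ltW.
Qed.

Lemma normed_lim_unique (X : normedModType K) (T : Type) (F : set_system T)
    (u : T -> X) (l l' : X) :
  ProperFilter F -> u @ F --> l -> u @ F --> l' -> l = l'.
Proof. by move=> FF ul ul'; apply: (@cvg_unique X (@norm_hausdorff _ X) (u @ F)). Qed.

Lemma cvg_sum (X : normedModType K) (T : Type) (F : set_system T) (I : Type)
    (s : seq I) (u : I -> T -> X) (l : I -> X) : Filter F ->
  (forall i, u i @ F --> l i) -> \sum_(i <- s) u i t @[t --> F] --> \sum_(i <- s) l i.
Proof.
move=> FF ul; elim: s => [|i s IHs].
  by under eq_fun do rewrite big_nil; rewrite big_nil; exact: cvg_cst.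
by under eq_fun do rewrite big_cons; rewrite big_cons; apply: cvgD.
Qed.

Lemma exists_linear (X Y : lmodType K) (f : X -> Y) : linear f ->
  exists g : {linear X -> Y}, forall x, g x = f x.
Proof.
move=> fl.
pose g : {linear X -> Y} := HB.pack f (GRing.isLinear.Build _ _ _ _ f fl).
by exists g.
Qed.

(** The sum of the rank one operators x |-> phi m x * w m, which need not converge in
    norm: the weak unconditional summability of w gives a meaning to it in the bidual. *)
Lemma wuc_operator (X Y : normedModType K) (phi : nat -> dual X) (w : nat -> bidual Y)
    (C : K) : 0 <= C -> (forall m, `|phi m| <= C) ->
  (forall N mu, \sum_(m < N) `|\val (w m) mu| <= `|mu|) ->
  exists R : {linear X -> bidual Y},
    (forall x mu, \sum_(m < N) (\val (phi m) x * \val (w m) mu : K^o) @[N --> \oo]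
       --> (\val (R x) mu : K^o)) /\
    (forall x, `|R x| <= C * `|x|).
Proof.
move=> C0 phiC ww.
pose S x mu (N : nat) : K^o := \sum_(m < N) (\val (phi m) x * \val (w m) mu).
have Sle x mu N : \sum_(m < N) `|\val (phi m) x * \val (w m) mu| <= C * `|x| * `|mu|.
  apply: (@le_trans _ _ (\sum_(m < N) C * `|x| * `|\val (w m) mu|)).
    apply: ler_sum => m _; rewrite normrM ler_wpM2r//.
    by apply: le_trans (ler_dual _ _) _; rewrite ler_wpM2r.
  by rewrite -mulr_sumr ler_wpM2l// mulr_ge0.
have Scvg x mu : cvg (S x mu @ \oo).
  pose v m : scalar_space K := \val (phi m) x * \val (w m) mu.
  have /cvg_ex[l Sl] := @abs_series_cvg _ (scalar_space K) v _ (Sle x mu).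
  by apply/cvg_ex; exists l.
pose f x mu : K^o := lim (S x mu @ \oo).
have fcv x mu : S x mu @ \oo --> f x mu by exact: Scvg.
have fle x mu : `|f x mu| <= C * `|x| * `|mu|.
  apply: cvg_norm_le (fcv x mu) _; apply: nearW => N.
  by apply: le_trans (ler_norm_sum _ _ _) _; exact: Sle.
have flin x : linear (f x).
  move=> a mu nu; apply: normed_lim_unique (fcv x (a *: mu + nu)) _.
  rewrite [X in X @ _](_ : _ = (fun N => a *: S x mu N + S x nu N)).
    by apply: cvgD; [apply: cvgZr; exact: fcv|exact: fcv].
  apply/funext => N; rewrite /S scaler_sumr -big_split /=; apply: eq_bigr => m _.
  by rewrite dualD dualZ mulrDr mulrCA.
have flin2 a x y mu : f (a *: x + y) mu = a * f x mu + f y mu.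
  apply: normed_lim_unique (fcv (a *: x + y) mu) _.
  rewrite [X in X @ _](_ : _ = (fun N => a *: S x mu N + S y mu N)).
    by apply: cvgD; [apply: cvgZr; exact: fcv|exact: fcv].
  apply/funext => N; rewrite /S scaler_sumr -big_split /=; apply: eq_bigr => m _.
  by rewrite dualD dualZ mulrDl -mulrA.
have fd x : dual_set (f x) by exact: dual_intro (flin x) (fle x).
have Rl : linear (fun x => to_dual (f x) : bidual Y).
  move=> a x y; apply: dual_ext => mu.
  by rewrite dual_valD dual_valZ !to_dualE.
have [R RE] := exists_linear Rl.
exists R; split=> [x mu|x]; rewrite RE; first by rewrite to_dualE//; exact: fcv.
by apply: dual_le => [|mu]; rewrite ?mulr_ge0// to_dualE.
Qed.

End Limits.

(** * Schauder bases *)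

Section Zabreiko.
Variables (K : scalarField) (X : completeNormedModType K) (p : X -> K).
Hypothesis p_ge0 : forall x, 0 <= p x.
Hypothesis pD : forall x y, p (x + y) <= p x + p y.
Hypothesis pZ : forall a x, p (a *: x) = `|a| * p x.
(* countable subadditivity, for series dominated by a geometric one *)
Hypothesis p_sum : forall (v : nat -> X) (x : X) (C : K),
  \sum_(i < N) v i @[N --> \oo] --> x ->
  (forall i, p (v i) <= C * 2^-1 ^+ i) -> p x <= C * 2.

Let pB x y : p (x - y) <= p x + p y.
Proof. by apply: le_trans (pD _ _) _; rewrite -scaleN1r pZ normrN1 mul1r. Qed.

Let exists_smaller (a b : K) : 0 < a -> 0 < b -> exists d : K, [/\ 0 < d, d <= a & d <= b].
Proof.
move=> a0 b0; have [ab|/ltW ba] := real_leP (gtr0_real a0) (gtr0_real b0).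
  by exists a.
by exists b.
Qed.

(** Baire's argument: otherwise nested balls lead to a point where p is infinite. *)
Lemma bounded_near_dense : exists (x0 : X) (r M : K), [/\ 0 < r, 0 <= M &
  forall x e, `|x - x0| < r -> 0 < e -> exists2 y, p y <= M & `|y - x| < e].
Proof.
apply: contrapT => h.
have step (nc : nat * (X * K)) : exists d : X * K, 0 < nc.2.2 ->
    [/\ 0 < d.2, d.2 <= nc.2.2 * 2^-1, `|d.1 - nc.2.1| <= nc.2.2 * 2^-1 &
        forall y, `|y - d.1| <= d.2 -> ~ p y <= nc.1%:R].
  case: nc => n [c t] /=; have [c0|c0] := pselect (0 < t); last by exists (c, t).
  have c2 : 0 < t * 2^-1 by rewrite mulr_gt0.
  have [x [xc [e [e0 he]]]] : exists x, `|x - c| < t * 2^-1 /\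
      exists e, 0 < e /\ forall y, p y <= n%:R -> ~ `|y - x| < e.
    apply: contrapT => h1; apply: h; exists c, (t * 2^-1), n%:R; split=> // x e xc e0.
    apply: contrapT => h2; apply: h1; exists x; split=> //; exists e; split=> // y py ye.
    by apply: h2; exists y.
  have e2 : 0 < e * 2^-1 by rewrite mulr_gt0.
  have [d [d0 dc de]] := exists_smaller c2 e2.
  exists (x, d) => _ /=; split=> // [|y yx py]; first exact: ltW.
  apply: (he y py); apply: le_lt_trans (le_trans yx de) _.
  by rewrite ltr_pdivrMr// mulr_natr mulr2n ltrDl.
have [f fP] := choice step.
pose fix c n : X * K := if n is n'.+1 then f (n', c n') else (0, 1).
have c0 n : 0 < (c n).2.
  by elim: n => [|n IHn] /=; [exact: ltr01|case: (fP (n, c n) IHn)].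
have cS n := fP (n, c n) (c0 n).
have nested n d : `|(c (n + d)%N).1 - (c n).1| + (c (n + d)%N).2 <= (c n).2.
  elim: d => [|d IHd]; first by rewrite addn0 subrr normr0 add0r.
  apply: le_trans IHd; rewrite addnS.
  have [_ + + _] := cS (n + d)%N => /= r2 cd.
  rewrite [in leRHS](splitr (c (n + d)%N).2) addrA lerD//.
  rewrite -(subrKA (c (n + d)%N).1) (le_trans (ler_normD _ _))// addrC lerD//.
have rle n : (c n).2 <= 2^-1 ^+ n.
  elim: n => [|n IHn]; first by rewrite expr0.
  have [_ + _ _] := cS n => /= /le_trans; apply.
  by rewrite exprSr ler_wpM2r.
have cc : cvg ((fun n => (c n).1) @ \oo).
  apply: cauchy_cvg; apply: cauchy_exP => e e0.
  have e2 : 0 < e * 2^-1 by rewrite mulr_gt0.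
  have [N] := scalar_geom (@ler01 K) e2; rewrite mul1r => Ne.
  exists (c N).1, N => // n /= Nn; rewrite -ball_normE /= distrC -(subnKC Nn).
  apply: (@le_lt_trans _ _ (e * 2^-1)).
    apply: le_trans (le_trans (rle N) Ne); apply: le_trans (nested N (n - N)%N).
    by rewrite lerDl ltW.
  by rewrite ltr_pdivrMr// mulr_natr mulr2n ltrDl.
move/cvg_ex : cc => [x cx].
have xc n : `|x - (c n).1| <= (c n).2.
  have cxn : ((fun m => (c m).1 - (c n).1) @ \oo) --> x - (c n).1.
    by apply: cvgB => //; exact: cvg_cst.
  apply: (@cvg_norm_le _ _ _ _ _ _ (c n).2 _ cxn); exists n => // m /= nm; rewrite -(subnKC nm).
  by apply: le_trans (nested n (m - n)%N); rewrite lerDl ltW.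
have [n] := scalar_archi (p_ge0 x) ltr01; rewrite mulr1.
have [_ _ _ nb] := cS n; exact: nb (xc n.+1).
Qed.

(** Zabreiko's lemma: successive approximation by vectors on which p is controlled. *)
Lemma zabreiko : exists2 C, 0 <= C & forall x, p x <= C * `|x|.
Proof.
have [x0 [r [M [r0 M0 xr]]]] := bounded_near_dense.
pose c := (M + M) / (r / 2).
have c0 : 0 <= c by rewrite /c divr_ge0 ?addr_ge0// ltW// divr_gt0.
have p0 : p 0 = 0 by rewrite -(scale0r 0) pZ normr0 mul0r.
have approx z : exists y, p y <= c * `|z| /\ `|z - y| <= `|z| * 2^-1.
  have [->|z0] := eqVneq z 0.
    by exists 0; rewrite p0 subrr normr0 mulr0 mul0r.
  have nz : 0 < `|z| by rewrite normr_gt0.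
  pose a := r / 2 / `|z|.
  have a0 : 0 < a by rewrite !divr_gt0.
  have az : `|a *: z| = r / 2 by rewrite normrZ gtr0_norm// divfK// gt_eqF.
  have d0 : 0 < r / 2 / 2 / 2 by rewrite !divr_gt0.
  have [|y1 py1 y1z] := xr (a *: z + x0) _ _ d0.
    by rewrite addrK az ltr_pdivrMr// mulr_natr mulr2n ltrDl.
  have [|y2 py2 y2z] := xr x0 _ _ d0; first by rewrite subrr normr0.
  exists (a^-1 *: (y1 - y2)); split.
    rewrite pZ gtr0_norm ?invr_gt0// ler_pdivrMl//.
    apply: (le_trans (pB _ _)); rewrite (_ : a * _ = M + M) ?lerD//.
    rewrite /a /c; field; rewrite !gt_eqF//.
  rewrite -[z in `|z - _|](scalerK (lt0r_neq0 a0)) -scalerBr normrZ.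
  rewrite gtr0_norm ?invr_gt0// ler_pdivrMl//.
  rewrite (_ : a *: z - _ = (y2 - x0) - (y1 - (a *: z + x0))); last first.
    by rewrite !opprB (addrC (a *: z) x0) -[in RHS](addrA x0) subrKA addrCA.
  apply: (le_trans (ler_normB _ _)); apply: (le_trans (lerD (ltW y2z) (ltW y1z))).
  rewrite (_ : a * _ = r / 2 / 2 / 2 + r / 2 / 2 / 2)//.
  by rewrite /a; field; rewrite !gt_eqF.
have [f fP] := choice approx.
exists (c * 2) => [|x]; first by rewrite mulr_ge0.
pose z := fix z n : X := if n is n'.+1 then z n' - f (z n') else x.
have zle n : `|z n| <= `|x| * 2^-1 ^+ n.
  elim: n => [|n IHn]; first by rewrite expr0 mulr1.
  have [_ /= /le_trans] := fP (z n); apply.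
  by rewrite exprSr mulrA ler_wpM2r.
have zsum N : \sum_(i < N) f (z i) = x - z N.
  elim: N => [|N IHN]; first by rewrite big_ord0 subrr.
  by rewrite big_ord_recr /= IHN opprB addrAC addrA.
rewrite mulrAC; apply: (p_sum (v := f \o z)).
  rewrite (_ : (fun N => _) = fun N => x - z N); last by apply/funext => N; rewrite zsum.
  apply/cvgrPdistC_lt => e e0.
  have e2 : 0 < e / 2 by rewrite divr_gt0.
  have [N Ne] := scalar_geom (normr_ge0 x) e2.
  exists N => // n /= Nn; rewrite addrAC subrr add0r normrN.
  apply: le_lt_trans (zle n) _; apply: (@le_lt_trans _ _ (e / 2)).
    apply: le_trans Ne; rewrite ler_wpM2l//.
    by rewrite ler_wiXn2l// ?invr_ge0// invf_le1// ler1n.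
  by rewrite ltr_pdivrMr// mulr_natr mulr2n ltrDl.
move=> i /=; have [+ _] := fP (z i) => /le_trans; apply.
by rewrite -(mulrA c) ler_wpM2l.
Qed.

End Zabreiko.

Section BasisCoordinates.
Variable K : scalarField.

Lemma geometric_sum_le (N : nat) : \sum_(i < N) 2^-1 ^+ i <= 2 :> K.
Proof.
suff -> : \sum_(i < N) 2^-1 ^+ i = 2 - 2 * 2^-1 ^+ N :> K.
  by rewrite gerBl mulr_ge0// exprn_ge0.
elim: N => [|N IHN]; first by rewrite big_ord0 expr0 mulr1 subrr.
by rewrite big_ord_recr /= IHN exprS mulrA mulfV// mul1r; ring.
Qed.

Lemma cvg_seq_bounded (X : normedModType K) (u : nat -> X) (l : X) :
  u @ \oo --> l -> exists M, forall N, `|u N| <= M.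
Proof.
move=> /cvgrPdist_lt/(_ _ ltr01)[N0 _ h].
exists (\sum_(i < N0) `|u i| + (`|l| + 1)) => N.
have s0 : 0 <= \sum_(i < N0) `|u i| by exact: sumr_ge0.
have [NN|NN] := ltnP N N0.
  by rewrite (bigD1 (Ordinal NN))//= -addrA lerDl !addr_ge0 ?sumr_ge0.
have /ltW uN := h N NN.
apply: (@le_trans _ _ (`|l| + 1)); last by rewrite lerDr.
by rewrite -[u N](subKr l) (le_trans (ler_normB _ _))// lerD.
Qed.

Variables (X : completeNormedModType K) (e : nat -> X).
Hypothesis eb : schauder_basis e.

(** By uniqueness of expansions, the supremum of the norms of the partial sums is a
    countably subadditive seminorm, which Zabreiko's lemma bounds by the norm. *)
Lemma basis_coordinates : exists (c : nat -> dual X) (C : K), [/\ 0 <= C,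
  forall N x, `|\sum_(j < N) \val (c j) x *: e j| <= C * `|x|,
  forall x, \sum_(j < N) \val (c j) x *: e j @[N --> \oo] --> x
  & forall i j, \val (c i) (e j) = (i == j)%:R].
Proof.
have [a aP] := choice eb.
have acvg x : \sum_(j < N) a x j *: e j @[N --> \oo] --> x by case: (aP x).
have auniq x (b : nat -> K) : \sum_(j < N) b j *: e j @[N --> \oo] --> x -> a x = b.
  by case: (aP x) => _; exact.
pose S N x : X := \sum_(j < N) a x j *: e j.
have alin t x y : a (t *: x + y) = fun j => t * a x j + a y j.
  apply: auniq; rewrite (_ : (fun N => _) = fun N => t *: S N x + S N y).
    by apply: cvgD; [apply: cvgZr; exact: acvg|exact: acvg].
  apply/funext => N; rewrite /S scaler_sumr -big_split /=; apply: eq_bigr => j _.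
  by rewrite scalerA scalerDl.
have Slin N t x y : S N (t *: x + y) = t *: S N x + S N y.
  rewrite /S scaler_sumr -big_split /=; apply: eq_bigr => j _.
  by rewrite alin scalerA scalerDl.
have a0 : a 0 = fun=> 0.
  apply: auniq; rewrite (_ : (fun N => _) = fun=> 0); first exact: cvg_cst.
  by apply/funext => N; rewrite big1// => j _; rewrite scale0r.
have ae j : a (e j) = fun i => (i == j)%:R.
  apply: auniq; apply/cvgrPdist_lt => d d0; exists j.+1 => // N /= jN.
  rewrite (bigD1 (Ordinal jN))//= eqxx scale1r big1 ?addr0 ?subrr ?normr0// => i ij.
  by rewrite (_ : (i == j :> nat) = false) ?scale0r//; exact/negbTE.
have e0 j : e j != 0.
  apply/eqP => ej; have := ae j; rewrite ej a0 => /(congr1 (fun f => f j)) /eqP.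
  by rewrite eqxx eq_sym oner_eq0.
have Sb x : exists M, forall N, `|S N x| <= M by exact: cvg_seq_bounded (acvg x).
pose p x : K := supremum 0 [set `|S N x| | N in setT].
have ple x N : `|S N x| <= p x.
  have [M xM] := Sb x; apply: (@ksup_ge _ _ M); last by exists N.
  by move=> _ [m _ <-]; rewrite normr_ge0 xM.
have lep x M : 0 <= M -> (forall N, `|S N x| <= M) -> p x <= M.
  by move=> M0 h; apply: ksup_le => // _ [N _ <-]; rewrite normr_ge0 h.
have p0 x : 0 <= p x by apply: le_trans (ple x 0%N).
have xp x : `|x| <= p x.
  apply: (@cvg_norm_le _ _ _ _ _ _ _ _ (acvg x)); apply: nearW => N; exact: ple.
have pD x y : p (x + y) <= p x + p y.
  apply: lep => [|N]; first exact: addr_ge0.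
  have := Slin N 1 x y; rewrite !scale1r => ->.
  by rewrite (le_trans (ler_normD _ _))// lerD.
have S0 N : S N 0 = 0 by rewrite /S a0 big1// => j _; rewrite scale0r.
have SZ N t x : S N (t *: x) = t *: S N x.
  by have := Slin N t x 0; rewrite !addr0 S0 addr0.
have pZle t x : p (t *: x) <= `|t| * p x.
  by apply: lep => [|N]; rewrite ?mulr_ge0// SZ normrZ ler_wpM2l.
have pZ t x : p (t *: x) = `|t| * p x.
  apply/eqP; rewrite eq_le pZle /=; have [->|t0] := eqVneq t 0.
    by rewrite normr0 mul0r.
  rewrite -ler_pdivlMl ?normr_gt0// -normfV.
  by have := pZle t^-1 (t *: x); rewrite scalerA mulVf// scale1r.
have SD N x y : S N (x + y) = S N x + S N y.
  by have := Slin N 1 x y; rewrite !scale1r.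
have Ssum N I (v : nat -> X) : S N (\sum_(i < I) v i) = \sum_(i < I) S N (v i).
  by elim: I => [|I IHI]; rewrite ?big_ord0 ?S0// !big_ord_recr /= SD IHI.
have aje x j : `|a x j| * `|e j| <= 2 * p x.
  have -> : `|a x j| * `|e j| = `|S j.+1 x - S j x|.
    by rewrite /S big_ord_recr /= addrAC subrr add0r normrZ.
  by rewrite (le_trans (ler_normB _ _))// mulrDl mul1r lerD.
have psum (v : nat -> X) (x : X) (C : K) : \sum_(i < N) v i @[N --> \oo] --> x ->
    (forall i, p (v i) <= C * 2^-1 ^+ i) -> p x <= C * 2.
  move=> vx pv.
  have C0 : 0 <= C by have := le_trans (p0 _) (pv 0%N); rewrite expr0 mulr1.
  have avc j : cvg (\sum_(i < I) (a (v i) j : K^o) @[I --> \oo]).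
    pose w i : scalar_space K := a (v i) j.
    suff /cvg_ex[l Sl] : cvg (\sum_(i < I) w i @[I --> \oo]) by apply/cvg_ex; exists l.
    apply: (@abs_series_cvg _ _ _ (2 * C * `|e j|^-1 * 2)) => I.
    apply: (@le_trans _ _ (\sum_(i < I) (2 * C * `|e j|^-1) * 2^-1 ^+ i)).
      apply: ler_sum => i _; rewrite mulrAC ler_pdivlMr ?normr_gt0//.
      by apply: le_trans (aje _ _) _; rewrite -mulrA ler_wpM2l.
    by rewrite -mulr_sumr ler_wpM2l ?geometric_sum_le// mulr_ge0 ?invr_ge0// mulr_ge0.
  pose b j : K^o := lim (\sum_(i < I) (a (v i) j : K^o) @[I --> \oo]).
  pose T N : X := \sum_(j < N) b j *: e j.
  have Tcvg N : \sum_(i < I) S N (v i) @[I --> \oo] --> T N.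
    rewrite (_ : (fun I => _) = fun I => \sum_(j < N) (\sum_(i < I) a (v i) j) *: e j).
      by apply: cvg_sum => j; apply: cvgZl; exact: avc.
    apply/funext => I; rewrite /S exchange_big /=; apply: eq_bigr => j _.
    by rewrite scaler_suml.
  have Tle N : `|T N| <= C * 2.
    apply: (@cvg_norm_le _ _ _ _ _ _ _ _ (Tcvg N)); apply: nearW => I.
    apply: le_trans (ler_norm_sum _ _ _) _.
    apply: (@le_trans _ _ (\sum_(i < I) C * 2^-1 ^+ i)).
      by apply: ler_sum => i _; exact: le_trans (ple _ _) (pv _).
    by rewrite -mulr_sumr ler_wpM2l ?geometric_sum_le.
  have Tx : T @ \oo --> x.
    apply/cvgrPdist_le => d d0; have d2 : 0 < d / 2 by rewrite divr_gt0.
    have [I0 I0d] := scalar_geom (mulr_ge0 (mulr_ge0 (ler0n K 2) C0) (ler0n K 2)) d2.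
    have fin : \sum_(i < I0) (v i - S N (v i)) @[N --> \oo] --> \sum_(i < I0) (v i - v i).
      by apply: cvg_sum => i; apply: cvgB; [exact: cvg_cst|exact: acvg].
    have := fin; rewrite big1 => [|i _]; last exact: subrr.
    move=> /cvgrPdist_le/(_ _ d2)[N0 _ hN]; exists N0 => // N /hN /=.
    rewrite sub0r normrN => Nd.
    have xT : \sum_(i < I) (v i - S N (v i)) @[I --> \oo] --> x - T N.
      rewrite (_ : (fun I => _) = fun I => \sum_(i < I) v i - \sum_(i < I) S N (v i)).
        by apply: cvgB.
      by apply/funext => I; rewrite sumrB.
    apply: (@cvg_norm_le _ _ _ _ _ _ _ _ xT); exists I0 => // I /= II.
    rewrite -(subnKC II) big_split_ord /= [leRHS]splitr.
    apply: (le_trans (ler_normD _ _)); apply: lerD => //.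
    apply: le_trans I0d; apply: le_trans (ler_norm_sum _ _ _) _.
    apply: (@le_trans _ _ (\sum_(i < I - I0) 2 * C * 2^-1 ^+ I0 * 2^-1 ^+ i)).
      apply: ler_sum => i _; apply: le_trans (ler_normB _ _) _.
      rewrite -!mulrA -exprD mulrDl !mul1r lerD//.
        exact: le_trans (xp _) (pv _).
      exact: le_trans (ple _ _) (pv _).
    rewrite -mulr_sumr [leRHS]mulrAC ler_wpM2l ?geometric_sum_le//.
    by rewrite mulr_ge0 ?exprn_ge0// mulr_ge0.
  apply: lep => [|N]; first exact: mulr_ge0.
  by rewrite /S (auniq _ _ Tx); exact: Tle.
have [C C0 pC] := zabreiko p0 pD pZ psum.
pose c j : X -> K^o := fun x => a x j.
have cd j : dual_set (c j).
  apply: (@dual_intro _ _ _ (2 * C / `|e j|)) => [t x y|x].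
    by rewrite /c alin.
  rewrite mulrAC ler_pdivlMr ?normr_gt0//; apply: le_trans (aje _ _) _.
  by rewrite -mulrA ler_wpM2l.
exists (fun j => to_dual (c j)), C; split=> //.
- move=> N x; apply: le_trans (pC x); apply: le_trans (ple x N).
  rewrite le_eqVlt; apply/orP; left; apply/eqP; congr (`|_|).
  by apply: eq_bigr => j _; rewrite to_dualE.
- move=> x; rewrite (_ : (fun N => _) = fun N => S N x); first exact: acvg.
  by apply/funext => N; apply: eq_bigr => j _; rewrite to_dualE.
- by move=> i j; rewrite to_dualE// /c ae.
Qed.

End BasisCoordinates.

Lemma closure_normP (K : numFieldType) (X : normedModType K) (A : set X) x :
  closure A x <-> forall d : K, 0 < d -> exists2 y, A y & `|x - y| < d.
Proof.
split=> [clA d d0|h B /nbhs_normP[d /= d0 dB]].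
  have [y [Ay xy]] : A `&` ball x d !=set0 by apply: clA; exact: nbhsx_ballx.
  by exists y => //; rewrite -ball_normE in xy.
by have [y Ay xy] := h d d0; exists y; split=> //; exact: dB.
Qed.

(** A converse: the uniform bound of the projections carries the convergence of
    Q t x to x from the span of b, where it is trivial, to the whole space. *)
Lemma basis_of_projections (K : scalarField) (X : completeNormedModType K) (b : nat -> X)
    (Q : nat -> X -> X) (C : K) : 0 <= C ->
  (forall r, b r != 0) ->
  (forall t x y a, Q t (a *: x + y) = a *: Q t x + Q t y) ->
  (forall t x, `|Q t x| <= C * `|x|) ->
  (forall t r, Q t (b r) = if (r < t)%N then b r else 0) ->
  (forall x d, 0 < d -> exists N (a : nat -> K), `|x - \sum_(j < N) a j *: b j| <= d) ->
  schauder_basis b.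
Proof.
move=> C0 b0 Qlin QC Qb dense_b x.
have Q0 t : Q t 0 = 0 by have := Qlin t 0 0 (-1); rewrite scaler0 addr0 scaleN1r addNr.
have QD t x1 x2 : Q t (x1 + x2) = Q t x1 + Q t x2.
  by have := Qlin t x1 x2 1; rewrite !scale1r.
have QZ t a x1 : Q t (a *: x1) = a *: Q t x1.
  by have := Qlin t x1 0 a; rewrite !addr0 Q0 addr0.
have QB t x1 x2 : Q t (x1 - x2) = Q t x1 - Q t x2.
  by rewrite QD -scaleN1r QZ scaleN1r.
have Qsum t N (a : nat -> K) : Q t (\sum_(j < N) a j *: b j) =
    \sum_(j < N | (j < t)%N) a j *: b j.
  rewrite [RHS]big_mkcond /=; elim: N => [|N IHN]; first by rewrite !big_ord0.
  by rewrite !big_ord_recr /= QD IHN QZ Qb; case: ifP => // _; rewrite scaler0.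
(* the partial sums of an expansion of x are the values Q t x *)
have Qlim y (a : nat -> K) t : \sum_(j < N) a j *: b j @[N --> \oo] --> y ->
    Q t y = \sum_(j < t) a j *: b j.
  move=> ay; apply/eqP; rewrite -subr_eq0 -normr_le0; apply/ler_addgt0Pr => d d0.
  have C1 : 0 < C + 1 by rewrite ltr_wpDl.
  have /cvgrPdist_lt/(_ _ (divr_gt0 d0 C1))[N _ /(_ (N + t)%N (leq_addr _ _))/=] := ay.
  rewrite addnC => Nd.
  have -> : \sum_(j < t) a j *: b j = Q t (\sum_(j < t + N) a j *: b j).
    by rewrite Qsum big_split_ord /= [X in _ + X]big1 ?addr0 => [|i];
      rewrite ?ltnNge ?leq_addr//; apply: eq_bigl => i; rewrite ltn_ord.
  rewrite -QB add0r; apply: le_trans (QC _ _) _.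
  apply: (@le_trans _ _ ((C + 1) * (d / (C + 1)))); last first.
    by rewrite mulrC divfK// gt_eqF.
  by rewrite ler_pM// ?lerDl// ltW.
have Qcvg y : Q t y @[t --> \oo] --> y.
  apply/cvgrPdist_le => d d0.
  have C1 : 0 < C + 1 by rewrite ltr_wpDl.
  have [N [a ya]] := dense_b y _ (divr_gt0 d0 C1).
  exists N => // t /= Nt; set z := \sum_(j < N) _ in ya.
  have Qz : Q t z = z.
    by rewrite Qsum; apply: eq_bigl => i; rewrite (leq_trans (ltn_ord i) Nt).
  rewrite (_ : y - Q t y = (y - z) - Q t (y - z)); last first.
    by rewrite QB Qz opprB addrA subrK.
  apply: le_trans (ler_normB _ _) _; apply: le_trans (lerD ya (QC _ _)) _.
  apply: (@le_trans _ _ ((C + 1) * (d / (C + 1)))); last first.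
    by rewrite mulrC divfK// gt_eqF.
  by rewrite mulrDl mul1r addrC lerD2r ler_wpM2l.
(* Q t.+1 - Q t has values in the line of b t, because this line is closed *)
have coef y t : exists a, Q t.+1 y - Q t y = a *: b t.
  pose D z := Q t.+1 z - Q t z.
  have Dsum N (a : nat -> K) : exists a', D (\sum_(j < N) a j *: b j) = a' *: b t.
    rewrite /D !Qsum.
    exists (if (t < N)%N then a t else 0).
    have [tN|Nt] := ltnP t N.
      rewrite (bigD1 (Ordinal tN))//= -addrA -[RHS]addr0; congr (_ + _).
      rewrite (eq_bigl (fun i : 'I_N => (i < t)%N)) ?subrr// => i.
      by rewrite ltnS leq_eqVlt -(inj_eq val_inj) /=; case: (ltngtP i t).
    rewrite scale0r (eq_bigl (fun i : 'I_N => (i < t)%N)) ?subrr// => i.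
    by rewrite (leq_trans (ltn_ord i) Nt) ltnW// ltnS (leq_trans (ltn_ord i) Nt).
  have [phi phi1 phib] := norming_functional (b t).
  have phi0 : \val phi (b t) != 0.
    by rewrite -normr_gt0 (lt_le_trans _ phib)// normr_gt0.
  exists (\val phi (D y) / \val phi (b t)).
  apply/eqP; rewrite -subr_eq0 -normr_le0; apply/ler_addgt0Pr => d d0; rewrite add0r.
  pose P z := z - (\val phi z / \val phi (b t)) *: b t.
  pose M := 1 + `|phi| / `|\val phi (b t)| * `|b t|.
  have M0 : 0 < M by rewrite ltr_pwDl// mulr_ge0// divr_ge0.
  have PM z : `|P z| <= M * `|z|.
    apply: le_trans (ler_normB _ _) _; rewrite mulrDl mul1r lerD2l normrZ normrM normfV.
    rewrite [leRHS]mulrAC ler_wpM2r// [leRHS]mulrAC ler_wpM2r ?invr_ge0//; exact: ler_dual.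
  have CM : 0 < M * (C + C) + 1 by rewrite ltr_wpDl// mulr_ge0 ?addr_ge0// ltW.
  have [N [a ya]] := dense_b y _ (divr_gt0 d0 CM); set z := \sum_(j < N) _ in ya.
  have [a' za'] := Dsum N a.
  rewrite -/(P (D y)) (_ : P (D y) = P (D (y - z))); last first.
    rewrite /P (_ : D (y - z) = D y - a' *: b t); last first.
      by rewrite -za' /D !QB !opprB addrACA [RHS]addrACA; congr (_ + _); exact: addrC.
    rewrite (dualB phi (D y)) dualZ mulrBl scalerBl mulfK// opprB addrA.
    by rewrite subrK.
  apply: le_trans (PM _) _.
  apply: (@le_trans _ _ (M * ((C + C) * (d / (M * (C + C) + 1))))).
    rewrite ler_wpM2l ?(ltW M0)//; apply: le_trans (ler_normB _ _) _.
    rewrite mulrDl lerD//; apply: le_trans (QC _ _) _; exact: ler_wpM2l.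
  rewrite mulrA mulrC -mulrA ler_piMr ?(ltW d0)// mulrC ler_pdivrMr// mul1r.
  by rewrite lerDl.
have [a aP] := choice (coef x).
have Q00 : Q 0%N x = 0.
  apply/eqP; rewrite -normr_le0; apply/ler_addgt0Pr => d d0; rewrite add0r.
  have C1 : 0 < C + 1 by rewrite ltr_wpDl.
  have [N [c xc]] := dense_b x _ (divr_gt0 d0 C1).
  rewrite -[Q 0%N x]subr0 -(_ : Q 0%N (\sum_(j < N) c j *: b j) = 0); last first.
    by rewrite Qsum big1.
  rewrite -QB; apply: le_trans (QC _ _) _.
  apply: (@le_trans _ _ ((C + 1) * (d / (C + 1)))); last first.
    by rewrite mulrC divfK// gt_eqF.
  by rewrite ler_pM// lerDl.
exists a; split=> [|a' xa'].
  rewrite (_ : (fun N => _) = fun N => Q N x); first exact: Qcvg.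
  apply/funext => N; elim: N => [|N IHN]; first by rewrite big_ord0 Q00.
  by rewrite big_ord_recr /= IHN -aP addrC subrK.
apply/funext => t; apply/eqP; rewrite -subr_eq0.
have : (a t - a' t) *: b t == 0.
  rewrite scalerBl subr_eq0; apply/eqP.
  by rewrite -aP !(Qlim _ _ _ xa') big_ord_recr /= addrAC subrr add0r.
by rewrite scaler_eq0 (negbTE (b0 t)) orbF.
Qed.
(** * Factorization through bounded sequences for spaces with separable dual *)

Section WeakStarFunctions.
Variables (K : scalarField) (X : normedModType K).

(** The dual unit ball. Its weak-star topology is used through convergence of filters
    only. *)
Definition dball : Type := {k : dual X | `|k| <= 1}.

Definition ev (x : X) (k : dball) : K^o := \val (sval k) x.

Definition weakstar_cvg (F : set_system dball) (k : dball) :=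
  forall x, ev x @ F --> ev x k.

Definition wfun : set (dball -> K^o) :=
  [set g | (exists M, forall k, `|g k| <= M) /\
           forall F k, ProperFilter F -> weakstar_cvg F k -> g @ F --> g k].

Lemma ev_le x k : `|ev x k| <= `|x|.
Proof.
apply: le_trans (ler_dual _ _) _; rewrite -[leRHS]mul1r ler_wpM2r//.
by case: k.
Qed.

Lemma wfun_cst (c : K) : wfun (fun=> c).
Proof. by split=> [|F k FF _]; [exists `|c| | exact: cvg_cst]. Qed.

Lemma wfun_ev x : wfun (ev x).
Proof. by split=> [|F k FF]; [exists `|x| => k; exact: ev_le | exact]. Qed.

Lemma wfunD f g : wfun f -> wfun g -> wfun (fun k => f k + g k).
Proof.
move=> [[M fM] fc] [[N gN] gc]; split=> [|F k FF Fk].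
  by exists (M + N) => k; rewrite (le_trans (ler_normD _ _))// lerD.
by apply: cvgD; [exact: fc|exact: gc].
Qed.

Lemma wfunM f g : wfun f -> wfun g -> wfun (fun k => f k * g k).
Proof.
move=> [[M fM] fc] [[N gN] gc]; split=> [|F k FF Fk].
  by exists (M * N) => k; rewrite normrM ler_pM.
by apply: cvgM; [exact: fc|exact: gc].
Qed.

Lemma wfunB f g : wfun f -> wfun g -> wfun (fun k => f k - g k).
Proof.
move=> fw gw; rewrite (_ : (fun k => _) = fun k => f k + (-1) * g k).
  by apply: wfunD => //; apply: wfunM => //; exact: wfun_cst.
by apply/funext => k; rewrite mulN1r.
Qed.

Lemma wfun_norm f : wfun f -> wfun (fun k => `|f k|).
Proof.
move=> [[M fM] fc]; split=> [|F k FF Fk].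
  by exists M => k; rewrite normr_id.
by apply: cvg_norm; exact: fc.
Qed.

Lemma wfun_prod (I : Type) (s : seq I) (f : I -> dball -> K^o) :
  (forall i, wfun (f i)) -> wfun (fun k => \prod_(i <- s) f i k).
Proof.
move=> fw; elim: s => [|i s IHs].
  by under eq_fun do rewrite big_nil; exact: wfun_cst.
by under eq_fun do rewrite big_cons; exact: wfunM.
Qed.

Lemma wfun_closed : subspace_closed wfun.
Proof.
split=> [|a u v uw vw]; first exact: wfun_cst.
by apply: wfunD => //; apply: wfunM => //; exact: wfun_cst.
Qed.

Lemma wfun_norm_on :
  norm_on wfun (fun g => supremum 0 [set `|g k| | k in [set: dball]]).
Proof.
apply: (@sup_norm_on _ _ _ setT (fun k (g : dball -> K^o) => `|g k|)).
- exact: wfun_closed.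
- by [].
- by move=> k u v; exact: ler_normD.
- by move=> k a u; rewrite -normrM.
- by move=> u [[M uM] _]; exists M.
- by move=> u _ u0; apply/funext => k; apply/eqP; rewrite -normr_eq0 u0.
Qed.

Definition wfun_normed := NormedSub wfun_closed wfun_norm_on.

Lemma wfun_complete (F : set_system (ns_type wfun_normed)) :
  ProperFilter F -> cauchy F -> cvg F.
Proof.
apply: (@sup_norm_complete _ _ setT) => //.
- by move=> u [[M uM] _]; exists M.
- move=> k; exists 1 => // u [[M uM] _]; rewrite mul1r.
  apply: (@ksup_ge _ _ M) => [_ [i _ <-]|]; last by exists k.
  by rewrite normr_ge0 uM.
- move=> g gP; split.
    have [[k0 _]|T0] := pselect (exists k : dball, True); last first.
      by exists 0 => k; case: T0; exists k.
    have [f [[[M fM] _] _ fg]] := gP k0 k0 k0 1 ltr01.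
    exists (M + 1) => k; rewrite -[g k](subKr (f k)).
    by rewrite (le_trans (ler_normB _ _))// lerD// fg.
  move=> G k FG Gk; apply/cvgrPdist_le => e e0.
  have e3 : 0 < e / 3 by rewrite divr_gt0.
  have [f [[_ fc] _ fg]] := gP k k k _ e3.
  have /cvgrPdist_le/(_ _ e3) := fc G k FG Gk; apply: filterS => l fkl.
  rewrite (_ : g k - g l = (f k - f l) - (f k - g k) + (f l - g l)); last by ring.
  rewrite (_ : e = e / 3 + e / 3 + e / 3); last by field.
  by rewrite (le_trans (ler_normD _ _))// lerD ?fg// (le_trans (ler_normB _ _))// lerD ?fg.
Qed.

Definition wspace : completeNormedModType K := bs_type (BanachSub wfun_complete).

Definition to_w (g : dball -> K^o) : wspace := insubd (0 : wspace) g.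

Lemma to_wE g : wfun g -> \val (to_w g) = g.
Proof. by move=> gw; rewrite /to_w insubdK//; exact: mem_set. Qed.

Lemma wspaceP (g : wspace) : wfun (\val g).
Proof. exact/set_mem/valP. Qed.

Lemma wspace_le (g : wspace) M : 0 <= M -> (forall k, `|\val g k| <= M) -> `|g| <= M.
Proof.
by move=> M0 gM; rewrite ns_normE; apply: ksup_le => // _ [k _ <-]; rewrite normr_ge0 gM.
Qed.

Lemma wspace_ge (g : wspace) k : `|\val g k| <= `|g|.
Proof.
have [[M gM] _] := wspaceP g; rewrite ns_normE; apply: (@ksup_ge _ _ M); last by exists k.
by move=> _ [l _ <-]; rewrite normr_ge0 gM.
Qed.

Lemma wspace_ext (f g : wspace) : (forall k, \val f k = \val g k) -> f = g.
Proof. by move=> fg; apply: val_inj; apply/funext. Qed.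

Lemma wspace_valB (f g : wspace) k : \val (f - g) k = \val f k - \val g k.
Proof. by rewrite bs_valB. Qed.

Lemma wspace_valD (f g : wspace) k : \val (f + g) k = \val f k + \val g k.
Proof. by rewrite bs_valD. Qed.

Lemma wspace_valZ a (f : wspace) k : \val (a *: f) k = a * \val f k.
Proof. by rewrite bs_valZ. Qed.

Lemma wspace_val_sum (I : Type) (s : seq I) (f : I -> wspace) k :
  \val (\sum_(i <- s) f i) k = \sum_(i <- s) \val (f i) k.
Proof. by rewrite bs_val_sum fct_sumE. Qed.

(** Banach-Alaoglu, in terms of ultrafilters. *)
Lemma alaoglu (U : set_system dball) : UltraFilter U -> exists k, weakstar_cvg U k.
Proof.
move=> UU.
have PU : ProperFilter U by exact: ultra_proper.
have /choice[f fcv] x : exists l : K^o, ev x @ U --> l.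
  have /cvg_ex[l ul] : cvg (ev x @ U : set_system K).
    apply: (@scalar_ultra_cvg _ `|x|); first exact: ultra_fmap.
    by rewrite /fmap; apply: (@filterE _ U) => k /=; exact: ev_le.
  by exists l.
have fl : linear f.
  move=> a x y; apply: normed_lim_unique (fcv (a *: x + y)) _.
  rewrite [X in X @ _](_ : _ = (fun k => a *: ev x k + ev y k)).
    by apply: cvgD; [apply: cvgZr; exact: fcv|exact: fcv].
  by apply/funext => k; rewrite /ev dualD dualZ.
have f1 x : `|f x| <= 1 * `|x|.
  rewrite mul1r; apply: (@cvg_norm_le _ _ _ _ _ _ _ _ (fcv x)).
  by apply: (@filterE _ U) => k; exact: ev_le.
have fd := dual_intro fl f1.
have fn : `|to_dual f| <= 1 by apply: dual_le => // x; rewrite to_dualE.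
by exists (exist _ (to_dual f) fn) => x; rewrite {2}/ev /= to_dualE.
Qed.

(** Dini's theorem: a limit along an ultrafilter of points where the functions are not
    small would be a point where they do not tend to 0. *)
Lemma dini (h : nat -> dball -> K^o) : (forall n, wfun (h n)) ->
  (forall n k, 0 <= h n k) -> (forall n k, h n.+1 k <= h n k) ->
  (forall k, exists n, h n k = 0) ->
  forall d, 0 < d -> exists N, forall n k, (N <= n)%N -> h n k <= d.
Proof.
move=> hw h0 hS hz d d0.
have hmon m n k : (m <= n)%N -> h n k <= h m k.
  by move/subnKC => <-; elim: (n - m)%N => [|i IHi]; rewrite ?addn0// addnS (le_trans (hS _ _)).
suff [N hN] : exists N, forall k, h N k <= d.
  by exists N => n k Nn; exact: le_trans (hmon _ _ _ Nn) (hN k).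
apply: contrapT => /forallNP hN.
have /choice[kap kapP] N : exists k, d < h N k.
  have /existsNP[k /negP hk] := hN N; exists k.
  by rewrite real_ltNge// ?ger0_real// ltW.
have [U [UU sU]] := ultraFilterLemma (@eventually_filter : ProperFilter \oo).
have [k kU] := alaoglu (ultra_fmap kap UU).
have [n hn] := hz k.
have PU : ProperFilter (kap @ U) by have [] := ultra_fmap kap UU.
have hcvg : h n @ (kap @ U) --> h n k := (hw n).2 _ k PU kU.
have near0 : U [set N | `|h n k - h n (kap N)| < d].
  by have /cvgrPdist_lt/(_ _ d0) := hcvg.
rewrite hn in near0.
have nearn : U [set N | (n <= N)%N] by apply: sU; exists n.
have [N [/= + nN]] := filter_ex (filterI near0 nearn).
rewrite sub0r normrN ger0_norm// => /(lt_trans (lt_le_trans (kapP N) (hmon n N _ nN))).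
by rewrite ltxx.
Qed.

(** A bounded increasing sequence of functions is weakly Cauchy for a functional, even
    after multiplication with arbitrary functions of the unit ball: otherwise its
    increments would be unconditionally summable with large values. *)
Lemma increments_small (g : nat -> dball -> K^o) (mu : dual wspace) (e : K) :
  (forall p, wfun (g p)) -> (forall p k, 0 <= g p k <= 1) ->
  (forall p k, g p k <= g p.+1 k) -> 0 < e ->
  exists p0, forall p h, (p0 <= p)%N -> wfun h -> (forall k, `|h k| <= 1) ->
    `|\val mu (to_w (fun k => h k * (g p k - g p0 k)))| <= e.
Proof.
move=> gw g01 gS e0.
have gmon m n k : (m <= n)%N -> g m k <= g n k.
  by move/subnKC => <-; elim: (n - m)%N => [|i IHi]; rewrite ?addn0// addnS (le_trans IHi).
apply: contrapT => /forallNP H.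
have /choice[P PP] p0 : exists ph : nat * (dball -> K^o), [/\ (p0 <= ph.1)%N, wfun ph.2,
    forall k, `|ph.2 k| <= 1 &
    e < `|\val mu (to_w (fun k => ph.2 k * (g ph.1 k - g p0 k)))|].
  apply: contrapT => /forallNP H1; apply: (H p0) => p h p0p hw h1.
  apply: contrapT => /negP he; apply: (H1 (p, h)); split=> //=.
  by rewrite real_ltNge// ?gtr0_real.
pose fix t i := if i is i'.+1 then (P (t i')).1 else 0%N.
pose v i : wspace := to_w (fun k => (P (t i)).2 k * (g (t i.+1) k - g (t i) k)).
have vE i : \val (v i) = fun k => (P (t i)).2 k * (g (t i.+1) k - g (t i) k).
  by rewrite to_wE//; apply: wfunM; [case: (PP (t i))|exact: wfunB].
have vmu N : \sum_(i < N) `|\val mu (v i)| <= 1 * `|mu|.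
  apply: sum_norm_dual => w w1; apply: wspace_le => // k.
  rewrite wspace_val_sum; apply: le_trans (ler_norm_sum _ _ _) _.
  apply: (@le_trans _ _ (\sum_(i < N) (g (t i.+1) k - g (t i) k))).
    apply: ler_sum => i _; have [tt' _ h1 _] := PP (t i).
    have gg : 0 <= g (t i.+1) k - g (t i) k by rewrite subr_ge0; exact: gmon.
    rewrite wspace_valZ vE !normrM (ger0_norm gg).
    by rewrite mulrA ler_piMl// mulr_ile1.
  have -> : \sum_(i < N) (g (t i.+1) k - g (t i) k) = g (t N) k - g (t 0%N) k.
    by rewrite -(big_mkord xpredT (fun i => g (t i.+1) k - g (t i) k)) telescope_sumr.
  have /andP[_ tN] := g01 (t N) k; have /andP[t0 _] := g01 (t 0%N) k.
  by rewrite lerBlDr (le_trans tN)// lerDl.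
have [N mN] := scalar_archi (normr_ge0 mu) e0.
have : N.+1%:R * e <= \sum_(i < N.+1) `|\val mu (v i)|.
  rewrite mulr_natl -[X in e *+ X]card_ord -sumr_const; apply: ler_sum => i _.
  by case: (PP (t i)) => _ _ _ /ltW.
move=> /le_trans/(_ (vmu _)); rewrite mul1r => /le_trans/(_ mN).
by rewrite ler_pM2r// ler_nat ltnn.
Qed.

End WeakStarFunctions.

Section Factorization.
Variables (K : scalarField) (X : normedModType K).
Variables (kk : nat -> dual X) (xx : nat -> X) (eps : K).
Hypothesis eps0 : 0 < eps.
Hypothesis kk_le : forall m, `|kk m| <= 2.
Hypothesis kk_dense : forall k : dball X, exists m, `|sval k - kk m| <= eps.
Hypothesis xx_le : forall q, `|xx q| <= 1.
Hypothesis xx_norming : forall (phi : dual X) C, 0 <= C ->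
  (forall q, `|\val phi (xx q)| <= C) -> `|phi| <= C.

Let G := wspace X.

Definition pos_part (x : K) : K := (x + `|x|) / 2.

Lemma pos_part_ge x : 0 <= x -> pos_part x = x.
Proof. by move=> x0; rewrite /pos_part ger0_norm//; field. Qed.

Lemma pos_part_le x : x <= 0 -> pos_part x = 0.
Proof. by move=> x0; rewrite /pos_part ler0_norm// subrr mul0r. Qed.

(** 1 up to eps, 0 beyond 2 * eps, and affine in between. *)
Definition cutoff (t : K) : K := pos_part (1 - pos_part (t - eps) / eps).

Lemma cutoff_near t : 0 <= t -> t <= eps -> cutoff t = 1.
Proof.
move=> t0 te; rewrite /cutoff (@pos_part_le (t - eps)) ?subr_le0//.
by rewrite mul0r subr0 pos_part_ge.
Qed.

Lemma cutoffP t : 0 <= t -> [/\ 0 <= cutoff t, cutoff t <= 1 &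
  cutoff t * t <= 2 * eps * cutoff t].
Proof.
move=> t0; have [te|/ltW et] := real_leP (ger0_real t0) (gtr0_real eps0).
  rewrite cutoff_near// mul1r mulr1 ler01 lexx; split=> //.
  by rewrite (le_trans te)// mulrDl mul1r lerDl ltW.
rewrite /cutoff (@pos_part_ge (t - eps)) ?subr_ge0//.
have e1 : 1 - (t - eps) / eps = (2 * eps - t) / eps by field; rewrite gt_eqF.
rewrite e1; have [t2|/ltW t2] := real_leP (ger0_real t0) (gtr0_real (mulr_gt0 (ltr0n K 2) eps0)).
  have h : 0 <= (2 * eps - t) / eps by rewrite divr_ge0 ?subr_ge0// ltW.
  rewrite pos_part_ge//; split=> //; last by rewrite mulrC ler_wpM2r.
  by rewrite -e1 gerBl divr_ge0 ?subr_ge0// ltW.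
by rewrite pos_part_le ?mul0r ?mulr0 ?ler01// mulr_le0_ge0 ?subr_le0// invr_ge0 ltW.
Qed.

Lemma wfun_pos_part (f : dball X -> K^o) : wfun f -> wfun (fun k => pos_part (f k)).
Proof.
move=> fw; apply: wfunM; last exact: wfun_cst.
by apply: wfunD => //; exact: wfun_norm.
Qed.

Lemma wfun_cutoff (f : dball X -> K^o) : wfun f -> wfun (fun k => cutoff (f k)).
Proof.
move=> fw; apply: wfun_pos_part; apply: wfunB; first exact: wfun_cst.
apply: wfunM; last exact: wfun_cst.
by apply: wfun_pos_part; apply: wfunB => //; exact: wfun_cst.
Qed.

(** The distance from k to kk m is the supremum over q of these numbers. *)
Let dev m q (k : dball X) : K^o := `|ev (xx q) k - \val (kk m) (xx q)|.

(** Decreases with p to a function that is 1 on the ball of radius eps about kk m and 0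
    off the ball of radius 2 * eps. *)
Let close m p (k : dball X) : K^o := \prod_(q < p) cutoff (dev m q k).

(** In the limit, 1 when k is at a distance more than 2 * eps from kk 0, ..., kk M.-1, and
    0 when it is within eps of one of them. *)
Let rest M p (k : dball X) : K^o := \prod_(m < M) (1 - close m p k).

(** For each p, the functions piece m p, m < M, and rest M p form a partition of unity. *)
Let piece m p (k : dball X) : K^o := rest m p k * close m p k.

Let dev_wfun m q : wfun (dev m q).
Proof. by apply: wfun_norm; apply: wfunB; [exact: wfun_ev|exact: wfun_cst]. Qed.

Let close_wfun m p : wfun (close m p).
Proof. by apply: wfun_prod => q; apply: wfun_cutoff; exact: dev_wfun. Qed.

Let rest_wfun M p : wfun (rest M p).
Proof. by apply: wfun_prod => m; apply: wfunB; [exact: wfun_cst|exact: close_wfun]. Qed.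

Let piece_wfun m p : wfun (piece m p).
Proof. exact: wfunM. Qed.

Let close01 m p k : 0 <= close m p k <= 1.
Proof.
apply/andP; split.
  by apply: prodr_ge0 => q _; have [] := cutoffP (normr_ge0 (ev (xx q) k - \val (kk m) (xx q))).
by apply: prodr_ile1 => q _; have [-> ->] := cutoffP (normr_ge0 (ev (xx q) k - \val (kk m) (xx q))).
Qed.

Let closeS m p k : close m p.+1 k <= close m p k.
Proof.
rewrite /close big_ord_recr /= ler_piMr//; first by have /andP[] := close01 m p k.
by have [] := cutoffP (normr_ge0 (ev (xx p) k - \val (kk m) (xx p))).
Qed.

Let close_dev m p q k : (q < p)%N -> close m p k * dev m q k <= 2 * eps * close m p k.
Proof.
move=> qp; rewrite /close (bigD1 (Ordinal qp))//= mulrAC mulrA.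
have [_ _ h] := cutoffP (normr_ge0 (ev (xx q) k - \val (kk m) (xx q))).
apply: ler_wpM2r => //; apply: prodr_ge0 => i _.
by have [] := cutoffP (normr_ge0 (ev (xx i) k - \val (kk m) (xx i))).
Qed.

Let close_eventually (k : dball X) : exists m, forall p, close m p k = 1.
Proof.
have [m km] := kk_dense k; exists m => p; apply: big1 => q _.
apply: cutoff_near; first exact: normr_ge0.
apply: le_trans km; rewrite /dev /ev -dual_valB.
by apply: le_trans (ler_dual _ _) _; rewrite ler_piMr.
Qed.

Let co_close01 m p k : 0 <= 1 - close m p k <= 1.
Proof. by have /andP[c0 c1] := close01 m p k; rewrite subr_ge0 c1 gerBl. Qed.

Let rest01 M p k : 0 <= rest M p k <= 1.
Proof.
apply/andP; split.
  by apply: prodr_ge0 => m _; have /andP[] := co_close01 m p k.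
by apply: prodr_ile1 => m _; exact: co_close01.
Qed.

Let restS M p k : rest M p k <= rest M p.+1 k.
Proof.
apply: ler_prod => m _; have /andP[-> _] := co_close01 m p k.
by rewrite lerD2l lerN2 closeS.
Qed.

Let restM M p k : rest M.+1 p k = rest M p k * (1 - close M p k).
Proof. by rewrite /rest big_ord_recr. Qed.

Let pieceE m p k : piece m p k = rest m p k - rest m.+1 p k.
Proof. by rewrite restM /piece; ring. Qed.

Let piece_ge0 m p k : 0 <= piece m p k.
Proof.
by have /andP[? _] := rest01 m p k; have /andP[? _] := close01 m p k; exact: mulr_ge0.
Qed.

Let sum_piece M p k : \sum_(m < M) piece m p k = 1 - rest M p k.
Proof.
elim: M => [|M IHM]; first by rewrite big_ord0 /rest big_ord0 subrr.
by rewrite big_ord_recr /= IHM pieceE; ring.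
Qed.

Let sum_piece_le1 M p k : \sum_(m < M) piece m p k <= 1.
Proof. by rewrite sum_piece gerBl; have /andP[] := rest01 M p k. Qed.

Let mu_cvg (mu : dual G) (f : nat -> dball X -> K^o) :
  (forall p, wfun (f p)) -> (forall p k, 0 <= f p k <= 1) ->
  (forall p k, f p k <= f p.+1 k) ->
  exists l : K^o, (\val mu (to_w (f p)) : K^o) @[p --> \oo] --> l.
Proof.
move=> fw f01 fS; pose u p : scalar_space K := \val mu (to_w (f p)).
suff /cvg_ex[l ul] : cvg (u @ \oo) by exists l.
apply: cauchy_cvg; apply: cauchy_exP => e e0.
have e2 : 0 < e / 2 by rewrite divr_gt0.
have [p0 hp0] := @increments_small _ _ f mu (e / 2) fw f01 fS e2.
exists (u p0), p0 => // p /= pp0; rewrite -ball_normE /=.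
have := hp0 p (fun=> 1) pp0 (wfun_cst _ _) _.
rewrite (_ : to_w _ = to_w (f p) - to_w (f p0)); last first.
  apply: wspace_ext => k; rewrite wspace_valB !to_wE ?mul1r//.
  by apply: wfunM; [exact: wfun_cst|exact: wfunB].
rewrite dualB distrC => h; apply: le_lt_trans (h _) _; first by move=> k; rewrite normr1.
by rewrite ltr_pdivrMr// mulr_natr mulr2n ltrDl.
Qed.

Let sum_mu_piece (mu : dual G) M p :
  \sum_(m < M) `|\val mu (to_w (piece m p))| <= `|mu|.
Proof.
rewrite -[leRHS]mul1r; apply: (@sum_norm_dual _ _ mu (fun m => to_w (piece m p))) => w w1.
apply: wspace_le => // k; rewrite wspace_val_sum.
apply: le_trans (ler_norm_sum _ _ _) _; apply: le_trans (sum_piece_le1 M p k).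
apply: ler_sum => m _; rewrite wspace_valZ to_wE//.
by rewrite normrM (ger0_norm (piece_ge0 m p k)) ler_piMl.
Qed.

(** The pieces converge weak-star as p grows, being differences of increasing sequences.
    As they are nonnegative with sum at most 1, the absolute values of mu on their limits
    have a sum bounded by the norm of mu. *)
Let exists_w : exists w : nat -> bidual G,
  (forall N mu, \sum_(m < N) `|\val (w m) mu| <= `|mu|) /\
  (forall m mu, (\val mu (to_w (piece m p)) : K^o) @[p --> \oo] --> (\val (w m) mu : K^o)).
Proof.
have lim_piece m (mu : dual G) :
    exists l : K^o, (\val mu (to_w (piece m p)) : K^o) @[p --> \oo] --> l.
  have [l1 h1] := mu_cvg mu (rest_wfun m) (rest01 m) (restS m).
  have [l2 h2] := mu_cvg mu (rest_wfun m.+1) (rest01 m.+1) (restS m.+1).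
  exists (l1 - l2).
  rewrite (_ : (fun p => _) = fun p => \val mu (to_w (rest m p)) - \val mu (to_w (rest m.+1 p))).
    exact: cvgB.
  apply/funext => p; rewrite -dualB; congr (\val mu _); apply: wspace_ext => k.
  by rewrite wspace_valB !to_wE// pieceE.
have /choice[f fP] m : exists fm : dual G -> K^o, forall mu,
    (\val mu (to_w (piece m p)) : K^o) @[p --> \oo] --> fm mu.
  by have [fm fmP] := choice (lim_piece m); exists fm.
have fl m : linear (f m).
  move=> a mu nu; apply: normed_lim_unique (fP m (a *: mu + nu)) _.
  rewrite (_ : (fun p => _) = fun p => a *: (\val mu (to_w (piece m p)) : K^o) +
    (\val nu (to_w (piece m p)) : K^o)).
    by apply: cvgD; [apply: cvgZr; exact: fP|exact: fP].
  by apply/funext => p; rewrite dual_valD dual_valZ.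
have f1 N mu : \sum_(m < N) `|f m mu| <= `|mu|.
  have : \sum_(m < N) (`|\val mu (to_w (piece m p))| : K^o) @[p --> \oo] -->
         \sum_(m < N) (`|f m mu| : K^o).
    by apply: cvg_sum => m; apply: cvg_norm; exact: fP.
  have s0 : 0 <= \sum_(m < N) `|f m mu| by exact: sumr_ge0.
  move=> /cvg_norm_le h; rewrite -[leLHS](ger0_norm s0); apply: h; apply: nearW => p.
  by rewrite ger0_norm ?sumr_ge0//; exact: sum_mu_piece.
have fd m : dual_set (f m).
  apply: (@dual_intro _ _ _ 1) => // mu; rewrite mul1r.
  by apply: le_trans (f1 m.+1 mu); rewrite big_ord_recr /= lerDr sumr_ge0.
exists (fun m => to_dual (f m)); split=> [N mu|m mu].
  by apply: le_trans (f1 N mu); apply: ler_sum => m _; rewrite to_dualE.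
by rewrite to_dualE//; exact: fP.
Qed.

(** Countable additivity: functionals do not charge the part far from all kk m. Each
    factor of rest M p is frozen at an index p_m beyond which it hardly changes for mu;
    the frozen products decrease pointwise to 0, hence uniformly. *)
Let rest_vanishes (mu : dual G) (d : K) : 0 < d -> exists M0, forall M, (M0 <= M)%N ->
  exists P, forall p h, (P <= p)%N -> wfun h -> (forall k, `|h k| <= 1) ->
    `|\val mu (to_w (fun k => h k * rest M p k))| <= d.
Proof.
move=> d0.
have d4 i : 0 < d / 4 * 2^-1 ^+ i by rewrite mulr_gt0 ?divr_gt0 ?exprn_gt0.
have incr m : exists p0, forall p h, (p0 <= p)%N -> wfun h -> (forall k, `|h k| <= 1) ->
    `|\val mu (to_w (fun k => h k * (close m p0 k - close m p k)))| <= d / 4 * 2^-1 ^+ m.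
  have sw p : wfun (fun k => 1 - close m p k) by apply: wfunB => //; exact: wfun_cst.
  have sS p k : 1 - close m p k <= 1 - close m p.+1 k by rewrite lerD2l lerN2 closeS.
  have [p0 hp0] := @increments_small _ _ _ mu _ sw (co_close01 m) sS (d4 m).
  exists p0 => p h pp0 hw h1.
  have -> : (fun k => h k * (close m p0 k - close m p k)) =
      (fun k => h k * (1 - close m p k - (1 - close m p0 k))).
    by apply/funext => k; congr (_ * _); ring.
  exact: hp0.
have [fr frP] := choice incr.
pose b M k : K^o := \prod_(m < M) (1 - close m (fr m) k).
have bw M : wfun (b M).
  by apply: wfun_prod => m; apply: wfunB; [exact: wfun_cst|exact: close_wfun].
have b01 M k : 0 <= b M k <= 1.
  apply/andP; split.
    by apply: prodr_ge0 => m _; have /andP[] := co_close01 m (fr m) k.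
  by apply: prodr_ile1 => m _; exact: co_close01.
have bS M k : b M.+1 k <= b M k.
  rewrite /b big_ord_recr /= ler_piMr//; first by have /andP[] := b01 M k.
  by have /andP[] := co_close01 M (fr M) k.
have bz k : exists M, b M k = 0.
  have [m km] := close_eventually k; exists m.+1.
  by rewrite /b big_ord_recr /= km subrr mulr0.
have mu1 : 0 < `|mu| + 1 by rewrite ltr_wpDl.
have dd : 0 < d / 2 / (`|mu| + 1) by rewrite !divr_gt0.
have [M0 bM0] := dini bw (fun M k => proj1 (andP (b01 M k))) bS bz dd.
exists M0 => M MM0; exists (\sum_(m < M) fr m)%N => p h pP hw h1.
have frozen N : (N <= M)%N -> forall g, wfun g -> (forall k, `|g k| <= 1) ->
    `|\val mu (to_w (fun k => g k * (rest N p k - b N k)))| <=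
      \sum_(m < N) d / 4 * 2^-1 ^+ m.
  elim: N => [_ g gw g1|N IHN NM g gw g1].
    rewrite big_ord0 (_ : to_w _ = 0) ?dual0 ?normr0//; apply: wspace_ext => k.
    rewrite to_wE; last by apply: wfunM => //; exact: wfunB.
    by rewrite /rest /b !big_ord0 subrr mulr0.
  have frp : (fr N <= p)%N.
    by apply: leq_trans pP; rewrite (bigD1 (Ordinal NM))//= leq_addr.
  pose g1' k : K^o := g k * (1 - close N p k).
  pose g2 k : K^o := g k * b N k.
  have g1w : wfun g1' by apply: wfunM => //; apply: wfunB => //; exact: wfun_cst.
  have g2w : wfun g2 by exact: wfunM.
  have g11 k : `|g1' k| <= 1.
    have /andP[c0 c1] := co_close01 N p k.
    by rewrite normrM (ger0_norm c0) mulr_ile1.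
  have g21 k : `|g2 k| <= 1.
    by have /andP[c0 c1] := b01 N k; rewrite normrM (ger0_norm c0) mulr_ile1.
  rewrite (_ : to_w _ = to_w (fun k => g1' k * (rest N p k - b N k)) +
      to_w (fun k => g2 k * (close N (fr N) k - close N p k))); last first.
    apply: wspace_ext => k; rewrite wspace_valD !to_wE; try by apply: wfunM => //; exact: wfunB.
    by rewrite restM /b big_ord_recr /= -/(b N k) /g1' /g2; ring.
  rewrite dualD big_ord_recr /= (le_trans (ler_normD _ _))// lerD//.
    exact: (IHN (ltnW NM)).
  exact: frP.
have hb : `|\val mu (to_w (fun k => h k * b M k))| <= d / 2.
  apply: le_trans (ler_dual _ _) _.
  have : `|to_w (fun k => h k * b M k)| <= d / 2 / (`|mu| + 1).
    apply: wspace_le => [|k]; first exact: ltW.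
    rewrite to_wE; last exact: wfunM.
    have /andP[c0 c1] := b01 M k; rewrite normrM (ger0_norm c0) -[leRHS]mul1r.
    by rewrite ler_pM// bM0.
  move=> /(ler_wpM2l (normr_ge0 mu)) /le_trans; apply.
  rewrite mulrA ler_pdivrMr// mulrC ler_wpM2l// ?lerDl//.
  by rewrite divr_ge0// ltW.
rewrite (_ : to_w _ = to_w (fun k => h k * (rest M p k - b M k)) +
    to_w (fun k => h k * b M k)); last first.
  apply: wspace_ext => k; rewrite wspace_valD !to_wE; try by apply: wfunM => //; exact: wfunB.
  by ring.
rewrite dualD [d]splitr (le_trans (ler_normD _ _))// lerD//.
apply: le_trans (frozen M (leqnn _) h hw h1) _.
rewrite -mulr_sumr (_ : d / 2 = d / 4 * 2); last by field.
by rewrite ler_wpM2l ?geometric_sum_le// divr_ge0// ltW.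
Qed.

(** On the support of piece m, the function x |-> ev x k differs from the constant
    \val (kk m) x by at most 2 * eps. Up to a multiple of rest M p, which vanishes in the
    limit, ev x is thus close to the sum of the pieces with these constants as
    coefficients. *)
Lemma factorization_data : exists (j : {linear X -> G}) (w : nat -> bidual G)
    (D : {linear X -> bidual G}),
  [/\ forall x, `|j x| = `|x|,
      forall N mu, \sum_(m < N) `|\val (w m) mu| <= `|mu|,
      forall x mu, \sum_(m < N) (\val (kk m) x * \val (w m) mu : K^o) @[N --> \oo]
        --> (\val mu (j x) - \val (D x) mu : K^o)
    & forall x, `|D x| <= 2 * eps * `|x|].
Proof.
have [j jE] : exists j : {linear X -> G}, forall x, j x = to_w (ev x).
  apply: exists_linear => a x y; apply: wspace_ext => k.
  rewrite wspace_valD wspace_valZ.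
  by rewrite !to_wE; [rewrite /ev dualD dualZ|exact: wfun_ev..].
have jv x k : \val (j x) k = ev x k by rewrite jE to_wE//; exact: wfun_ev.
have jle x : `|j x| <= `|x| by apply: wspace_le => // k; rewrite jv; exact: ev_le.
have jiso x : `|j x| = `|x|.
  apply/eqP; rewrite eq_le jle/=; have [phi phi1 phix] := norming_functional x.
  apply: le_trans phix _; pose k : dball X := exist _ phi phi1.
  by rewrite -[\val phi x]/(ev x k) -jv; exact: wspace_ge.
have [w [w1 wcvg]] := exists_w.
have [R [Rcvg Rle]] := wuc_operator (ler0n K 2) kk_le w1.
have jdual x : dual_set (fun mu : dual G => \val mu (j x) : K^o).
  apply: (@dual_intro _ _ _ `|x|) => [a mu nu|mu]; first by rewrite dual_valD dual_valZ.
  by rewrite mulrC; apply: le_trans (ler_dual _ _) _; rewrite jiso.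
have Dl : linear (fun x => to_dual (fun mu : dual G => \val mu (j x) : K^o) - R x : bidual G).
  move=> a x y; apply: dual_ext => mu.
  rewrite dual_valB op_dualP dual_valD dual_valZ !dual_valB.
  by rewrite !to_dualE// linearP dualD dualZ; ring.
have [D DE] := exists_linear Dl.
have Dv x mu : \val (D x) mu = \val mu (j x) - \val (R x) mu.
  by rewrite DE dual_valB to_dualE.
exists j, w, D; split=> // [x mu|x]; first by rewrite Dv subKr; exact: Rcvg.
apply: dual_le => [|mu]; first by rewrite !mulr_ge0// ltW.
rewrite mulrAC.
have psid : dual_set (fun y => \val (D y) mu : K^o).
  have [C C0 DC] : exists2 C, 0 <= C & forall y, `|D y| <= C * `|y|.
    exists (1 + 2) => [|y]; first exact: addr_ge0.
    rewrite DE mulrDl mul1r (le_trans (ler_normB _ _))// lerD//.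
    by apply: dual_le => // nu; rewrite to_dualE// mulrC (le_trans (ler_dual _ _))// jiso.
  apply: (@dual_intro _ _ _ (C * `|mu|)) => [a y z|y].
    exact: op_dualP.
  by rewrite mulrAC (le_trans (ler_dual _ _))// ler_wpM2r.
rewrite -[\val (D x) mu]/((fun y => \val (D y) mu : K^o) x) -(to_dualE psid).
apply: le_trans (ler_dual _ _) _; rewrite ler_wpM2r//.
apply: xx_norming => [|q]; first by rewrite !mulr_ge0// ltW.
rewrite to_dualE//; apply/ler_addgt0Pr => d d0.
have [M0 hM0] := rest_vanishes mu d0.
pose u M : K^o := \val mu (j (xx q)) - \sum_(m < M) \val (kk m) (xx q) * \val (w m) mu.
have ucvg : u @ \oo --> (\val (D (xx q)) mu : K^o).
  by rewrite Dv; apply: cvgB; [exact: cvg_cst|exact: Rcvg].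
apply: (@cvg_norm_le _ _ _ _ _ _ _ _ ucvg); exists M0 => // M /= MM0.
have [P hP] := hM0 M MM0.
pose v p : K^o := \val mu (j (xx q)) - \sum_(m < M) \val (kk m) (xx q) * \val mu (to_w (piece m p)).
have vcvg : v @ \oo --> u M.
  apply: cvgB; first exact: cvg_cst.
  by apply: cvg_sum => m; apply: cvgM; [exact: cvg_cst|exact: wcvg].
apply: (@cvg_norm_le _ _ _ _ _ _ _ _ vcvg); exists (maxn P q.+1) => // p /=.
rewrite geq_max => /andP[Pp qp].
pose z : G := \sum_(m < M) to_w (fun k => (ev (xx q) k - \val (kk m) (xx q)) * piece m p k).
have zw m : wfun (fun k => (ev (xx q) k - \val (kk m) (xx q)) * piece m p k).
  by apply: wfunM => //; apply: wfunB; [exact: wfun_ev|exact: wfun_cst].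
have rw : wfun (fun k => ev (xx q) k * rest M p k) by apply: wfunM => //; exact: wfun_ev.
have -> : v p = \val mu z + \val mu (to_w (fun k => ev (xx q) k * rest M p k)).
  rewrite /v -dualD; apply/eqP; rewrite subr_eq; apply/eqP.
  rewrite (eq_bigr (fun m : 'I_M => \val mu (\val (kk m) (xx q) *: to_w (piece m p)))); last first.
    by move=> m _; rewrite dualZ.
  rewrite -dual_sum -dualD; congr (\val mu _); apply: wspace_ext => k.
  rewrite !wspace_valD !wspace_val_sum jv (to_wE rw) addrAC -big_split /=.
  rewrite (eq_bigr (fun m : 'I_M => ev (xx q) k * piece m p k)); last first.
    move=> m _; rewrite (to_wE (zw m)).
    rewrite -[X in _ + X]/(\val (kk m) (xx q) * \val (to_w (piece m p)) k) to_wE//.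
    by ring.
  by rewrite -mulr_sumr sum_piece; ring.
rewrite (le_trans (ler_normD _ _))// lerD//; last first.
  apply: hP => //; first exact: wfun_ev.
  by move=> k; apply: le_trans (ev_le _ _) _; exact: xx_le.
rewrite (le_trans (ler_dual _ _))// mulrC ler_wpM2r//.
apply: wspace_le => [|k]; first by rewrite !mulr_ge0// ltW.
rewrite wspace_val_sum (le_trans (ler_norm_sum _ _ _))//.
apply: (@le_trans _ _ (\sum_(m < M) 2 * eps * piece m p k)).
  apply: ler_sum => m _; rewrite (to_wE (zw m)) normrM (ger0_norm (piece_ge0 m p k)).
  rewrite mulrC /piece -(mulrA (rest m p k)) (mulrCA (2 * eps)); apply: ler_wpM2l.
    by have /andP[] := rest01 m p k.
  exact: close_dev.
by rewrite -mulr_sumr ler_piMr ?sum_piece_le1// mulr_ge0// ltW.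
Qed.

End Factorization.

Definition separable (K : numFieldType) (X : normedModType K) :=
  exists phi : nat -> X, closure (range phi) = setT.

Section SeparableDual.
Variables (K : scalarField) (X : normedModType K).

Lemma almost_norming (phi : dual X) (d : K) : 0 < d ->
  exists x, `|x| <= 1 /\ `|phi| - d <= `|\val phi x|.
Proof.
move=> d0; apply: contrapT => /forallNP h.
have small x : `|x| <= 1 -> `|\val phi x| < `|phi| - d.
  move=> x1; rewrite real_ltNge// ?realB ?(gtr0_real d0)//.
  by apply/negP => hx; apply: (h x).
have pd : 0 <= `|phi| - d.
  have := small 0; rewrite normr0 ler01 => /(_ isT).
  by move=> /(le_lt_trans (normr_ge0 _))/ltW.
have : `|phi| <= `|phi| - d.
  rewrite [leLHS]bs_normE; apply: ksup_le => // _ [x x1 <-].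
  by rewrite normr_ge0 ltW//= small.
by rewrite lerBrDr gerDl => /(lt_le_trans d0); rewrite ltxx.
Qed.

Lemma norming_sequence : separable (dual X) -> exists xx : nat -> X,
  (forall q, `|xx q| <= 1) /\ forall (phi : dual X) C, 0 <= C ->
    (forall q, `|\val phi (xx q)| <= C) -> `|phi| <= C.
Proof.
move=> [ph phd].
have d0 (r : nat) : 0 < 2^-1 ^+ r :> K by rewrite exprn_gt0.
have /choice[z zP] (ir : nat * nat) : exists x, `|x| <= 1 /\
    `|ph ir.1| - 2^-1 ^+ ir.2 <= `|\val (ph ir.1) x| by exact: almost_norming.
pose xx q := if @unpickle (nat * nat)%type q is Some ir then z ir else 0.
exists xx; split=> [q|phi C C0 hC].
  by rewrite /xx; case: unpickle => [ir|]; [case: (zP ir)|rewrite normr0].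
apply/ler_addgt0Pr => d dp; have d3 : 0 < d / 3 by rewrite divr_gt0.
have : closure (range ph) phi by rewrite phd.
move=> /closure_normP/(_ _ d3)[_ [i _ <-] /ltW phi_i].
have [r] := scalar_geom (@ler01 K) d3; rewrite mul1r => rd.
have [z1 zi] := zP (i, r).
have zC : `|\val phi (z (i, r))| <= C.
  by have := hC (pickle (i, r)); rewrite /xx pickleK.
have h1 : `|phi| <= `|ph i| + d / 3.
  by rewrite -[phi in leLHS](subrK (ph i)) (le_trans (ler_normD _ _))// addrC lerD2l.
have h2 : `|ph i| <= `|\val (ph i) (z (i, r))| + d / 3.
  by rewrite -lerBlDr; apply: le_trans zi; rewrite lerD2l lerN2.
have h3 : `|\val (ph i) (z (i, r))| <= C + d / 3.
  rewrite (_ : \val (ph i) _ = \val phi (z (i, r)) - \val (phi - ph i) (z (i, r))).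
    rewrite (le_trans (ler_normB _ _))// lerD//.
    apply: le_trans (ler_dual _ _) _; apply: le_trans phi_i.
    by rewrite ler_piMr.
  by rewrite dual_valB subKr.
apply: le_trans h1 _; rewrite (_ : C + d = C + d / 3 + d / 3 + d / 3); last by field.
by rewrite lerD2r (le_trans h2)// lerD2r.
Qed.

End SeparableDual.

Section NullSequences.
Variable K : scalarField.

Lemma c0_le (a : c0 K nat) M : 0 <= M -> (forall i, `|\val a i| <= M) -> `|a| <= M.
Proof.
move=> M0 aM; rewrite bs_normE; apply: ksup_le => // _ [i _ <-].
by rewrite normr_ge0 aM.
Qed.

Lemma c0_ge (a : c0 K nat) i : `|\val a i| <= `|a|.
Proof.
have [M aM] := c0_bounded (bs_valP a).
rewrite bs_normE; apply: (@ksup_ge _ _ M); last by exists i.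
by move=> _ [j _ <-]; rewrite normr_ge0 aM.
Qed.

Definition unit_fun (m : nat) : nat -> K^o := fun i => (i == m)%:R.

Lemma unit_fun_c0 m : c0_set (unit_fun m).
Proof.
move=> e e0; apply: (@sub_finite_set _ _ [set m]); last exact: finite_set1.
move=> i /=; rewrite /unit_fun; have [//|_] := eqVneq i m.
by rewrite normr0 => /(lt_le_trans e0); rewrite ltxx.
Qed.

Definition c0_unit m : c0 K nat := to_bs (BanachSub (@c0_complete K nat)) (unit_fun m).

Lemma c0_unitE m i : \val (c0_unit m) i = (i == m)%:R.
Proof. by rewrite to_bsE//; exact: unit_fun_c0. Qed.

(** Coordinates and unit vectors of c0; the last condition says that the unit vectors
    are weakly unconditionally summable. *)
Definition c0_like (Z : normedModType K) := exists (u : nat -> Z) (gam : nat -> dual Z),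
  [/\ forall m, `|gam m| <= 1, forall l m, \val (gam l) (u m) = (l == m)%:R
    & forall N (psi : dual Z), \sum_(m < N) `|\val psi (u m)| <= `|psi|].

Lemma c0_is_c0_like : c0_like (c0 K nat).
Proof.
pose g (m : nat) (a : c0 K nat) : K^o := \val a m.
have g1 m a : `|g m a| <= 1 * `|a| by rewrite mul1r c0_ge.
have gd m : dual_set (g m).
  apply: dual_intro (g1 m) => a x y; rewrite /g bs_valD bs_valZ.
  by [].
exists c0_unit, (fun m => to_dual (g m)); split=> [m|l m|N psi].
- by apply: dual_le => // a; rewrite to_dualE//; exact: g1.
- by rewrite to_dualE// /g c0_unitE.
- rewrite -[leRHS]mul1r; apply: sum_norm_dual => w w1.
  apply: c0_le => // i; rewrite bs_val_sum fct_sumE.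
  rewrite (eq_bigr (fun m : 'I_N => w m * (i == m)%:R)); last first.
    by move=> m _; rewrite bs_valZ -[LHS]/(w m * \val (c0_unit m) i) c0_unitE.
  have [iN|Ni] := ltnP i N.
    rewrite (bigD1 (Ordinal iN))//= eqxx mulr1 big1 ?addr0// => m mi.
    by rewrite (_ : (i == m) = false) ?mulr0//; apply/negbTE; rewrite eq_sym.
  rewrite big1 ?normr0// => m _; rewrite (_ : (i == m) = false) ?mulr0//.
  by apply/negbTE; rewrite gtn_eqF// (leq_trans (ltn_ord m)).
Qed.

(** The canonical map of X into the bidual of a superspace G is, up to the small
    operator D, the composition of V : X -> Z'' with the extension of W : Z -> G'' to the
    bidual of Z, because both are determined by the values kk m x and w m. *)
Lemma c0_factorization (X Z : normedModType K) (eps : K) :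
  separable (dual X) -> c0_like Z -> 0 < eps -> eps <= 1 ->
  exists (G : completeNormedModType K) (j : {linear X -> G}) (W : {linear Z -> bidual G})
    (V : {linear X -> bidual Z}) (D : {linear X -> bidual G}),
  [/\ forall x, `|j x| = `|x|,
      [/\ forall a, `|W a| <= 1 * `|a|, forall x, `|V x| <= 2 * `|x|
        & forall x, `|D x| <= 2 * eps * `|x|]
    & forall x mu, \val mu (j x) - \val (D x) mu =
        \val (V x) (to_dual (fun a => \val (W a) mu : K^o))].
Proof.
move=> sX [u [gam [gam1 gamu usum]]] e0 e1.
have [ph phd] := sX; have [xx [xx1 xxn]] := norming_sequence sX.
pose kk m : dual X := if `|ph m| <= 2 then ph m else 0.
have kk2 m : `|kk m| <= 2 by rewrite /kk; case: ifP => // _; rewrite normr0.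
have kkd (k : dball X) : exists m, `|sval k - kk m| <= eps.
  have : closure (range ph) (sval k) by rewrite phd.
  move=> /closure_normP/(_ _ e0)[_ [m _ <-] /ltW km]; exists m.
  rewrite /kk ifT//; rewrite -[ph m](subKr (sval k)) (le_trans (ler_normB _ _))//.
  by rewrite (_ : 2 = 1 + 1)// lerD// ?(le_trans km)//; case: (k).
have [j [w [D [jiso w1 Dcvg Dle]]]] := factorization_data e0 kk2 kkd xx1 xxn.
have [W [Wcvg Wle]] := wuc_operator ler01 gam1 w1.
pose uh m (psi : dual Z) : K^o := \val psi (u m).
have uhd m : dual_set (uh m).
  apply: (@dual_intro _ _ _ `|u m|) => [a x y|psi]; last by rewrite mulrC ler_dual.
  by rewrite /uh dual_valD dual_valZ.
have uh1 N psi : \sum_(m < N) `|\val (to_dual (uh m)) psi| <= `|psi|.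
  by under eq_bigr do rewrite to_dualE//; exact: usum.
have [V [Vcvg Vle]] := @wuc_operator _ _ _ kk (fun m => to_dual (uh m)) _ (ler0n K 2) kk2 uh1.
have Wu m mu : \val (W (u m)) mu = \val (w m) mu.
  apply: normed_lim_unique (Wcvg (u m) mu) _; apply/cvgrPdist_lt => d d0.
  exists m.+1 => // N /= mN; rewrite (bigD1 (Ordinal mN))//= gamu eqxx mul1r.
  rewrite big1 ?addr0 ?subrr ?normr0// => i im; rewrite gamu.
  by rewrite (_ : (i == m :> nat) = false) ?mul0r//; exact/negbTE.
exists (wspace X), j, W, V, D; split=> // x mu.
have mud : dual_set (fun a => \val (W a) mu : K^o).
  apply: (@dual_intro _ _ _ `|mu|) => [a y z|y]; first exact: op_dualP.
  apply: le_trans (ler_dual _ _) _; rewrite mulrC ler_wpM2l//.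
  by have := Wle y; rewrite mul1r.
apply: normed_lim_unique (Dcvg x mu) _.
have := Vcvg x (to_dual (fun a => \val (W a) mu : K^o)).
rewrite (_ : (fun N => _) = (fun N => \sum_(m < N) \val (kk m) x * \val (w m) mu))//.
apply/funext => N; apply: eq_bigr => m _.
by rewrite to_dualE// /uh to_dualE// Wu.
Qed.

End NullSequences.

(** * Operators of an ideal *)

Section IdealOperators.
Variables (K : scalarField) (n : nat) (A : ideal K n).
Implicit Types (E X Y : 'I_n -> completeNormedModType K).
Implicit Types (F G : completeNormedModType K).

Lemma ideal_compose E X F G (R : forall i, {linear X i -> E i}) (S : {linear F -> G})
    (T : A E F) (cS : K) (cR : 'I_n -> K) :
  0 <= cS -> (forall y, `|S y| <= cS * `|y|) ->
  (forall i, 0 <= cR i) -> (forall i x, `|R i x| <= cR i * `|x|) ->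
  exists2 U : A X G, forall x, \val U x = S (\val T (fun i => R i (x i)))
    & `|U| <= cS * `|T| * \prod_i cR i.
Proof.
move=> cS0 Sc cR0 Rc.
have Rcont i : continuous (R i) by exact: bounded_cont (Rc i).
have Scont : continuous S by exact: bounded_cont Sc.
have [UA Ule] := ideal_comp Rcont Scont (bs_valP T).
exists (to_bs (ideal_sub A X G) (fun x => S (\val T (fun i => R i (x i))))) => [x|].
  by rewrite to_bsE.
rewrite bs_normE to_bsE//; apply: le_trans Ule _.
apply: ler_pM.
- by rewrite mulr_ge0 ?(opnorm_ge0 Scont)// -bs_normE.
- by apply: prodr_ge0 => i _; exact: opnorm_ge0 (Rcont i).
- by rewrite -bs_normE ler_wpM2r// opnorm_le.
- apply: ler_prod => i _; rewrite (opnorm_ge0 (Rcont i)) /=.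
  exact: opnorm_le (cR0 i) (Rc i).
Qed.

Lemma elementary_in_ideal E F (phi : forall i, dual (E i)) (y : F) :
  exists2 U : A E F, \val U = elementary_op (fun i => \val (phi i)) y
    & `|U| <= (\prod_i `|phi i|) * `|y|.
Proof.
have [PA P1] := ideal_prod A.
pose P : A (fun=> scalar_space K) (scalar_space K) :=
  to_bs (ideal_sub A (fun=> scalar_space K) (scalar_space K)) (fun x => \prod_i (x i : K)).
have [S SE] : exists S : {linear scalar_space K -> F},
    forall a : scalar_space K, S a = (a : K) *: y.
  by apply: exists_linear => a b c; have := scalerDl y (a * b : K) c; rewrite -scalerA.
have Sle a : `|S a| <= `|y| * `|a| by rewrite SE normrZ mulrC.
have exR i : exists R : {linear E i -> scalar_space K}, forall x, R x = \val (phi i) x.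
  by apply: exists_linear => a b c; rewrite dualD dualZ.
pose R i := sval (cid (exR i)).
have RE i x : R i x = \val (phi i) x := svalP (cid (exR i)) x.
have Rle i x : `|R i x| <= `|phi i| * `|x| by rewrite RE; exact: ler_dual.
have [U UE Ule] := ideal_compose P (normr_ge0 y) Sle (fun i => normr_ge0 (phi i)) Rle.
exists U.
  apply/funext => x; rewrite UE SE /P to_bsE//; congr (_ *: _).
  by apply: eq_bigr => i _; rewrite RE.
apply: le_trans Ule _; rewrite [`|P|](_ : _ = 1) ?mulr1 1?mulrC//.
by rewrite bs_normE to_bsE.
Qed.

Lemma ideal_ext E F (S T : A E F) : (forall x, \val S x = \val T x) -> S = T.
Proof. by move=> ST; apply: bs_ext; apply/funext. Qed.

Lemma ideal_slot E F (T : A E F) (k : 'I_n) (x : forall i, E i) (y' : dual F) :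
  dual_set (fun z : E k => \val y' (\val T (dfwith x k z)) : K^o).
Proof.
have [Tm Tc] := ideal_mult (bs_valP T); split=> [a u v|].
  by rewrite Tm dualD dualZ.
move=> z; apply: continuous_comp; last exact: dual_cont.
apply: (@continuous_comp _ (prod_topology E) _ (dfwith x k) (\val T)); last exact: Tc.
exact: dfwith_continuous.
Qed.

(** Composition of T with the operators r i outside the k-th variable and, after the
    Arens extension of T in the k-th variable, with an operator into the bidual. *)
Lemma arens_pull E X F (k : 'I_n) (r : forall i, {linear X i -> E i})
    (R : {linear X k -> bidual (E k)}) (C : K) (T : A E F) :
  arens_stable A F -> (forall i x, `|r i x| <= 1 * `|x|) ->
  0 <= C -> (forall x, `|R x| <= C * `|x|) ->
  exists2 U : A X F, forall x (y' : dual F), \val y' (\val U x) =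
      \val (R (x k)) (to_dual (fun z => \val y' (\val T (dfwith (fun i => r i (x i)) k z)) : K^o))
    & `|U| <= C * `|T|.
Proof.
move=> As r1 C0 RC; have [V VE VT] := As k E T.
pose B : completeNormedModType K := bidual (E k).
pose Rf : forall i, {linear X i -> B} := dfwith (fun i => \0 : {linear X i -> B}) k R.
pose lift i : {linear X i -> fam_with E k B i} :=
  match i == k as b return {linear X i -> (if b then B else E i : completeNormedModType K)} with
  | true => Rf i | false => r i end.
pose c i : K := if i == k then C else 1.
have c0 i : 0 <= c i by rewrite /c; case: ifP.
have liftle i x : `|lift i x| <= c i * `|x|.
  rewrite /lift /c /fam_with; case: (i == k) (@eqP _ i k) => [ik|_]; last exact: r1.
  move: x; rewrite -/B; have {ik} -> : i = k := elimT ik isT.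
  by move=> x; rewrite /Rf dfwithin; exact: RC.
have idle (y : F) : `|idfun y| <= 1 * `|y| by rewrite mul1r.
have [U UE Ule] := ideal_compose V ler01 idle c0 liftle.
exists U => [x y'|].
  rewrite UE /=.
  rewrite (_ : (fun i => lift i (x i)) = pt_with k (fun i => r i (x i)) (R (x k))).
    by rewrite VE.
  apply: functional_extensionality_dep => i.
  rewrite /lift /pt_with /fam_with; case: (i == k) (@eqP _ i k) => // ik.
  have {ik} -> : i = k := elimT ik isT.
  by rewrite /Rf dfwithin.
apply: le_trans Ule _; rewrite mul1r VT mulrC (bigD1 k)//= {1}/c eqxx big1 ?mulr1//.
by move=> i ik; rewrite /c (negbTE ik).
Qed.

Definition cast_op (V W : completeNormedModType K) (e : V = W) : {linear V -> W} :=
  match e in _ = W return {linear V -> W} with erefl => idfun end.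

Lemma cast_op_comp (U V W : completeNormedModType K) (e1 : U = V) (e2 : V = W) (e3 : U = W) x :
  cast_op e2 (cast_op e1 x) = cast_op e3 x.
Proof. by move: e3; case: _ / e2; case: _ / e1 => e3; rewrite (Prop_irrelevance e3 erefl). Qed.

(** The identity between families that agree outside one index; 0 where they differ. *)
Definition fam_id X E (i : 'I_n) : {linear X i -> E i} :=
  match pselect (X i = E i) with left e => cast_op e | right _ => \0 end.

Lemma fam_id_isometric X E i : X i = E i -> isometric (fam_id X E i).
Proof.
move=> e x; rewrite /fam_id; case: pselect => // e'.
by case: _ / e'.
Qed.

Lemma fam_id_le X E i x : `|fam_id X E i x| <= 1 * `|x|.
Proof.
rewrite mul1r; have [e|ne] := pselect (X i = E i); first by rewrite fam_id_isometric.
by rewrite /fam_id; case: pselect => // _ /=; rewrite normr0.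
Qed.

Lemma fam_id_comp X E Y i x : X i = E i -> E i = Y i ->
  fam_id E Y i (fam_id X E i x) = fam_id X Y i x.
Proof.
move=> e1 e2; rewrite /fam_id; case: pselect => // h1; case: pselect => // h2.
case: pselect => [h3|[]]; first exact: cast_op_comp.
by rewrite e1.
Qed.

Definition finite_type E F : set (mult_op E F) :=
  [set T | exists s : seq ((forall i, dual (E i)) * F),
     T = \sum_(p <- s) elementary_op (fun i => \val (p.1 i)) p.2].

Lemma dfwith_elementary E F (phi : forall i, E i -> K) (y : F) (k : 'I_n)
    (x : forall i, E i) (z : E k) :
  elementary_op phi y (dfwith x k z) = (phi k z * \prod_(i | i != k) phi i (x i)) *: y.
Proof.
rewrite /elementary_op (bigD1 k)//= dfwithin; congr ((_ * _) *: _).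
by apply: eq_bigr => i ik; rewrite dfwithout// eq_sym.
Qed.

(** An Arens extension followed by R turns the k-th factor phi of an elementary operator
    into the functional x |-> R x phi. *)
Lemma finite_type_pull E X F (k : 'I_n) (r : forall i, {linear X i -> E i})
    (R : {linear X k -> bidual (E k)}) (C : K) (T : A E F) (U : A X F) :
  (forall i x, `|r i x| <= 1 * `|x|) -> (forall x, `|R x| <= C * `|x|) ->
  (forall x (y' : dual F), \val y' (\val U x) =
    \val (R (x k)) (to_dual (fun z => \val y' (\val T (dfwith (fun i => r i (x i)) k z)) : K^o))) ->
  finite_type (\val T) -> finite_type (\val U).
Proof.
move=> r1 RC UE [s TE].
pose psi (phi : forall i, dual (E i)) : forall i, dual (X i) :=
  dfwith (fun i => to_dual (fun x => \val (phi i) (r i x) : K^o)) k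
    (to_dual (fun x => \val (R x) (phi k) : K^o)).
have rd (phi : forall i, dual (E i)) i : dual_set (fun x => \val (phi i) (r i x) : K^o).
  apply: (@dual_intro _ _ _ `|phi i|) => [a u v|x]; first by rewrite linearP dualD dualZ.
  by apply: le_trans (ler_dual _ _) _; rewrite ler_wpM2l//; have := r1 i x; rewrite mul1r.
have Rd (phi : dual (E k)) : dual_set (fun x => \val (R x) phi : K^o).
  apply: (@dual_intro _ _ _ (C * `|phi|)) => [a u v|x]; first exact: op_dualP.
  by apply: le_trans (ler_dual _ _) _; rewrite mulrAC ler_wpM2r.
exists [seq (psi p.1, p.2) | p <- s]; rewrite big_map /=.
apply/funext => x; apply: dual_separates => y'; rewrite UE.
pose c (p : (forall i, dual (E i)) * F) : K :=
  \val y' p.2 * \prod_(i | i != k) \val (p.1 i) (r i (x i)).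
rewrite (_ : to_dual _ = \sum_(p <- s) c p *: p.1 k); last first.
  apply: dual_ext => z; rewrite to_dualE; last exact: ideal_slot.
  rewrite TE fct_sumE dual_sum dual_val_sum; apply: eq_bigr => p _.
  by rewrite dfwith_elementary dualZ dual_valZ /c [LHS]mulrC (mulrC (\val (p.1 k) z)) mulrA.
rewrite dual_sum fct_sumE dual_sum; apply: eq_bigr => p _.
rewrite dualZ /elementary_op dualZ (bigD1 k)//= /psi dfwithin to_dualE//.
rewrite (eq_bigr (fun i => \val (p.1 i) (r i (x i)))); last first.
  by move=> i ik; rewrite dfwithout 1?eq_sym// to_dualE.
rewrite /c [RHS]mulrC -mulrA; congr (_ * _). exact: mulrC.
Qed.

Definition approximable E F := forall (T : A E F) (e : K), 0 < e ->
  exists2 S : A E F, finite_type (\val S) & `|T - S| <= e.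

(** If finite type operators are dense after the k-th space is replaced by a space like
    c0, they are dense before. An extension of T to the space G of a factorization is
    restricted to c0, approximated there, and Arens extension brings it back. *)
Lemma approximable_step E X F (k : 'I_n) : extendible A -> arens_stable A F ->
  (forall i, i != k -> X i = E i) -> c0_like (X k) -> separable (dual (E k)) ->
  approximable X F -> approximable E F.
Proof.
move=> Aext As XE Xk Ek Xapp T e e0.
have T1 : 0 < `|T| + 1 by rewrite ltr_wpDl.
pose eps := e / (e + 4 * (`|T| + 1)).
have den : 0 < e + 4 * (`|T| + 1) by rewrite addr_gt0// mulr_gt0.
have eps0 : 0 < eps by rewrite divr_gt0.
have eps1 : eps <= 1.
  by rewrite /eps ler_pdivrMr// mul1r lerDl mulr_ge0// ltW.
have epsT : 2 * eps * `|T| <= e / 2.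
  rewrite /eps ler_pdivlMr// (_ : _ * 2 = (e * (4 * `|T|)) / (e + 4 * (`|T| + 1))).
    rewrite ler_pdivrMr// ler_wpM2l ?(ltW e0)//.
    by rewrite mulrDr addrA addrC addrA lerDr addr_ge0// ltW// mulr_gt0.
  by field; rewrite gt_eqF.
have [G0] := c0_factorization Ek Xk eps0 eps1.
pose Y := fam_with E k G0.
have Yk : Y k = G0 by rewrite /Y /fam_with eqxx.
have YE i : i != k -> Y i = E i by move=> ik; rewrite /Y /fam_with (negbTE ik).
rewrite -Yk => -[j [W [V [D [jiso [Wle Vle Dle] VW]]]]].
pose jf : forall i, {linear E i -> Y i} := dfwith (fam_id E Y) k j.
have jfiso i : isometric (jf i).
  rewrite /jf; have [->|ik] := eqVneq i k; first by rewrite dfwithin.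
  by rewrite dfwithout 1?eq_sym//; apply: fam_id_isometric; rewrite YE.
have [T' T'E T'n] := Aext _ _ _ jf jfiso T.
have [U0 U0E U0n] := @arens_pull Y X F k (fam_id X Y) W 1 T' As
  (fun i x => @fam_id_le X Y i x) ler01 Wle.
have d8 : 0 < e / 4 by rewrite divr_gt0.
have [S0 S0ft S0n] := Xapp U0 _ d8.
have [U1 U1E U1n] := @arens_pull X E F k (fam_id E X) V 2 U0 As
  (fun i x => @fam_id_le E X i x) (ler0n _ _) Vle.
have [S1 S1E S1n] := @arens_pull X E F k (fam_id E X) V 2 S0 As
  (fun i x => @fam_id_le E X i x) (ler0n _ _) Vle.
have [R1 R1E R1n] := @arens_pull X E F k (fam_id E X) V 2 (U0 - S0) As
  (fun i x => @fam_id_le E X i x) (ler0n _ _) Vle.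
have eps2 : 0 <= 2 * eps by rewrite mulr_ge0// ltW.
have [U2 U2E U2n] := @arens_pull Y E F k (fam_id E Y) D (2 * eps) T' As
  (fun i x => @fam_id_le E Y i x) eps2 Dle.
have TU : T - U1 = U2.
  apply: ideal_ext => x; apply: dual_separates => y'.
  rewrite bs_valB dualB U1E U2E.
  set mu := to_dual (fun z : Y k => _).
  have muE z : \val mu z = \val y' (\val T' (dfwith (fun i => fam_id E Y i (x i)) k z)).
    by rewrite to_dualE//; exact: ideal_slot.
  have -> : \val y' (\val T x) = \val mu (j (x k)).
    rewrite muE -T'E; congr (\val y' (\val T' _)).
    apply: functional_extensionality_dep => i; rewrite /jf.
    have [->|ik] := eqVneq i k; first by rewrite !dfwithin.
    by rewrite !dfwithout// eq_sym.
  apply/eqP; rewrite subr_eq [X in _ == X]addrC -subr_eq VW; apply/eqP.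
  congr (\val _ _); congr to_dual; apply/funext => a.
  rewrite U0E dfwithin; congr (\val _ _); apply: dual_ext => z.
  rewrite muE to_dualE; last exact: ideal_slot.
  congr (\val y' (\val T' _)); apply: functional_extensionality_dep => i.
  have [->|ik] := eqVneq i k; first by rewrite !dfwithin.
  rewrite !dfwithout 1?eq_sym//; apply/esym/fam_id_comp; first by rewrite XE.
  by rewrite XE// YE.
have US : U1 - S1 = R1.
  apply: ideal_ext => x; apply: dual_separates => y'.
  rewrite bs_valB dualB U1E S1E R1E -dualB; congr (\val _ _); apply: dual_ext => z.
  rewrite dual_valB !to_dualE; try exact: ideal_slot.
  by rewrite bs_valB dualB.
exists S1; first exact: finite_type_pull (fun i x => @fam_id_le E X i x) Vle S1E S0ft.
rewrite -(subrKA U1) (le_trans (ler_normD _ _))// TU US [e in leRHS]splitr lerD//.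
  by apply: le_trans U2n _; rewrite T'n.
apply: le_trans R1n _; apply: (@le_trans _ _ (2 * (e / 4))); first by rewrite ler_wpM2l.
by rewrite le_eqVlt; apply/orP; left; apply/eqP; field.
Qed.

End IdealOperators.

(** * Density of finite type operators *)

Section Density.
Variables (K : scalarField) (n : nat) (A : ideal K n).
Implicit Types (E X Y : 'I_n -> completeNormedModType K).
Implicit Types (F G : completeNormedModType K).

Lemma finite_type0 E F : finite_type (0 : mult_op E F).
Proof. by exists [::]; rewrite big_nil. Qed.

Lemma finite_typeD E F (S T : mult_op E F) :
  finite_type S -> finite_type T -> finite_type (S + T).
Proof. by move=> [s ->] [t ->]; exists (s ++ t); rewrite big_cat. Qed.

Lemma finite_typeZ E F a (T : mult_op E F) : finite_type T -> finite_type (a *: T).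
Proof.
move=> [s ->]; exists [seq (p.1, a *: p.2) | p <- s]; rewrite big_map scaler_sumr.
apply: eq_bigr => p _; apply/funext => x.
by rewrite -[LHS]/(a *: ((\prod_i _) *: p.2)) /elementary_op !scalerA mulrC.
Qed.

Lemma finite_type_sum E F (I : Type) (s : seq I) (T : I -> mult_op E F) :
  (forall i, finite_type (T i)) -> finite_type (\sum_(i <- s) T i).
Proof.
move=> fT; elim: s => [|i s IHs]; first by rewrite big_nil; exact: finite_type0.
by rewrite big_cons; exact: finite_typeD.
Qed.

(** The factors of a nonzero elementary operator of the ideal are proportional to its
    partial functions, hence continuous functionals; for the pairing of l1 with c0, this
    spares the manipulation of infinite sums. *)
Lemma elementary_finite_type E F (T : A E F) (phi : forall i, E i -> K) (g : F) :
  \val T = elementary_op phi g -> finite_type (\val T).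
Proof.
move=> TE; have [[x Tx]|T0] := pselect (exists x, \val T x != 0); last first.
  rewrite (_ : \val T = 0); first exact: finite_type0.
  apply/funext => x; apply/eqP; apply/negPn/negP => Tx; apply: T0; by exists x.
have [px g0] : \prod_i phi i (x i) != 0 /\ g != 0.
  by move: Tx; rewrite TE scaler_eq0 negb_or => /andP[].
have [y' _ y'g] := norming_functional g.
have y'0 : \val y' g != 0 by rewrite -normr_gt0 (lt_le_trans _ y'g)// normr_gt0.
have phid k : dual_set (phi k : E k -> K^o).
  pose c := (\prod_(i | i != k) phi i (x i)) * \val y' g.
  have c0 : c != 0.
    by rewrite mulf_neq0//; move: px; rewrite (bigD1 k)//= mulf_eq0 negb_or => /andP[].
  have sl := ideal_slot T k x y'.
  have -> : phi k = fun z =>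
      \val (c^-1 *: to_dual (fun z => \val y' (\val T (dfwith x k z)) : K^o)) z.
    apply/funext => z; rewrite dual_valZ to_dualE// TE dfwith_elementary dualZ.
    by rewrite -mulrA -/c mulrC mulfK.
  exact: dualP.
exists [:: (fun i => to_dual (phi i : E i -> K^o), g)]; rewrite big_seq1 TE /=.
by apply/funext => z; rewrite /elementary_op; under [in RHS]eq_bigr do rewrite to_dualE//.
Qed.

Lemma denseP (X : normedModType K) (S : set X) x (d : K) : dense S -> 0 < d ->
  exists2 y, S y & `|x - y| < d.
Proof.
move=> dS d0; have [|//|y [xy Sy]] := dS (ball x d); first by exists x; exact: ballxx.
  exact: ball_open.
by exists y => //; rewrite -ball_normE in xy.
Qed.

(** The Radon-Nikodym property, for countable index sets: elementary tensors have dense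
    span in the completed tensor product, which is mapped onto the ideal. *)
Lemma approximable_c0 F : radon_nikodym A F -> approximable A (fun=> c0 K nat) F.
Proof.
move=> [alpha _ /(_ (fun=> nat))[X [iota [Phi [[iso dn] Phic Phip [Phis _]]]]]] T e e0.
have [C C0 PhiC] := cont_bounded Phic.
have [u uT] := Phis T.
have d0 : 0 < e / (C + 1) by rewrite divr_gt0// ltr_wpDl.
have [_ [z _ <-] uz] := denseP u dn d0.
exists (Phi (iota z)); last first.
  rewrite -uT -linearB; apply: le_trans (PhiC _) _.
  apply: (@le_trans _ _ ((C + 1) * (e / (C + 1)))); last first.
    by rewrite mulrC divfK// gt_eqF// ltr_wpDl.
  by rewrite ler_pM// ?lerDl// ltW.
have [s zs] := set_mem (valP z).
pose Ef : option 'I_n -> normedModType K := fam_rcons (fun=> l1 K nat) F.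
have pt (x : forall o, Ef o) : tensors Ef (pure_tensor x).
  by exists [:: (1, x)]; rewrite big_seq1 scale1r.
pose pz (x : forall o, Ef o) : tensor_space alpha Ef :=
  @NsType _ _ (NormedSub (tensors_closed Ef) (tn_normP alpha Ef)) _ (mem_set (pt x)).
have -> : z = \sum_(p <- s) p.1 *: pz p.2.
  apply: val_inj; rewrite zs linear_sum; apply: eq_bigr => p _.
  by rewrite linearZ.
have -> : Phi (iota (\sum_(p <- s) p.1 *: pz p.2)) =
    \sum_(p <- s) p.1 *: Phi (iota (pz p.2)) :> A (fun=> c0 K nat) F.
  by rewrite !linear_sum; apply: eq_bigr => p _; rewrite !linearZ.
rewrite bs_val_sum; apply: finite_type_sum => p; rewrite bs_valZ; apply: finite_typeZ.
apply: (@elementary_finite_type _ F _ (fun i => l1_pairing (p.2 (Some i))) (p.2 None)).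
apply: Phip => /=; congr pure_tensor.
by apply: functional_extensionality_dep => -[i|].
Qed.

(** The vector-valued Lewis theorem: c0 is replaced by the spaces E i one at a time. *)
Lemma approximable_separable E F : extendible A -> arens_stable A F ->
  radon_nikodym A F -> (forall i, separable (dual (E i))) -> approximable A E F.
Proof.
move=> Aext As RN Es.
pose X m (i : 'I_n) : completeNormedModType K := if (i < m)%N then E i else c0 K nat.
suff h m : (m <= n)%N -> approximable A (X m) F.
  have := h n (leqnn n); congr (approximable A _ F).
  by apply/funext => i; rewrite /X ltn_ord.
elim: m => [_|m IHm mn].
  have := approximable_c0 RN; congr (approximable A _ F).
apply: (@approximable_step _ _ A (X m.+1) (X m) F (Ordinal mn)) => //.
- move=> i im; rewrite /X ltnS [(i <= m)%N]leq_eqVlt.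
  by rewrite (_ : (i == m :> nat) = false)//; exact/negbTE.
- by rewrite /X /= ltnn; exact: c0_is_c0_like.
- by rewrite /X /= ltnSn; exact: Es.
- exact: IHm (ltnW mn).
Qed.

End Density.

(** * The square ordering *)

Lemma size_square_block k : size (square_block k) = (2 * k).+1.
Proof. by rewrite size_cat !size_map size_rev !size_iota; lia. Qed.

Lemma size_square_blocks k : size (flatten [seq square_block l | l <- iota 0 k]) = (k * k)%N.
Proof.
elim: k => // k IHk; rewrite -addn1 iotaD map_cat flatten_cat size_cat IHk add0n.
by rewrite (_ : flatten _ = square_block k ++ [::])// cats0 size_square_block; lia.
Qed.

Lemma nth_square_block k u : (u <= 2 * k)%N ->
  nth (0, 0)%N (square_block k) u = if (u <= k)%N then (u, k) else (k, 2 * k - u)%N.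
Proof.
move=> u2; rewrite nth_cat size_map size_iota ltnS; case: leqP => uk.
  by rewrite (nth_map 0%N) ?size_iota ?ltnS// nth_iota// ltnS.
rewrite (nth_map 0%N) ?size_rev ?size_iota; last by lia.
rewrite nth_rev ?size_iota; last by lia.
by rewrite nth_iota; [congr pair|]; lia.
Qed.

Lemma square2E k u : (u <= 2 * k)%N ->
  square2 (k * k + u) = if (u <= k)%N then (u, k) else (k, 2 * k - u)%N.
Proof.
move=> u2; rewrite /square2; have -> : (k * k + u).+1 = (k + (k * k + u - k).+1)%N by nia.
rewrite iotaD map_cat flatten_cat nth_cat size_square_blocks.
rewrite ifF ?ltnNge ?leq_addr// addKn add0n [flatten _](_ : _ = square_block k ++
  flatten [seq square_block l | l <- iota k.+1 (k * k + u - k)])//.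
rewrite nth_cat size_square_block ifT ?ltnS//.
exact: nth_square_block.
Qed.

Lemma square_decomp t : exists k u, (u <= 2 * k)%N /\ t = (k * k + u)%N.
Proof.
elim: t => [|t [k [u [u2 ->]]]]; first by exists 0%N, 0%N.
have [uk|ku] := ltnP u (2 * k); first by exists k, u.+1; split=> //; lia.
by exists k.+1, 0%N; split=> //; nia.
Qed.

Lemma square2_surj i j : exists t, square2 t = (i, j).
Proof.
have [ij|ji] := leqP i j.
  by exists (j * j + i)%N; rewrite square2E ?ij//; lia.
exists (i * i + (2 * i - j))%N; rewrite square2E; last by lia.
by rewrite ifF; [congr pair; lia|apply/negbTE; rewrite -ltnNge; lia].
Qed.

Lemma square_ltn k u l v : (u <= 2 * k)%N -> (v <= 2 * l)%N ->
  (l * l + v < k * k + u)%N = (l < k)%N || (l == k) && (v < u)%N.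
Proof.
move=> u2 v2; have [lk|kl|->] := ltngtP l k => /=.
- by apply/idP; nia.
- by apply/negbTE; rewrite -leqNgt; nia.
- by rewrite ltn_add2l.
Qed.

Lemma size_square_order m t : size (square_order m t) = m.+1.
Proof. by elim: m t => //= m IHm t; rewrite size_rcons IHm. Qed.

Lemma square_order_surj m s : size s = m.+1 -> exists t, square_order m t = s.
Proof.
elim: m s => [[|a []]// _|m IHm s]; first by exists a.
case/lastP: s => // s a; rewrite size_rcons => -[/IHm[i <-]].
by have [t ti] := square2_surj i a; exists t; rewrite /= ti.
Qed.

Section SquareProjections.
Variables (K : scalarField) (X : normedModType K).

Definition proj_family (P : nat -> X -> X) (C : K) :=
  (forall N x y a, P N (a *: x + y) = a *: P N x + P N y) /\
  (forall N x, `|P N x| <= C * `|x|).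

(** The projection for the first t pairs in the square ordering comes from rectangles:
    with t = k * k + u, these pairs form the square of the indices below k, the first
    pairs of the last column, and those of the last row that are reached after it. *)
Lemma square_projections (S P : nat -> X -> X) (C1 C2 : K) :
  0 <= C1 -> 0 <= C2 -> proj_family S C1 -> proj_family P C2 ->
  exists (Q : nat -> X -> X) (C : K), [/\ 0 <= C, proj_family Q C &
    forall t r b, (forall i, S i b = if ((square2 r).1 < i)%N then b else 0) ->
      (forall j, P j b = if ((square2 r).2 < j)%N then b else 0) ->
      Q t b = if (r < t)%N then b else 0].
Proof.
move=> C10 C20 [Sl SC] [Pl PC].
have /choice[ku kuP] t : exists ku : nat * nat,
    (ku.2 <= 2 * ku.1)%N /\ t = (ku.1 * ku.1 + ku.2)%N.
  by have [k [u]] := square_decomp t; exists (k, u).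
pose k t := (ku t).1; pose u t := (ku t).2.
pose row t x := P (k t) x - P (minn (k t) ((2 * k t).+1 - u t)%N) x.
pose Q t x := S (k t) (P (k t) x) + S (minn (u t) (k t).+1) (P (k t).+1 x - P (k t) x) +
  (S (k t).+1 (row t x) - S (k t) (row t x)).
have SB i x y : S i (x - y) = S i x - S i y.
  by have := Sl i y x (-1); rewrite !scaleN1r addrC => ->; rewrite addrC.
exists Q, (C1 * C2 + C1 * (C2 + C2) + (C1 * (C2 + C2) + C1 * (C2 + C2))); split.
- by rewrite !addr_ge0// mulr_ge0// addr_ge0.
- split=> [t x y a|t x].
    have rowl : row t (a *: x + y) = a *: row t x + row t y.
      by rewrite /row !Pl scalerBr opprD addrACA.
    have coll : P (k t).+1 (a *: x + y) - P (k t) (a *: x + y) =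
        a *: (P (k t).+1 x - P (k t) x) + (P (k t).+1 y - P (k t) y).
      by rewrite !Pl scalerBr opprD addrACA.
    rewrite /Q rowl coll Pl !Sl !scalerDr scalerN opprD.
    by rewrite [in RHS]addrACA [X in X + _ = _]addrACA [X in _ + X = _]addrACA.
  have rowle : `|row t x| <= (C2 + C2) * `|x|.
    by rewrite mulrDl (le_trans (ler_normB _ _))// lerD.
  have colle : `|P (k t).+1 x - P (k t) x| <= (C2 + C2) * `|x|.
    by rewrite mulrDl (le_trans (ler_normB _ _))// lerD.
  have SP i (z : X) c : `|z| <= c * `|x| -> `|S i z| <= C1 * c * `|x|.
    by move=> zc; rewrite (le_trans (SC _ _))// -mulrA ler_wpM2l.
  rewrite /Q !mulrDl (le_trans (ler_normD _ _))// lerD//.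
    by rewrite (le_trans (ler_normD _ _))// lerD// SP.
  by rewrite (le_trans (ler_normB _ _))// lerD// SP.
move=> t r b Sb Pb.
have S0 i : S i 0 = 0 by rewrite -[0 in LHS](subrr (0 : X)) SB subrr.
have [ut te] := kuP t; rewrite -/(k t) -/(u t) in ut te.
have [l [v [vl re]]] := square_decomp r.
move: Sb Pb; rewrite re; case r12E : (square2 _) => [r1 r2] /= Sb Pb.
have r12 : (v <= l)%N /\ r1 = v /\ r2 = l \/ (l < v)%N /\ r1 = l /\ r2 = (2 * l - v)%N.
  by move: r12E; rewrite square2E//; case: leqP => h [<- <-]; [left|right].
have Sif c i : S i (if c then b else 0) = if c then S i b else 0 by case: c.
rewrite /Q /row !SB !Pb !Sif !Sb {Sb Pb Sif r12E}.
rewrite [in RHS]te square_ltn//.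
case E2 : (r2 < k t)%N; case E3 : (r2 < (k t).+1)%N;
  case E4 : (r2 < minn (k t) ((2 * k t).+1 - u t))%N; case E1 : (r1 < k t)%N;
  case E5 : (r1 < minn (u t) (k t).+1)%N; case E6 : (r1 < (k t).+1)%N;
  case EL : ((l < k t)%N || (l == k t) && (v < u t)%N);
  rewrite ?(subr0, subrr, addr0, add0r, oppr0)//; exfalso; lia.
Qed.

(** Recursion on m: the pairs consist of the index of the first entries in their square
    ordering and of the last entry. *)
Lemma square_order_projections (b : seq nat -> X) (P : nat -> nat -> X -> X) (C : K) m :
  0 <= C -> (forall d, proj_family (P d) C) ->
  (forall d N s, (d <= m)%N -> P d N (b s) = if (nth 0%N s d < N)%N then b s else 0) ->
  exists (Q : nat -> X -> X) (C' : K), [/\ 0 <= C', proj_family Q C' &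
    forall t r w, Q t (b (square_order m r ++ w)) =
      if (r < t)%N then b (square_order m r ++ w) else 0].
Proof.
move=> C0 PC; elim: m => [|m IHm] Pb.
  by exists (P 0%N), C; split=> // t r w; rewrite Pb.
have [|S [C' [C'0 SC' Sb]]] := IHm; first by move=> d N s dm; apply: Pb; exact: leqW.
have [Q [C'' [C''0 QC'' Qb]]] := square_projections C'0 C0 SC' (PC m.+1).
exists Q, C''; split=> // t r w /=; case r12 : (square2 r) => [r1 r2] /=.
rewrite cat_rcons; apply: Qb => j; rewrite r12 /=; first exact: Sb.
by rewrite Pb// nth_cat size_square_order ltnn subnn.
Qed.

End SquareProjections.

(** * Closed linear hulls *)

Section LinearHull.
Variable K : scalarField.

Definition lin_closed (X : normedModType K) (W : set X) :=
  subspace_closed W /\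
  forall x, (forall d : K, 0 < d -> exists2 y, W y & `|x - y| <= d) -> W x.

(** The intersection of the closed subspaces containing B: membership is used as an
    induction principle. *)
Definition lin_hull (X : normedModType K) (B : set X) : set X :=
  [set x | forall W, lin_closed W -> B `<=` W -> W x].

Lemma lin_hull_closed (X : normedModType K) (B : set X) : lin_closed (lin_hull B).
Proof.
split=> [|x h W Wc BW].
  split=> [W [[W0 _] _] _|a u v uB vB W Wc BW]; first exact: W0.
  by have [[_ WD] _] := Wc; apply: WD; [exact: uB|exact: vB].
have [_ Wl] := Wc; apply: Wl => d d0; have [y yB xy] := h d d0.
by exists y => //; exact: yB.
Qed.

Lemma lin_hull_sub (X : normedModType K) (B : set X) : B `<=` lin_hull B.
Proof. by move=> x Bx W _; exact. Qed.

Lemma lin_closed_sum (X : normedModType K) (W : set X) (I : Type) (s : seq I) (v : I -> X) :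
  lin_closed W -> (forall i, W (v i)) -> W (\sum_(i <- s) v i).
Proof.
move=> [[W0 WD] _] Wv; elim: s => [|i s IHs]; first by rewrite big_nil.
by rewrite big_cons -[v i]scale1r; exact: WD.
Qed.

Lemma lin_closedZ (X : normedModType K) (W : set X) a v : lin_closed W -> W v -> W (a *: v).
Proof. by move=> [[W0 WD] _] Wv; rewrite -[_ *: _]addr0; exact: WD. Qed.

Lemma lin_closed_lim (X : normedModType K) (W : set X) (u : nat -> X) x :
  lin_closed W -> u @ \oo --> x -> (forall i, W (u i)) -> W x.
Proof.
move=> [_ Wl] ux Wu; apply: Wl => d d0.
have /cvgrPdist_le/(_ _ d0)[N _ /(_ N (leqnn N))/= h] := ux.
by exists (u N).
Qed.

Lemma lin_hull_image (X Z : normedModType K) (L : {linear X -> Z}) (C : K)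
    (B : set X) (W : set Z) x : (forall y, `|L y| <= C * `|y|) -> lin_closed W ->
  (forall y, B y -> W (L y)) -> lin_hull B x -> W (L x).
Proof.
move=> LC [[W0 WD] Wl] BW /(_ [set y | W (L y)]); apply=> //; split.
  split=> [|a u v /= uW vW] /=; first by rewrite linear0.
  by rewrite linearP; exact: WD.
move=> y /= h; apply: Wl => d d0.
have C1 : 0 < `|C| + 1 by rewrite ltr_wpDl.
have [z Wz yz] := h _ (divr_gt0 d0 C1); exists (L z) => //.
rewrite -linearB (le_trans (LC _))//.
have [->|nz] := eqVneq (y - z) 0; first by rewrite normr0 mulr0 ltW.
have C0 : 0 <= C by have := le_trans (normr_ge0 _) (LC (y - z)); rewrite pmulr_lge0 ?normr_gt0.
apply: (@le_trans _ _ ((`|C| + 1) * (d / (`|C| + 1)))).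
  by rewrite ler_pM// (ger0_norm C0) lerDl.
by rewrite mulrC divfK// gt_eqF.
Qed.

(** The uniform bound lets the convergence pass to limits of vectors. *)
Lemma lin_closed_cvg (X : normedModType K) (P : nat -> X -> X) (C : K) : 0 <= C ->
  (forall N, linear (P N)) -> (forall N x, `|P N x| <= C * `|x|) ->
  lin_closed [set x | P N x @[N --> \oo] --> x].
Proof.
move=> C0 Pl PC; split.
  have P0 N : P N 0 = 0 by have := Pl N (-1) 0 0; rewrite scaler0 addr0 scaleN1r addNr.
  split=> [|a u v /= Pu Pv] /=.
    by under eq_fun do rewrite P0; exact: cvg_cst.
  by under eq_fun do rewrite Pl; apply: cvgD => //; apply: cvgZr.
move=> x h; apply/cvgrPdist_le => d d0.
have C2 : 0 < C + 2 by rewrite ltr_wpDl.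
have e0 := divr_gt0 d0 C2.
have [y /= /cvgrPdist_le/(_ _ e0)[N _ hN] xy] := h _ e0.
exists N => // M NM.
have PB : P M (x - y) = P M x - P M y.
  by rewrite (addrC x) -(scaleN1r y) Pl scaleN1r addrC.
rewrite (_ : x - P M x = (x - y) + (y - P M y) - P M (x - y)); last first.
  by rewrite PB opprB !subrKA.
rewrite (le_trans (ler_normB _ _))//.
apply: (@le_trans _ _ (d / (C + 2) + d / (C + 2) + C * (d / (C + 2)))).
  rewrite lerD//; last by rewrite (le_trans (PC _ _))// ler_wpM2l.
  by rewrite (le_trans (ler_normD _ _))// lerD// hN.
rewrite (_ : _ + C * _ = (C + 2) * (d / (C + 2))); last by ring.
by rewrite mulrC divfK// gt_eqF.
Qed.

Lemma basis_hull (X : completeNormedModType K) (e : nat -> X) x :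
  schauder_basis e -> lin_hull (range e) x.
Proof.
move=> eb; have [a [ax _]] := eb x; have hc := @lin_hull_closed X (range e).
apply: (lin_closed_lim hc ax) => N; apply: (lin_closed_sum _ hc) => j.
by apply: (lin_closedZ _ hc); apply: lin_hull_sub; exists j.
Qed.

Lemma lin_hull_range (X : normedModType K) (b : nat -> X) x : lin_hull (range b) x ->
  forall d : K, 0 < d -> exists N (a : nat -> K), `|x - \sum_(j < N) a j *: b j| <= d.
Proof.
pose D := [set x | forall d : K, 0 < d ->
  exists N (a : nat -> K), `|x - \sum_(j < N) a j *: b j| <= d].
have ext N M (a : nat -> K) : \sum_(j < N) a j *: b j =
    \sum_(j < N + M) (if (j < N)%N then a j else 0) *: b j.
  rewrite big_split_ord /= [X in _ + X]big1 ?addr0 => [|j _].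
    by apply: eq_bigr => j _; rewrite ltn_ord.
  by rewrite ltnNge leq_addr scale0r.
move=> /(_ D); apply=> [|_ [t _ <-] d d0]; last first.
  exists t.+1, (fun j => (j == t)%:R).
  rewrite (bigD1 ord_max)//= eqxx scale1r big1 ?addr0 ?subrr ?normr0 ?ltW// => i it.
  by rewrite (_ : (i == t :> nat) = false) ?scale0r//; exact/negbTE.
split.
  split=> [d d0|c u v ub vb d d0].
    by exists 0%N, (fun=> 0); rewrite big_ord0 subrr normr0 ltW.
  have C0 : 0 < `|c| + 1 by rewrite ltr_wpDl.
  have d2 : 0 < d / 2 by rewrite divr_gt0.
  have [N [a ua]] := ub _ (divr_gt0 d2 C0).
  have [M [a' va]] := vb _ d2.
  exists (N + M)%N, (fun j => c * (if (j < N)%N then a j else 0) +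
                              (if (j < M)%N then a' j else 0)).
  rewrite (eq_bigr (fun j : 'I_(N + M) => c *: ((if (j < N)%N then a j else 0) *: b j) +
      (if (j < M)%N then a' j else 0) *: b j)); last first.
    by move=> j _; rewrite scalerDl scalerA.
  rewrite big_split /= -scaler_sumr -ext (addnC N) -ext opprD addrACA -scalerBr.
  rewrite (le_trans (ler_normD _ _))// [leRHS]splitr lerD// normrZ.
  apply: (@le_trans _ _ ((`|c| + 1) * (d / 2 / (`|c| + 1)))).
    by rewrite ler_pM// lerDl.
  by rewrite mulrC divfK// gt_eqF.
move=> y h d d0; have d2 : 0 < d / 2 by rewrite divr_gt0.
have [z zD yz] := h _ d2; have [N [a za]] := zD _ d2; exists N, a.
by rewrite -(subrKA z) (le_trans (ler_normD _ _))// [leRHS]splitr lerD.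
Qed.

End LinearHull.

(** * Elementary operators and monomials *)

Section Monomials.
Variables (K : scalarField) (n : nat) (A : ideal K n).
Variables (E : 'I_n -> completeNormedModType K) (F : completeNormedModType K).
Implicit Types (phi : forall i, dual (E i)) (y : F).

Definition elem phi y : A E F :=
  to_bs (ideal_sub A E F) (elementary_op (fun i => \val (phi i)) y).

Lemma elemE phi y : \val (elem phi y) = elementary_op (fun i => \val (phi i)) y.
Proof.
by have [U UE _] := elementary_in_ideal A phi y; rewrite /elem -UE to_bsE//; exact: bs_valP.
Qed.

Lemma elem_le phi y : `|elem phi y| <= (\prod_i `|phi i|) * `|y|.
Proof.
have [U UE Ule] := elementary_in_ideal A phi y.
by rewrite (_ : elem phi y = U)//; apply: bs_ext; rewrite elemE UE.
Qed.

Lemma elem_linear_vec phi : linear (elem phi).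
Proof.
move=> a u v; apply: ideal_ext => x; rewrite bs_valD bs_valZ !elemE.
rewrite -[RHS]/(a *: (_ *: u) + _ *: v) /elementary_op scalerDr !scalerA.
by congr (_ *: _ + _); rewrite mulrC.
Qed.

Lemma elem_linear_fun phi y (k : 'I_n) : linear (fun psi => elem (dfwith phi k psi) y).
Proof.
have E1 psi x : \val (elem (dfwith phi k psi) y) x =
    (\val psi (x k) * \prod_(i | i != k) \val (phi i) (x i)) *: y.
  rewrite elemE /elementary_op (bigD1 k)//= dfwithin; congr ((_ * _) *: _).
  by apply: eq_bigr => i ik; rewrite dfwithout// eq_sym.
move=> a u v; apply: ideal_ext => x; rewrite bs_valD bs_valZ.
rewrite -[RHS]/(a *: \val (elem (dfwith phi k u) y) x + \val (elem (dfwith phi k v) y) x).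
by rewrite !E1 dual_valD dual_valZ scalerA -scalerDl mulrDl mulrA.
Qed.

(** Elementary operators are limits of those with factors in linearly dense sets,
    replacing one factor at a time. *)
Lemma elem_hull (B : forall i, set (dual (E i))) (BF : set F) phi y :
  (forall i psi, lin_hull (B i) psi) -> (forall z, lin_hull BF z) ->
  lin_hull [set elem p.1 p.2 | p in [set p : (forall i, dual (E i)) * F |
    (forall i, B i (p.1 i)) /\ BF p.2]] (elem phi y).
Proof.
move=> Bd BFd; set W := lin_hull _; have Wc : lin_closed W := lin_hull_closed _.
suff h m : (m <= n)%N -> forall phi, (forall i : 'I_n, (m <= i)%N -> B i (phi i)) ->
    W (elem phi y).
  by apply: (h n (leqnn n)) => i; rewrite leqNgt ltn_ord.
elim: m => [_ {}phi phiB|m IHm mn {}phi phiB].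
  have [L LE] := exists_linear (elem_linear_vec phi).
  rewrite -LE; apply: (@lin_hull_image _ _ _ L (\prod_i `|phi i|) BF) => // z.
    by rewrite LE; exact: elem_le.
  by move=> zB; rewrite LE; apply: lin_hull_sub; exists (phi, z) => //; split=> // i; exact: phiB.
have [L LE] := exists_linear (@elem_linear_fun phi y (Ordinal mn)).
rewrite (_ : phi = dfwith phi (Ordinal mn) (phi (Ordinal mn))); last first.
  apply: functional_extensionality_dep => i.
  by have [->|im] := eqVneq i (Ordinal mn); rewrite ?dfwithin// dfwithout// eq_sym.
rewrite -LE; apply: (@lin_hull_image _ _ _ L
    ((\prod_(i | i != Ordinal mn) `|phi i|) * `|y|) (B (Ordinal mn))) => //.
  move=> psi; rewrite LE (le_trans (elem_le _ _))// (bigD1 (Ordinal mn))//= dfwithin.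
  rewrite -mulrA mulrC ler_wpM2r// ler_wpM2r//.
  rewrite le_eqVlt; apply/orP; left; apply/eqP; apply: eq_bigr => i im.
  by rewrite dfwithout// eq_sym.
move=> psi psiB; rewrite LE; apply: IHm; first exact: ltnW.
move=> i mi; have [->|im] := eqVneq i (Ordinal mn); first by rewrite dfwithin.
rewrite dfwithout 1?eq_sym//; apply: phiB; rewrite ltn_neqAle mi andbT eq_sym.
by rewrite -(inj_eq val_inj) /= in im.
Qed.

(** The projections of the factors combine into those for the square ordering, and the
    closed span of the monomials contains all elementary operators. *)
Lemma monomials_basis_of_projections (e' : forall i, nat -> dual (E i)) (f : nat -> F)
    (P : option 'I_n -> nat -> A E F -> A E F) (C : K) :
  0 <= C -> (forall o, proj_family (P o) C) ->
  (forall k N phi y j, phi k = e' k j ->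
     P (Some k) N (elem phi y) = if (j < N)%N then elem phi y else 0) ->
  (forall N phi l, P None N (elem phi (f l)) = if (l < N)%N then elem phi (f l) else 0) ->
  (forall i j, e' i j != 0) -> (forall l, f l != 0) ->
  (forall i psi, lin_hull (range (e' i)) psi) -> (forall z, lin_hull (range f) z) ->
  approximable A E F -> monomials_basis A e' f.
Proof.
move=> C0 PC Pe Pf e0 f0 ed fd app.
pose M (s : seq nat) : A E F := elem (fun i => e' i (nth 0%N s i)) (f (nth 0%N s n)).
have ME s : \val (M s) = monomial e' f s by rewrite elemE.
pose b t := M (square_order n t).
exists b => [t|]; first exact: ME.
have M0 s : M s != 0.
  apply/eqP => /(congr1 val) Ms0.
  have xx i : exists x, \val (e' i (nth 0%N s i)) x != 0.
    apply: contrapT => /forallNP h; move/eqP: (e0 i (nth 0%N s i)); apply.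
    by apply: dual_ext => x; apply/eqP/negPn/negP; exact: h.
  pose x i := sval (cid (xx i)).
  have xP i : \val (e' i (nth 0%N s i)) (x i) != 0 := svalP (cid (xx i)).
  have : \val (M s) x = 0 by rewrite Ms0.
  rewrite ME => /eqP; rewrite scaler_eq0 (negbTE (f0 _)) orbF.
  by apply/negP/prodf_neq0 => i _; exact: xP.
pose P' (d : nat) := P (insub d : option 'I_n).
have P'M d N s : (d <= n)%N -> P' d N (M s) = if (nth 0%N s d < N)%N then M s else 0.
  rewrite leq_eqVlt => /orP[/eqP ->|dn].
    by rewrite /P' insubF ?ltnn//; exact: Pf.
  rewrite /P' (@insubT _ (fun i => i < n)%N 'I_n d dn).
  exact: (Pe (Ordinal dn)).
have [Q [C' [C'0 [Ql QC] QM]]] :=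
  @square_order_projections K (A E F) M P' C n C0 (fun d => PC (insub d)) P'M.
apply: (@basis_of_projections _ _ b Q C') => //.
- by move=> t; exact: M0.
- by move=> t r; have := QM t r [::]; rewrite cats0.
move=> T; apply: lin_hull_range.
have [Wsub Wlim] := lin_hull_closed (range b).
apply: Wlim => d d0; have [S [s SE] TS] := app T d d0; exists S => //.
have -> : S = \sum_(p <- s) elem p.1 p.2.
  apply: bs_ext; rewrite SE bs_val_sum; apply: eq_bigr => p _.
  by rewrite elemE.
have hc := @lin_hull_closed K (A E F) (range b).
apply: (lin_closed_sum _ hc) => p W Wc bW.
apply: (elem_hull p.1 p.2 ed fd Wc) => _ [[phi y] /= [phiB [l _ <-]]] <-.
have [j phij] : exists j : 'I_n -> nat, forall i, phi i = e' i (j i).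
  by have /choice[j jP] : forall i, exists j, phi i = e' i j;
    [move=> i; have [j _ <-] := phiB i; exists j|exists j].
pose w := rcons [seq j i | i <- enum 'I_n] l.
have sw : size w = n.+1 by rewrite size_rcons size_map size_enum_ord.
have [t tw] := square_order_surj sw.
apply: bW; exists t => //; rewrite /b tw /M.
rewrite (_ : nth 0%N w n = l); last by rewrite nth_rcons size_map size_enum_ord ltnn eqxx.
congr elem; apply: functional_extensionality_dep => i.
rewrite nth_rcons size_map size_enum_ord ltn_ord (nth_map i) ?size_enum_ord//.
by rewrite nth_ord_enum phij.
Qed.

End Monomials.

(** * Projections acting on the ideal *)

Section BasisData.
Variables (K : scalarField) (n : nat) (A : ideal K n).
Variables (E : 'I_n -> completeNormedModType K).

(** None stands for the range and Some k for the k-th variable: P N keeps the monomials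
    whose basis vector in that factor has an index below N, and kills the others. *)
Definition acts_on_monomials (F : completeNormedModType K) (e' : forall i, nat -> dual (E i))
    (f : nat -> F) (o : option 'I_n) (P : nat -> A E F -> A E F) : Prop :=
  match o with
  | Some k => forall N (phi : forall i, dual (E i)) (y : F) j, phi k = e' k j ->
      P N (elem A phi y) = if (j < N)%N then elem A phi y else 0
  | None => forall N (phi : forall i, dual (E i)) l,
      P N (elem A phi (f l)) = if (l < N)%N then elem A phi (f l) else 0
  end.

Lemma exists_projections (F : completeNormedModType K) (U : nat -> A E F -> A E F -> Prop)
    (C : K) :
  (forall N T, exists2 V, U N T V & `|V| <= C * `|T|) ->
  (forall N S T VS VT V a, U N S VS -> U N T VT -> U N (a *: S + T) V ->
     V = a *: VS + VT) ->
  exists2 P : nat -> A E F -> A E F, proj_family P C & forall N T, U N T (P N T).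
Proof.
move=> exU Ulin; pose P N T := sval (cid2 (exU N T)).
have PU N T : U N T (P N T) by rewrite /P; case: cid2.
exists P => //; split=> [N S T a|N T]; first exact: Ulin (PU N S) (PU N T) (PU N _).
by rewrite /P; case: cid2.
Qed.

Lemma indicator_sum (X : normedModType K) (N j : nat) (v : nat -> X) :
  \sum_(i < N) ((i == j :> nat)%:R : K) *: v i = if (j < N)%N then v j else 0.
Proof.
have [jN|Nj] := ltnP j N.
  rewrite (bigD1 (Ordinal jN))//= eqxx scale1r big1 ?addr0// => i ij.
  by rewrite (_ : (i == j :> nat) = false) ?scale0r//; exact/negbTE.
rewrite big1// => i _; rewrite (_ : (i == j :> nat) = false) ?scale0r//.
by apply/negbTE; rewrite ltn_eqF// (leq_trans (ltn_ord i)).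
Qed.

Section Range.
Variables (F : completeNormedModType K) (f : nat -> F) (c : nat -> dual F) (C : K).
Hypothesis C0 : 0 <= C.
Hypothesis fC : forall N y, `|\sum_(l < N) \val (c l) y *: f l| <= C * `|y|.
Hypothesis cf : forall i j, \val (c i) (f j) = (i == j)%:R.

Lemma range_projections : exists2 P : nat -> A E F -> A E F, proj_family P C &
  forall N T x, \val (P N T) x = \sum_(l < N) \val (c l) (\val T x) *: f l.
Proof.
apply: (@exists_projections F (fun N T V =>
  forall x, \val V x = \sum_(l < N) \val (c l) (\val T x) *: f l)) => [N T|].
  have [S SE] : exists S : {linear F -> F}, forall y, S y = \sum_(l < N) \val (c l) y *: f l.
    apply: exists_linear => a u v; rewrite scaler_sumr -big_split /=.
    by apply: eq_bigr => l _; rewrite dualD dualZ scalerDl scalerA.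
  have SC y : `|S y| <= C * `|y| by rewrite SE; exact: fC.
  have id1 i (x : E i) : `|(idfun : {linear E i -> E i}) x| <= 1 * `|x| by rewrite mul1r.
  have [V VE Vle] := ideal_compose T C0 SC (fun=> ler01) id1.
  exists V => [x|]; first by rewrite VE SE.
  by apply: le_trans Vle _; rewrite big1// mulr1.
move=> N S T VS VT V a VSE VTE VE; apply: ideal_ext => x.
rewrite bs_valD bs_valZ -[RHS]/(a *: \val VS x + \val VT x) VE VSE VTE.
rewrite bs_valD bs_valZ -[(_ + _) x]/(a *: \val S x + \val T x).
rewrite scaler_sumr -big_split /=; apply: eq_bigr => l _.
by rewrite dualD dualZ scalerDl scalerA.
Qed.

Lemma range_projections_act (e' : forall i, nat -> dual (E i)) : exists2 P : nat -> A E F -> A E F,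
  proj_family P C & acts_on_monomials e' f None P.
Proof.
have [P PC PE] := range_projections; exists P => // N phi l.
apply: ideal_ext => x; rewrite PE elemE /elementary_op; set a := \prod_i _.
rewrite (eq_bigr (fun i : 'I_N => a *: (((i == l :> nat)%:R : K) *: f i))); last first.
  by move=> i _; rewrite dualZ cf scalerA.
rewrite -scaler_sumr indicator_sum; case: ifP => _; first by rewrite elemE.
by rewrite scaler0.
Qed.

End Range.

(** In the k-th variable, the basis projections of the dual are the adjoints of
    operators into the bidual, which act through the Arens extension. *)
Lemma dual_projections_act (F : completeNormedModType K) (f : nat -> F)
    (e' : forall i, nat -> dual (E i)) (k : 'I_n) :
  arens_stable A F -> schauder_basis (e' k) ->
  exists (P : nat -> A E F -> A E F) (C : K), [/\ 0 <= C, proj_family P C &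
    acts_on_monomials e' f (Some k) P].
Proof.
move=> As eb; have [c [C [C0 eC _ ce]]] := basis_coordinates eb.
have exR N : exists R : {linear E k -> bidual (E k)}, forall x (psi : dual (E k)),
    \val (R x) psi = \val (\sum_(j < N) \val (c j) psi *: e' k j) x.
  have Rd x : dual_set (fun psi : dual (E k) =>
      \val (\sum_(j < N) \val (c j) psi *: e' k j) x : K^o).
    apply: (@dual_intro _ _ _ (C * `|x|)) => [a u v|psi].
      rewrite -[RHS]/(a * _ + _) -dual_valZ -dual_valD; congr (\val _ x).
      rewrite scaler_sumr -big_split /=; apply: eq_bigr => l _.
      by rewrite dualD dualZ scalerDl scalerA.
    by rewrite mulrAC (le_trans (ler_dual _ _))// ler_wpM2r.
  have Rl : linear (fun x => to_dual (fun psi : dual (E k) =>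
      \val (\sum_(j < N) \val (c j) psi *: e' k j) x : K^o) : bidual (E k)).
    move=> a u v; apply: dual_ext => psi.
    by rewrite dual_valD dual_valZ !to_dualE// dualD dualZ.
  by have [R RE] := exists_linear Rl; exists R => x psi; rewrite RE to_dualE.
have /choice[R RE] := exR.
have RC N x : `|R N x| <= C * `|x|.
  apply: dual_le => [|psi]; first exact: mulr_ge0.
  by rewrite RE mulrAC (le_trans (ler_dual _ _))// ler_wpM2r.
have id1 i (x : E i) : `|(idfun : {linear E i -> E i}) x| <= 1 * `|x| by rewrite mul1r.
pose pulled N (T V : A E F) := forall x (y' : dual F), \val y' (\val V x) =
  \val (R N (x k)) (to_dual (fun z => \val y' (\val T (dfwith x k z)) : K^o)).
have exV N (T : A E F) : exists2 V, pulled N T V & `|V| <= C * `|T|.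
  exact: (@arens_pull _ _ A E E F k (fun i => idfun) (R N) C T As id1 C0 (RC N)).
have [|P PC PE] := exists_projections exV.
  move=> N S T VS VT V a VSE VTE VE; apply: ideal_ext => x; apply: dual_separates => y'.
  rewrite bs_valD bs_valZ -[(_ + _) x]/(a *: \val VS x + \val VT x).
  rewrite dualD dualZ VE VSE VTE -dualZ -dualD; congr (\val _ _).
  apply: dual_ext => z; rewrite dual_valD dual_valZ.
  rewrite !to_dualE; [|exact: ideal_slot..].
  by rewrite bs_valD bs_valZ -[(_ + _) (dfwith x k z)]/(a *: \val S _ + \val T _) dualD dualZ.
exists P, C; split=> // N phi y j phij; apply: ideal_ext => x; apply: dual_separates => y'.
rewrite PE; pose t := \val y' y * \prod_(i | i != k) \val (phi i) (x i).
have -> : to_dual (fun z => \val y' (\val (elem A phi y) (dfwith x k z)) : K^o) = t *: e' k j.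
  apply: dual_ext => z; rewrite to_dualE; last exact: ideal_slot.
  by rewrite elemE dfwith_elementary dualZ phij dual_valZ /t mulrC (mulrC (\val (e' k j) z)) mulrA.
rewrite RE (eq_bigr (fun i : 'I_N => t *: (((i == j :> nat)%:R : K) *: e' k i))); last first.
  by move=> i _; rewrite dualZ ce scalerA.
rewrite -scaler_sumr indicator_sum; case: ifP => _; last first.
  by rewrite scaler0 dual0.
rewrite dual_valZ elemE /elementary_op dualZ (bigD1 k)//= phij /t.
by rewrite [RHS]mulrC -!mulrA; congr (_ * _); exact: mulrC.
Qed.

End BasisData.

Section DomainProjections.
Variables (K : scalarField) (n : nat) (A : ideal K n).
Variables (E : 'I_n -> completeNormedModType K).
Variables (e : forall i, nat -> E i) (e' : forall i, nat -> dual (E i)) (C : 'I_n -> K).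
Hypothesis C0 : forall i, 0 <= C i.
Hypothesis eC : forall i N x, `|\sum_(j < N) \val (e' i j) x *: e i j| <= C i * `|x|.
Hypothesis ee : forall i j l, \val (e' i j) (e i l) = (j == l)%:R.

Let exP i N : exists P : {linear E i -> E i}, forall x,
  P x = \sum_(j < N) \val (e' i j) x *: e i j.
Proof.
apply: exists_linear => a u v; rewrite scaler_sumr -big_split /=.
by apply: eq_bigr => j _; rewrite dualD dualZ scalerDl scalerA.
Qed.

Let Pe i N : {linear E i -> E i} := sval (cid (exP i N)).

Let PeE i N x : Pe i N x = \sum_(j < N) \val (e' i j) x *: e i j.
Proof. exact: svalP (cid (exP i N)) x. Qed.

Let PeC i N x : `|Pe i N x| <= C i * `|x|. Proof. by rewrite PeE; exact: eC. Qed.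

Let e'P i j N x : \val (e' i j) (Pe i N x) = if (j < N)%N then \val (e' i j) x else 0.
Proof.
rewrite PeE dual_sum.
rewrite (eq_bigr (fun l : 'I_N => ((l == j :> nat)%:R : K) *: (\val (e' i l) x : K^o))).
  exact: (@indicator_sum K K^o N j (fun l => \val (e' i l) x)).
by move=> l _; rewrite dualZ ee eq_sym [LHS]mulrC.
Qed.

Lemma domain_projections_act (F : completeNormedModType K) (f : nat -> F) (k : 'I_n) :
  exists (P : nat -> A E F -> A E F) (D : K), [/\ 0 <= D, proj_family P D &
    acts_on_monomials e' f (Some k) P].
Proof.
pose R N : forall i, {linear E i -> E i} :=
  dfwith (fun i => idfun : {linear E i -> E i}) k (Pe k N).
pose cR i : K := if i == k then C k else 1.
have cR0 i : 0 <= cR i by rewrite /cR; case: ifP.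
have RC N i x : `|R N i x| <= cR i * `|x|.
  rewrite /R /cR; move: x; have [->|ik] := eqVneq i k => x; first by rewrite dfwithin; exact: PeC.
  by rewrite dfwithout 1?eq_sym//= mul1r.
have id1 y : `|(idfun : {linear F -> F}) y| <= 1 * `|y| by rewrite mul1r.
have exV N (T : A E F) : exists2 V : A E F,
    forall x, \val V x = \val T (fun i => R N i (x i)) & `|V| <= C k * `|T|.
  have [V VE Vle] := ideal_compose T ler01 id1 cR0 (RC N); exists V => //.
  apply: le_trans Vle _; rewrite mul1r mulrC (bigD1 k)//= big1 ?mulr1.
    by rewrite /cR eqxx.
  by move=> i ik; rewrite /cR (negbTE ik).
have [|P PC PE] := exists_projections exV.
  move=> N S T VS VT V a VSE VTE VE; apply: ideal_ext => x.
  by rewrite bs_valD bs_valZ -[RHS]/(a *: \val VS x + \val VT x) VE VSE VTE bs_valD bs_valZ.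
exists P, (C k); split=> // N phi y j phij; apply: ideal_ext => x.
rewrite PE elemE /elementary_op (bigD1 k)//= {1}/R dfwithin phij e'P.
rewrite (eq_bigr (fun i => \val (phi i) (x i))); last first.
  by move=> i ik; rewrite /R dfwithout// eq_sym.
case: ifP => _; last by rewrite mul0r scale0r.
by rewrite elemE /elementary_op [in RHS](bigD1 k)//= phij.
Qed.

Lemma domain_projections (F : completeNormedModType K) :
  exists2 P : nat -> A E F -> A E F, proj_family P (\prod_i C i) & forall N T x,
    \val (P N T) x = \val T (fun i => \sum_(j < N) \val (e' i j) (x i) *: e i j).
Proof.
have id1 y : `|(idfun : {linear F -> F}) y| <= 1 * `|y| by rewrite mul1r.
apply: (@exists_projections _ _ _ _ F (fun N T V => forall x,
    \val V x = \val T (fun i => \sum_(j < N) \val (e' i j) (x i) *: e i j))) => [N T|].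
  have [V VE Vle] := ideal_compose T ler01 id1 C0 (fun i => @PeC i N); exists V => [x|].
    rewrite VE /=; congr (\val T _).
    by apply: functional_extensionality_dep => i; rewrite PeE.
  by apply: le_trans Vle _; rewrite mul1r mulrC.
move=> N S T VS VT V a VSE VTE VE; apply: ideal_ext => x.
by rewrite bs_valD bs_valZ -[RHS]/(a *: \val VS x + \val VT x) VE VSE VTE bs_valD bs_valZ.
Qed.

(** An operator composed with finite rank projections is of finite type: its variables
    are expanded one at a time, the first m ones being replaced by basis vectors. *)
Lemma finite_rank_finite_type (F : completeNormedModType K) (T : A E F) N :
  finite_type (fun x => \val T (fun i => \sum_(j < N) \val (e' i j) (x i) *: e i j)).
Proof.
have [Tm _] := ideal_mult (bs_valP T).
pose pt m (s : 'I_n -> nat) (x : forall i, E i) : forall i, E i := fun i =>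
  if (i < m)%N then e i (s i) else \sum_(j < N) \val (e' i j) (x i) *: e i j.
pose cf m (s : 'I_n -> nat) (x : forall i, E i) : K :=
  \prod_(i < n | (i < m)%N) \val (e' i (s i)) (x i).
suff h d m : (m + d)%N = n -> forall s, finite_type (fun x => cf m s x *: \val T (pt m s x)).
  have := h n 0%N erefl (fun=> 0%N); congr finite_type; apply/funext => x.
  by rewrite /cf big_pred0 ?scale1r.
elim: d m => [m|d IHd m md s].
  rewrite addn0 => -> s.
  exists [:: (fun i => e' i (s i), \val T (fun i => e i (s i)))]; rewrite big_seq1.
  apply/funext => x; rewrite /elementary_op /cf [in LHS](eq_bigl xpredT) => [|i];
    last exact: ltn_ord.
  congr (_ *: \val T _); apply: functional_extensionality_dep => i.
  by rewrite /pt ltn_ord.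
have mn : (m < n)%N by rewrite -md addnS ltnS leq_addr.
pose k := Ordinal mn.
pose sj j : 'I_n -> nat := fun i => if i == k then j else s i.
rewrite (_ : (fun x => _) = \sum_(j < N) (fun x => cf m.+1 (sj j) x *: \val T (pt m.+1 (sj j) x))).
  by apply: finite_type_sum => j; apply: IHd; rewrite addSnnS.
apply/funext => x; rewrite fct_sumE.
have -> : pt m s x = dfwith (pt m s x) k (\sum_(j < N) \val (e' k j) (x k) *: e k j).
  apply: functional_extensionality_dep => i.
  have [->|ik] := eqVneq i k; last by rewrite dfwithout// eq_sym.
  by rewrite dfwithin /pt /= ltnn.
have [L LE] := exists_linear (Tm k (pt m s x)).
rewrite -LE linear_sum scaler_sumr; apply: eq_bigr => j _.
rewrite linearZ /= LE scalerA; congr (_ *: \val T _).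
  rewrite /cf [RHS](bigD1 k) ?ltnSn//= /sj eqxx mulrC; congr (_ * _).
  apply: eq_big => [i|i im].
    rewrite ltnS (leq_eqVlt i m) -(inj_eq val_inj) /=.
    by case: (ltngtP i m).
  by rewrite ifF//; apply/negbTE; rewrite -(inj_eq val_inj) /= ltn_eqF.
apply: functional_extensionality_dep => i.
have [->|ik] := eqVneq i k; first by rewrite dfwithin /pt /= ltnSn /sj eqxx.
rewrite dfwithout 1?eq_sym// /pt /sj (negbTE ik) ltnS (leq_eqVlt i m).
by rewrite (_ : (i == m :> nat) = false)//; exact/negbTE.
Qed.

Hypothesis e'_total : forall i psi, lin_hull (range (e' i)) psi.

(** Density for values in the bidual of F descends to F. The operators T composed with
    the basis projections of the variables have values in F and are of finite type; they
    converge to T because they do as operators into the bidual, whose norm is equivalent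
    to that of F on operators of finite type, thanks to the projections of F extended to
    its bidual. *)
Lemma approximable_bidual (F : completeNormedModType K) (f : nat -> F) :
  schauder_basis f -> approximable A E (bidual F) -> approximable A E F.
Proof.
move=> fb app; have [c [Cf [Cf0 fC _ cf]]] := basis_coordinates fb.
have prodC0 : 0 <= \prod_i C i by apply: prodr_ge0 => i _; exact: C0.
have id1 i (x : E i) : `|(idfun : {linear E i -> E i}) x| <= 1 * `|x| by rewrite mul1r.
(* operators with values in F, seen as operators into its bidual *)
have Jd (y : F) : dual_set (fun phi : dual F => \val phi y : K^o).
  apply: (@dual_intro _ _ _ `|y|) => [a u v|phi]; first by rewrite dual_valD dual_valZ.
  by rewrite mulrC ler_dual.
have Jl : linear (fun y => to_dual (fun phi : dual F => \val phi y : K^o) : bidual F).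
  move=> a u v; apply: dual_ext => phi.
  by rewrite dual_valD dual_valZ !to_dualE// dualD dualZ.
have [J JE] := exists_linear Jl.
have J1 y : `|J y| <= 1 * `|y|.
  by apply: dual_le => [|phi]; rewrite mul1r// JE to_dualE// mulrC ler_dual.
have exJ (T : A E F) : exists2 V : A E (bidual F), forall x, \val V x = J (\val T x) &
    `|V| <= 1 * `|T|.
  have [V VE Vle] := ideal_compose T ler01 J1 (fun=> ler01) id1; exists V => //.
  by apply: le_trans Vle _; rewrite big1// mulr1.
pose jA T := sval (cid2 (exJ T)).
have jAE T x : \val (jA T) x = J (\val T x) by rewrite /jA; case: cid2.
have jAle T : `|jA T| <= 1 * `|T| by rewrite /jA; case: cid2.
have jAB S T : jA (S - T) = jA S - jA T.
  apply: ideal_ext => x; rewrite jAE !bs_valB -[RHS]/(\val (jA S) x - \val (jA T) x) !jAE.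
  exact: linearB.
have jAinj S T : jA S = jA T -> S = T.
  move=> ST; apply: ideal_ext => x; apply: dual_separates => phi.
  have : \val (jA S) x = \val (jA T) x by rewrite ST.
  by rewrite !jAE => /(congr1 (fun z : bidual F => \val z phi)); rewrite !JE !to_dualE.
(* the basis projections of F are defined on its bidual and have values in F: this is
   how norms in F are recovered from norms in the bidual *)
have St_l M : linear (fun z : bidual F => \sum_(l < M) \val z (c l) *: f l).
  move=> a u v; rewrite scaler_sumr -big_split /=; apply: eq_bigr => l _.
  by rewrite -[(_ + _) (c l)]/(a * \val u (c l) + \val v (c l)) scalerDl scalerA.
have St_le M (z : bidual F) : `|\sum_(l < M) \val z (c l) *: f l| <= Cf * `|z|.
  have [phi phi1 phiz] := norming_functional (\sum_(l < M) \val z (c l) *: f l).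
  apply: le_trans phiz _.
  rewrite (_ : \val phi _ = \val z (\sum_(l < M) \val phi (f l) *: c l)); last first.
    by rewrite !dual_sum; apply: eq_bigr => l _; rewrite !dualZ mulrC.
  apply: le_trans (ler_dual _ _) _; rewrite mulrC ler_wpM2r//.
  apply: dual_le => // y.
  rewrite (_ : \val _ y = \val phi (\sum_(l < M) \val (c l) y *: f l)); last first.
    rewrite dual_val_sum dual_sum; apply: eq_bigr => l _.
    by rewrite dual_valZ dualZ mulrC.
  apply: le_trans (ler_dual _ _) _; rewrite -[leRHS]mul1r ler_pM//.
have [Q QC QE] := @range_projections _ _ A E F f c Cf Cf0 fC.
have Q_jA M T : `|Q M T| <= Cf * `|jA T|.
  have [S SE] := exists_linear (St_l M).
  have SC z : `|S z| <= Cf * `|z| by rewrite SE; exact: St_le.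
  have [V VE Vle] := ideal_compose (jA T) Cf0 SC (fun=> ler01) id1.
  rewrite (_ : Q M T = V); first by apply: le_trans Vle _; rewrite big1// mulr1.
  apply: ideal_ext => x; rewrite QE VE /= jAE SE; apply: eq_bigr => l _.
  by rewrite JE to_dualE.
have [Ql QlC] := QC.
have compare (S : A E F) : finite_type (\val S) -> `|S| <= Cf * `|jA S|.
  move=> [s Ss].
  have Wc := @lin_closed_cvg _ _ Q Cf Cf0 (fun N a u v => Ql N u v a) QlC.
  have SE : S = \sum_(p <- s) elem A p.1 p.2.
    by apply: bs_ext; rewrite Ss bs_val_sum; apply: eq_bigr => p _; rewrite elemE.
  have QS : Q M S @[M --> \oo] --> S.
    rewrite SE.
    apply: (lin_closed_sum _ Wc) => p.
    apply: (@elem_hull _ _ A E F (fun=> setT) (range f) p.1 p.2 _ _ _ Wc) => //.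
    - by move=> i psi; apply: lin_hull_sub.
    - by move=> z; exact: basis_hull.
    move=> _ [[phi y] /= [_ [l _ <-]]] <-; apply/cvgrPdist_lt => d d0.
    exists l.+1 => // M /= lM; rewrite (_ : Q M _ = elem A phi (f l)) ?subrr ?normr0//.
    apply: ideal_ext => x; rewrite QE elemE /elementary_op; set a := \prod_i _.
    rewrite (eq_bigr (fun i : 'I_M => a *: (((i == l :> nat)%:R : K) *: f i))); last first.
      by move=> i _; rewrite dualZ cf scalerA.
    by rewrite -scaler_sumr indicator_sum lM.
  by apply: (@cvg_norm_le _ _ _ _ _ _ _ _ QS); apply: nearW => M; exact: Q_jA.
(* the operators S for which R N S tends to S form a closed subspace, which contains the
   elementary operators with factors in the sequences e' i *)
have [R RC RE] := domain_projections (bidual F).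
have [Rl RlC] := RC.
have Rcvg (S : A E (bidual F)) : R N S @[N --> \oo] --> S.
  have Wc := @lin_closed_cvg _ _ R _ prodC0 (fun N a u v => Rl N u v a) RlC.
  have [_ Wlim] := Wc; apply: Wlim => d d0.
  have [S' [s S's] SS'] := app S d d0; exists S' => //.
  have -> : S' = \sum_(p <- s) elem A p.1 p.2.
    by apply: bs_ext; rewrite S's bs_val_sum; apply: eq_bigr => p _; rewrite elemE.
  apply: (lin_closed_sum _ Wc) => p.
  apply: (@elem_hull _ _ A E (bidual F) (fun i => range (e' i)) setT p.1 p.2 e'_total _ _ Wc).
    by move=> z; apply: lin_hull_sub.
  move=> _ [[phi y] /= [phiB _]] <-; apply/cvgrPdist_lt => r r0.
  have /choice[j phij] i : exists j, e' i j = phi i by have [j _ <-] := phiB i; exists j.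
  exists (\sum_i (j i).+1)%N => // N /= jN.
  rewrite (_ : R N _ = elem A phi y) ?subrr ?normr0//.
  apply: ideal_ext => x; rewrite RE !elemE; congr (_ *: _); apply: eq_bigr => i _.
  rewrite -PeE -phij e'P ifT//; apply: leq_trans jN.
  by rewrite (bigD1 i)//= leq_addr.
move=> T d d0; have [P PC PE] := domain_projections F.
have jP N : jA (P N T) = R N (jA T).
  by apply: ideal_ext => x; rewrite jAE PE RE jAE.
have Pft N : finite_type (\val (P N T)).
  by have := @finite_rank_finite_type F T N; congr finite_type; apply/funext => x; rewrite PE.
have PTcvg : cvg (P N T @[N --> \oo]).
  apply: cauchy_cvg; apply: cauchy_exP => r r0.
  have C1 : 0 < Cf + 1 by rewrite ltr_wpDl.
  have r3 : 0 < r / (Cf + 1) / 2 by rewrite !divr_gt0.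
  have /cvgrPdist_lt/(_ _ r3)[N0 _ hN] := Rcvg (jA T).
  exists (P N0 T), N0 => // N /= NN; rewrite -ball_normE /=.
  have ft : finite_type (\val (P N0 T - P N T)).
    rewrite bs_valB -scaleN1r; apply: finite_typeD => //; exact: finite_typeZ.
  apply: le_lt_trans (compare _ ft) _; rewrite jAB !jP.
  apply: (@le_lt_trans _ _ (Cf * (r / (Cf + 1)))); last first.
    by rewrite mulrCA gtr_pMr// ltr_pdivrMr// mul1r ltrDl ltr01.
  rewrite ler_wpM2l// -(subrKA (jA T)) (le_trans (ler_normD _ _))// distrC.
  by rewrite [leRHS]splitr lerD//; apply/ltW/hN => /=.
move/cvg_ex : PTcvg => [S PS].
have ST : S = T.
  apply: jAinj; apply: normed_lim_unique (Rcvg (jA T)).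
  apply/cvgrPdist_le => r r0; have /cvgrPdist_le/(_ _ r0) := PS.
  apply: filterS => N; rewrite -jP -jAB => /(le_trans _); apply.
  by apply: le_trans (jAle _) _; rewrite mul1r.
have /cvgrPdist_le/(_ _ d0)[N _ /(_ N (leqnn N))/= TN] := PS.
by exists (P N T); [exact: Pft|rewrite ST in TN].
Qed.

End DomainProjections.

(** * Separability of the dual *)

Lemma rat_dense (R : realType) (x d : R) : 0 < d -> exists r : rat, `|x - ratr r| <= d.
Proof.
move=> d0; have xd : x < x + d by rewrite ltrDl.
have [r] := rat_in_itvoo xd; rewrite in_itv /= => /andP[xr rx]; exists r.
by rewrite distrC ger0_norm ?subr_ge0 ?(ltW xr)// lerBlDl ltW.
Qed.

Lemma scalar_separable (K : scalarField) :
  exists q : nat -> K, forall x (d : K), 0 < d -> exists i, `|x - q i| <= d.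
Proof.
case: K => _ [R|R] /=.
  exists (fun i => if @unpickle rat i is Some r then ratr r else 0) => x d d0.
  by have [r xr] := rat_dense x d0; exists (pickle r); rewrite pickleK.
exists (fun i => if @unpickle (rat * rat)%type i is Some r
  then (ratr r.1 +i* ratr r.2)%C else 0) => -[a b] d d0.
have d2 : 0 < complex.Re d / 2.
  by move: d0; case: d => x y; rewrite ltcE /= => /andP[_ ?]; rewrite divr_gt0.
have [r ar] := rat_dense a d2; have [s bs] := rat_dense b d2.
exists (pickle (r, s)); rewrite pickleK.
have -> : d = (complex.Re d)%:C%C.
  by move: d0; case: (d) => x y; rewrite ltcE /= => /andP[/eqP -> _].
rewrite normc_def lecR /= [X in _ <= X]splitr.
apply: le_trans (lerD ar bs).
rewrite -[leRHS](ger0_norm (addr_ge0 (normr_ge0 _) (normr_ge0 _))).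
rewrite -[leRHS]sqrtr_sqr ler_sqrt ?sqr_ge0//.
rewrite [leRHS]sqrrD -!normrX !(ger0_norm (sqr_ge0 _)) addrAC lerDl.
by rewrite mulrn_wge0// mulr_ge0.
Qed.

(** Combinations with coefficients in a countable dense set of scalars. *)
Lemma separable_of_total (K : scalarField) (X : normedModType K) (e : nat -> X) :
  (forall x, lin_hull (range e) x) -> separable X.
Proof.
move=> ed; have [q qd] := scalar_separable K.
pose v (s : seq nat) : X := \sum_(j < size s) q (nth 0%N s j) *: e j.
exists (fun i => if @unpickle (seq nat) i is Some s then v s else 0).
apply/seteqP; split=> // x _; apply/closure_normP => d d0.
have d2 : 0 < d / 2 by rewrite divr_gt0.
have [N [a xa]] := lin_hull_range (ed x) d2.
have d8 j : 0 < d / 8 * 2^-1 ^+ j / (`|e j| + 1).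
  by rewrite divr_gt0 ?mulr_gt0 ?divr_gt0 ?exprn_gt0// ltr_wpDl.
have /choice[i iP] j : exists i, `|a j - q i| <= d / 8 * 2^-1 ^+ j / (`|e j| + 1).
  exact: qd (d8 j).
pose s := mkseq i N; exists (v s); first by exists (pickle s) => //; rewrite pickleK.
rewrite -(subrKA (\sum_(j < N) a j *: e j)); apply: le_lt_trans (ler_normD _ _) _.
have vE : v s = \sum_(j < N) q (i j) *: e j.
  by rewrite /v size_mkseq; apply: eq_bigr => j _; rewrite nth_mkseq.
have h : `|\sum_(j < N) a j *: e j - v s| <= d / 8 * 2.
  rewrite vE -sumrB; apply: le_trans (ler_norm_sum _ _ _) _.
  apply: (@le_trans _ _ (\sum_(j < N) d / 8 * 2^-1 ^+ j)).
    apply: ler_sum => j _; rewrite -scalerBl normrZ.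
    apply: (@le_trans _ _ (d / 8 * 2^-1 ^+ j / (`|e j| + 1) * (`|e j| + 1))).
      by rewrite ler_pM// lerDl.
    by rewrite divfK// gt_eqF// ltr_wpDl.
  by rewrite -mulr_sumr ler_wpM2l ?geometric_sum_le// divr_ge0// ltW.
apply: le_lt_trans (lerD xa h) _.
rewrite [ltRHS](_ : d = d / 2 + d / 8 * 2 + d / 4); last by field.
by rewrite ltrDl divr_gt0.
Qed.

Lemma schauder_basis_neq0 (K : scalarField) (X : completeNormedModType K) (e : nat -> X) j :
  schauder_basis e -> e j != 0.
Proof.
move=> /basis_coordinates[c [_ [_ _ _ ce]]]; apply/eqP => ej.
by have /eqP := ce j j; rewrite ej dual0 eqxx eq_sym oner_eq0.
Qed.

Lemma proj_family_le (K : scalarField) (X : normedModType K) (P : nat -> X -> X) (C D : K) :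
  C <= D -> proj_family P C -> proj_family P D.
Proof.
move=> CD [Pl PC]; split=> // N x; apply: le_trans (PC N x) _.
exact: ler_wpM2r.
Qed.

(** The range is the same in both parts of the theorem: its basis projections act by
    composition. *)
Lemma monomials_basis_of_actions (K : scalarField) (n : nat) (A : ideal K n)
    (E : 'I_n -> completeNormedModType K) (F : completeNormedModType K)
    (e' : forall i, nat -> dual (E i)) (f : nat -> F) :
  (forall k, exists (P : nat -> A E F -> A E F) (C : K), [/\ 0 <= C, proj_family P C &
     acts_on_monomials e' f (Some k) P]) ->
  schauder_basis f -> (forall i j, e' i j != 0) ->
  (forall i psi, lin_hull (range (e' i)) psi) ->
  approximable A E F -> monomials_basis A e' f.
Proof.
move=> actE fb e0 ed app.
have exP (o : option 'I_n) : exists PC : (nat -> A E F -> A E F) * K,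
    [/\ 0 <= PC.2, proj_family PC.1 PC.2 & acts_on_monomials e' f o PC.1].
  case: o => [k|]; first by have [P [C PC]] := actE k; exists (P, C).
  have [c [C [C0 fC _ cf]]] := basis_coordinates fb.
  have [P PC Pf] := range_projections_act A C0 fC cf e'.
  by exists (P, C).
have [PC PCP] := choice exP.
apply: (@monomials_basis_of_projections _ _ A E F e' f (fun o => (PC o).1)
  (\sum_o (PC o).2)) => //.
- by apply: sumr_ge0 => o _; case: (PCP o).
- move=> o; have [_ + _] := PCP o; apply: proj_family_le.
  rewrite (bigD1 o)//= lerDl; apply: sumr_ge0 => o' _; by case: (PCP o').
- by move=> k; case: (PCP (Some k)).
- by case: (PCP None).
- by move=> l; exact: schauder_basis_neq0.
- by move=> z; exact: basis_hull.
Qed.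

(** * The theorem *)

Theorem theorem2p10 (K : scalarField) (n : nat) (n_gt0 : (0 < n)%N)
    (A : ideal K n) (E : 'I_n -> completeNormedModType K)
    (F : completeNormedModType K) :
  extendible A ->
  (forall (e' : forall i, nat -> dual (E i)) (f : nat -> F),
     arens_stable A F -> radon_nikodym A F ->
     (forall i, schauder_basis (e' i)) -> schauder_basis f ->
     monomials_basis A e' f) /\
  (forall (e : forall i, nat -> E i) (e' : forall i, nat -> dual (E i))
          (f : nat -> F),
     arens_stable A (bidual F) -> radon_nikodym A (bidual F) ->
     bounded_approximation (bidual F) ->
     (forall i, schauder_basis (e i)) -> (forall i, shrinking (e i)) ->
     (forall i, coordinate_functionals (e i) (e' i)) -> schauder_basis f ->
     monomials_basis A e' f).
Proof.
move=> Aext; split=> [e' f As RN eb fb|e e' f As RN _ eb shr coo fb].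
  have ed i psi : lin_hull (range (e' i)) psi by exact: basis_hull.
  apply: monomials_basis_of_actions => //.
  - by move=> k; exact: dual_projections_act.
  - by move=> i j; exact: schauder_basis_neq0.
  - by apply: approximable_separable => // i; exact: separable_of_total.
have ed i psi : lin_hull (range (e' i)) psi.
  have hc := @lin_hull_closed K (dual (E i)) (range (e' i)).
  have [_ hlim] := hc; apply: hlim => d d0.
  have : closure [set phi : dual (E i) | exists N (a : nat -> K),
      phi = \sum_(j < N) a j *: e' i j] psi by rewrite shr.
  move=> /closure_normP/(_ _ d0)[_ [N [a ->]] /ltW psia].
  exists (\sum_(j < N) a j *: e' i j) => //.
  apply: (lin_closed_sum _ hc) => j; apply: (lin_closedZ _ hc).
  by apply: lin_hull_sub; exists j.
have exC i : exists C : K, [/\ 0 <= C,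
    forall N x, `|\sum_(j < N) \val (e' i j) x *: e i j| <= C * `|x|
    & forall j l, \val (e' i j) (e i l) = (j == l)%:R].
  have [c [C [C0 eC ec ce]]] := basis_coordinates (eb i).
  have e'c j : e' i j = c j.
    apply: dual_ext => x; have [a [_ au]] := eb i x.
    have a1 := au (fun j => \val (e' i j) x) (coo i x).
    have a2 := au (fun j => \val (c j) x) (ec x).
    by have := congr1 (fun g : nat -> K => g j) (etrans (esym a1) a2).
  exists C; split=> // [N x|j l]; last by rewrite e'c ce.
  rewrite (eq_bigr (fun j : 'I_N => \val (c j) x *: e i j)) => [|j _]; first exact: eC.
  by rewrite e'c.
have [C CP] := choice exC.
have C0 i : 0 <= C i by case: (CP i).
have eC i N x : `|\sum_(j < N) \val (e' i j) x *: e i j| <= C i * `|x|.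
  by case: (CP i).
have ee i j l : \val (e' i j) (e i l) = (j == l)%:R by case: (CP i).
apply: monomials_basis_of_actions => //.
- by move=> k; exact: domain_projections_act C0 eC ee F f k.
- move=> i j; apply/eqP => e'0; have /eqP := ee i j j.
  by rewrite e'0 eqxx eq_sym oner_eq0.
- apply: (@approximable_bidual _ _ A E e e' C C0 eC ee ed F f fb).
  by apply: approximable_separable => // i; exact: separable_of_total.
Qed.
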